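(* Assume that $\|X_0\|_\infty<\infty$ and that $X_0$ is $\mathcal F_0$-measurable. Assume in addition that $$\sum_{n=1}^{\infty} n^{-3/2}\,\|\mathbf E(S_n\mid\mathcal F_0)\|_\infty<\infty ,$$ and that there exists $\sigma^2\ge 0$ with $$\lim_{n\to\infty}\big\|n^{-1}\mathbf E(S_n^2\mid\mathcal F_0)-\sigma^2\big\|_\infty=0 .$$ Then, for every sequence $(a_n)$ of positive numbers with $a_n\to0$ and $na_n\to\infty$, the normalized partial sums processes $W_n$ satisfy the moderate deviation principle in $D([0,1])$ with speed $a_n$ and good rate function $I_\sigma$.
   Context: Setting: $(\Omega,\mathcal A,\mathbf P)$ is a probability space, $T:\Omega\to\Omega$ is a bijective bimeasurable transformation preserving $\mathbf P$, $\mathcal F_0\subseteq\mathcal A$ is a sub-$\sigma$-field with $\mathcal F_0\subseteq T^{-1}(\mathcal F_0)$, and $\mathcal F_i=T^{-i}(\mathcal F_0)$ for $i\in\mathbf Z$. $X_0$ is a real centered random variable ($\mathbf E(X_0)=0$) and $X_i=X_0\circ T^i$, $i\in\mathbf Z$. Put $S_n=\sum_{j=1}^n X_j$ and $W_n(t)=n^{-1/2}\sum_{i=1}^{[nt]}X_i$, $t\in[0,1]$ ($[\cdot]$ is the integer part). $\|\cdot\|_\infty$ is the essential supremum norm with respect to $\mathbf P$. $D([0,1])$ is the space of right-continuous functions on $[0,1]$ with left-hand limits, with the Skorohod topology. $(W_n)$ satisfies the moderate deviation principle (MDP) in $D([0,1])$ with speed $a_n$ and good rate function $I$ if $\{x: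 I(x)\le\alpha\}$ is compact for every $\alpha<\infty$ and, for every Borel set $\Gamma\subseteq D([0,1])$ with interior $\Gamma^0$ and closure $\bar\Gamma$, $$-\inf_{x\in\Gamma^0}I(x)\le\liminf_n a_n\log\mathbf P(\sqrt{a_n}\,W_n\in\Gamma)\le\limsup_n a_n\log\mathbf P(\sqrt{a_n}\,W_n\in\Gamma)\le-\inf_{x\in\bar\Gamma}I(x).$$ For $\sigma>0$, $I_\sigma(h)=\frac1{2\sigma^2}\int_0^1(h'(u))^2\,du$ if $h(0)=0$ and $h$ is absolutely continuous, and $I_\sigma(h)=\infty$ otherwise. For $\sigma=0$, $I_0(h)=0$ if $h\equiv0$ and $I_0(h)=\infty$ otherwise. *)

(* Defs.v *)
From HB Require Import structures.
From mathcomp Require Import all_boot all_order all_algebra.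
From mathcomp Require Import all_classical all_reals all_analysis.
Set Implicit Arguments.
Unset Strict Implicit.
Unset Printing Implicit Defensive.
Import Order.TTheory GRing.Theory Num.Theory.
Import numFieldNormedType.Exports.
Local Open Scope classical_set_scope.
Local Open Scope ring_scope.

Section skorohod_space.
Context {R : realType}.

Definition cadlag01 (f : R -> R) : Prop :=
  (forall t : R, t \in `[0, 1[ -> f s @[s --> t^'+] --> f t) /\
  (forall t : R, t \in `]0, 1] -> cvg (f s @[s --> t^'-])).

(* An element of D([0,1]) is encoded by its extension by 0 to the real line, so
   that equality in this type is equality of functions on [0,1]; the conditions
   of cadlag01 only involve the values on [0,1]. *)
Record skorohod : Type := Skorohod {
  skorohod_fun :> R -> R ;
  skorohod_cadlag : cadlag01 skorohod_fun ;
  skorohod_out : forall t : R, t \notin `[0, 1] -> skorohod_fun t = 0 }.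

HB.instance Definition _ := gen_eqMixin skorohod.
HB.instance Definition _ := gen_choiceMixin skorohod.

Definition time_change (l : R -> R) : Prop :=
  [/\ {in `[0, 1] &, {homo l : s t / s < t}},
      {within `[0, 1], continuous l} &
      l @` `[0, 1] = `[0, 1]%classic].

(* inf over time changes l of max (sup |l - id|, sup |x - y o l|) *)
Definition skorohod_dist (x y : skorohod) : \bar R :=
  ereal_inf [set e%:E | e in [set e : R | exists2 l, time_change l &
    forall t : R, t \in `[0, 1] -> `|l t - t| <= e /\ `|x t - y (l t)| <= e]].

(* Only the topology induced by the distance matters, hence the pseudometric
   structure below, whose open balls are those of skorohod_dist. *)
Definition skorohod_ball (x : skorohod) (e : R) : set skorohod :=
  [set y | (skorohod_dist x y < e%:E)%E].

Lemma skorohod_ballP x e y : skorohod_ball x e y <-> exists r, r < e /\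
  exists2 l, time_change l &
    forall t : R, t \in `[0, 1] -> `|l t - t| <= r /\ `|x t - y (l t)| <= r.
Proof.
split=> [/ereal_inf_lt[_ [r [l lt H] <-]]|[r [re [l lt H]]]].
  by rewrite lte_fin => re; exists r; split => //; exists l.
apply: (@le_lt_trans _ _ r%:E); last by rewrite lte_fin.
by apply: ereal_inf_lbound; exists r => //; exists l.
Qed.

Lemma time_change_in l t : time_change l -> t \in `[0, 1] -> l t \in `[0, 1].
Proof.
case=> _ _ lE t01; have : (l @` `[0, 1]) (l t) by exists t.
by rewrite lE.
Qed.

Lemma time_change_mk l : {in `[0, 1] &, {homo l : s t / s < t}} ->
  (forall t, t \in `[0, 1] -> l t \in `[0, 1]) ->
  (forall t, t \in `[0, 1] -> exists2 s, s \in `[0, 1] & l s = t) ->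
  time_change l.
Proof.
move=> lhomo lin lsurj.
have lmono : {in `[0, 1] &, {mono l : x y / x <= y}} by apply: le_mono_in.
have i0 : (0 : R) \in `[0, 1] by rewrite in_itv/= lexx ler01.
have i1 : (1 : R) \in `[0, 1] by rewrite in_itv/= lexx ler01.
have l0 : l 0 = 0.
  have [s s01 ls] := lsurj _ i0; apply/eqP; rewrite eq_le.
  have -> : 0 <= l 0 by have := lin _ i0; rewrite in_itv/= => /andP[].
  have : l 0 <= l s by rewrite lmono//; move: s01; rewrite in_itv/= => /andP[].
  by rewrite ls => ->.
have l1 : l 1 = 1.
  have [s s01 ls] := lsurj _ i1; apply/eqP; rewrite eq_le.
  have -> : l 1 <= 1 by have := lin _ i1; rewrite in_itv/= => /andP[].
  have : l s <= l 1 by rewrite lmono//; move: s01; rewrite in_itv/= => /andP[].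
  by rewrite ls.
split => //.
- apply: segment_inc_surj_continuous => //.
  by rewrite l0 l1 => t /lsurj[s s01 <-]; exists s.
- rewrite eqEsubset; split => [_ [t t01 <-]|t /lsurj[s s01 <-]].
    exact: lin.
  by exists s.
Qed.

Lemma time_change_id : time_change id.
Proof. by apply: time_change_mk => // t t01; exists t. Qed.

Lemma time_change_comp l m :
  time_change l -> time_change m -> time_change (m \o l).
Proof.
move=> lt mt; have li := fun t => @time_change_in l t lt.
have mi := fun t => @time_change_in m t mt.
case: lt => lh _ lE; case: mt => mh _ mE; apply: time_change_mk.
- by move=> s t s01 t01 st /=; apply: mh; rewrite ?li//; apply: lh.
- by move=> t t01 /=; rewrite mi// li.
- move=> t t01; have : (m @` `[0, 1]) t by rewrite mE.
  move=> [s s01 <-]; have : (l @` `[0, 1]) s by rewrite lE.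
  by move=> [u u01 <-]; exists u.
Qed.

Lemma time_change_inv l : time_change l ->
  exists2 m, time_change m & {in `[0, 1], cancel m l}.
Proof.
move=> lt; have li := fun t => @time_change_in l t lt.
case: lt => lh _ lE.
have lmono : {in `[0, 1] &, {mono l : x y / x <= y}} by apply: le_mono_in.
pose m s := xget 0 [set t | t \in `[0, 1] /\ l t = s].
have mP s : s \in `[0, 1] -> m s \in `[0, 1] /\ l (m s) = s.
  move=> s01; have : (l @` `[0, 1]) s by rewrite lE.
  by move=> [t t01 ts]; rewrite /m; case: xgetP => [u _ []//|/(_ t)[]].
exists m; last by move=> s /mP[].
apply: time_change_mk.
- move=> s t s01 t01 st; have [ms ls] := mP _ s01; have [mt ltt] := mP _ t01.
  by rewrite ltNge -lmono// ls ltt -ltNge.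
- by move=> s /mP[].
- move=> t t01; exists (l t); first exact: li.
  by have [ms ls] := mP _ (li _ t01); exact: (inc_inj_in lmono).
Qed.

Lemma skorohod_ball_center x (e : R) : 0 < e -> skorohod_ball x e x.
Proof.
move=> e0; apply/skorohod_ballP; exists 0; split => //.
by exists id; [exact: time_change_id|move=> t _; rewrite !subrr normr0].
Qed.

Lemma skorohod_ball_sym x y (e : R) : skorohod_ball x e y -> skorohod_ball y e x.
Proof.
move=> /skorohod_ballP[r [re [l lt H]]].
have [m mt mK] := time_change_inv lt.
apply/skorohod_ballP; exists r; split => //; exists m => // t t01.
have [H1 H2] := H _ (time_change_in mt t01).
by rewrite mK// in H1 H2; rewrite distrC H1 distrC H2.
Qed.

Lemma skorohod_ball_triangle x y z (e1 e2 : R) :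
  skorohod_ball x e1 y -> skorohod_ball y e2 z -> skorohod_ball x (e1 + e2) z.
Proof.
move=> /skorohod_ballP[r [re [l lt H]]] /skorohod_ballP[r' [re' [m mt H']]].
apply/skorohod_ballP; exists (r + r'); split; first exact: ltrD.
exists (m \o l); first exact: time_change_comp.
move=> t t01; have [H1 H2] := H _ t01.
have [H3 H4] := H' _ (time_change_in lt t01); split => /=.
- by rewrite -(subrKA (l t)) addrC (le_trans (ler_normD _ _))// lerD.
- by rewrite -(subrKA (y (l t))) (le_trans (ler_normD _ _))// lerD.
Qed.

HB.instance Definition _ := hasNbhs.Build skorohod
  (nbhs_ (entourage_ skorohod_ball)).

HB.instance Definition _ := @Nbhs_isPseudoMetric.Build R skorohod
  (entourage_ skorohod_ball) erefl skorohod_ball skorohod_ball_center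
  skorohod_ball_sym skorohod_ball_triangle erefl.

Lemma skorohod_scale_cadlag (c : R) (x : skorohod) :
  cadlag01 (fun t => c * x t).
Proof.
have [xr xl] := skorohod_cadlag x; split => t t01.
- by apply: cvgMr; exact: xr.
- by apply: is_cvgMr; exact: xl.
Qed.

Lemma skorohod_scale_out (c : R) (x : skorohod) t :
  t \notin `[0, 1] -> c * x t = 0.
Proof. by move=> /skorohod_out ->; rewrite mulr0. Qed.

Definition skorohod_scale (c : R) (x : skorohod) : skorohod :=
  Skorohod (@skorohod_scale_cadlag c x) (@skorohod_scale_out c x).

End skorohod_space.
Arguments skorohod R : clear implicits.

Section partial_sums.
Context {R : realType}.

(* n^(-1/2) (x_1 + ... + x_[nt]); the path for n = 0 is 0. *)
Definition partial_sum_path (n : nat) (x : nat -> R) (t : R) : R :=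
  if t \in `[0, 1] then
    (Num.sqrt n%:R)^-1 * \sum_(1 <= i < (Num.truncn (n%:R * t)).+1) x i
  else 0.

Lemma partial_sum_path_cadlag n (x : nat -> R) :
  cadlag01 (partial_sum_path n x).
Proof.
split => t; rewrite in_itv/= => /andP[t0 t1].
- pose k := Num.truncn (n%:R * t).
  have nt0 : 0 <= n%:R * t by rewrite mulr_ge0.
  have /andP[kt tk] : k%:R <= n%:R * t < k.+1%:R by exact: truncn_itv.
  have nsk : \forall s \near t^'+,
      n = 0%N \/ 0 < n%:R :> R /\ s < n%:R^-1 * k.+1%:R.
    have [->|n0] := eqVneq n 0%N; first by near=> s; left.
    have np : 0 < n%:R :> R by rewrite ltr0n lt0n.
    have tk' : t < n%:R^-1 * k.+1%:R by rewrite ltr_pdivlMl.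
    by near=> s; right; split => //; near: s; exact: nbhs_right_lt.
  apply: (@cvg_trans _ (cst (partial_sum_path n x t) @ t^'+)); last exact: cvg_cst.
  apply: near_eq_cvg; near=> s; rewrite /cst /partial_sum_path !in_itv/= t0 (ltW t1).
  have ts : t < s by near: s; exact: nbhs_right_gt.
  have s1 : s < 1 by near: s; exact: nbhs_right_lt.
  rewrite (ltW s1) (ltW (le_lt_trans t0 ts))/=.
  suff -> : Num.truncn (n%:R * s) = k by [].
  have sk : n = 0%N \/ 0 < n%:R :> R /\ s < n%:R^-1 * k.+1%:R by near: s.
  have ks : k%:R <= n%:R * s by rewrite (le_trans kt)// ler_wpM2l// ltW.
  apply: truncn_def; rewrite ks /=.
  case: sk => [->|[np]]; first by rewrite mul0r ltr0n.
  by rewrite ltr_pdivlMl.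
- have [->|n0] := eqVneq n 0%N.
    apply: (@is_cvg_near_cst _ _ (0 : R)); near=> s.
    rewrite /partial_sum_path mul0r truncn0 big_geq// mulr0.
    by case: ifP.
  have np : 0 < n%:R :> R by rewrite ltr0n lt0n.
  have nt0 : 0 < n%:R * t by rewrite mulr_gt0.
  have [k /andP[kt tk]] : exists k : nat, k%:R < n%:R * t <= k.+1%:R.
    pose k := Num.truncn (n%:R * t).
    have /andP[kt tk] : k%:R <= n%:R * t < k.+1%:R by exact/truncn_itv/ltW.
    move: kt; rewrite le_eqVlt => /orP[/eqP kt|kt]; last by exists k; rewrite kt ltW.
    case: k kt {tk} => [kt|k kt]; first by rewrite -kt ltxx in nt0.
    by exists k; rewrite -kt ltr_nat ltnSn lexx.
  apply: (@is_cvg_near_cst _ _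
    ((Num.sqrt n%:R)^-1 * \sum_(1 <= i < k.+1) x i)); near=> s.
  have st : s < t by near: s; exact: nbhs_left_lt.
  have ks : k%:R / n%:R < s.
    by near: s; apply: nbhs_left_gt; rewrite ltr_pdivrMr// mulrC.
  have s0 : 0 <= s by rewrite (le_trans _ (ltW ks))// divr_ge0.
  rewrite /partial_sum_path in_itv/= s0 (le_trans (ltW st) t1)/=.
  suff -> : Num.truncn (n%:R * s) = k by [].
  apply: truncn_def; rewrite mulrC -ler_pdivrMr// (ltW ks)/=.
  by rewrite mulrC (lt_le_trans _ tk)// ltr_pM2l.
Unshelve. all: by end_near. Qed.

Lemma partial_sum_path_out n (x : nat -> R) t :
  t \notin `[0, 1] -> partial_sum_path n x t = 0.
Proof. by rewrite /partial_sum_path => /negbTE ->. Qed.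

Definition partial_sum_process (n : nat) (x : nat -> R) : skorohod R :=
  Skorohod (@partial_sum_path_cadlag n x) (@partial_sum_path_out n x).

End partial_sums.

Section conditional_expectation.
Context d {Omega : measurableType d} {R : realType} (P : probability Omega R).

Definition sub_sigma_field (F : set (set Omega)) : Prop :=
  sigma_algebra setT F /\ F `<=` measurable.

Definition measurable_for (F : set (set Omega)) (Y : Omega -> R) : Prop :=
  preimage_set_system setT Y measurable `<=` F.

(* Z is a version of E(Y | F), which is only determined up to a P-null set. *)
Definition is_cond_exp (F : set (set Omega)) (Y Z : Omega -> R) : Prop :=
  [/\ measurable_for F Z, P.-integrable setT (EFin \o Z) &
    forall A, F A -> (\int[P]_(w in A) (Z w)%:E = \int[P]_(w in A) (Y w)%:E)%E].

End conditional_expectation.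

Section deviations.
Context {R : realType}.

Definition absolutely_continuous (a b : R) (f : R -> R) : Prop :=
  forall e : R, 0 < e -> exists2 r : R, 0 < r & forall (n : nat) (u v : 'I_n -> R),
    (forall i, a <= u i /\ u i <= v i /\ v i <= b) ->
    trivIset setT (fun i => `]u i, v i[%classic) ->
    \sum_(i < n) (v i - u i) < r -> \sum_(i < n) `|f (v i) - f (u i)| < e.

(* derive1 h is 0 by convention where h is not differentiable, which for absolutely
   continuous h only concerns a null set. *)
Definition rate_function (sigma : R) (h : skorohod R) : \bar R :=
  if sigma == 0 then
    if `[< forall t : R, t \in `[0, 1] -> h t = 0 >] then 0%E else +oo%E
  else if `[< h 0 = 0 /\ absolutely_continuous 0 1 h >] then
    (((2 * sigma ^+ 2)^-1)%:E *
      \int[@lebesgue_measure R]_(u in `[0%R, 1%R]) ((derive1 h u) ^+ 2)%:E)%E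
  else +oo%E.

Definition MDP d (Omega : measurableType d) (P : probability Omega R)
    (W : nat -> Omega -> skorohod R) (a : nat -> R)
    (I : skorohod R -> \bar R) : Prop :=
  (forall alpha : \bar R, (alpha < +oo)%E -> compact [set x | (I x <= alpha)%E]) /\
  forall G : set (skorohod R), <<s [set U | open U] >> G ->
    let u n := ((a n)%:E *
      lne (P [set w | G (skorohod_scale (Num.sqrt (a n)) (W n w))]))%E in
    (- ereal_inf (I @` G°) <= limn_einf u)%E /\
    (limn_einf u <= limn_esup u)%E /\
    (limn_esup u <= - ereal_inf (I @` closure G))%E.

End deviations.

(* Main.v *)
Require Import Defs.
From HB Require Import structures.
From mathcomp Require Import all_boot all_order all_algebra.
From mathcomp Require Import all_classical all_reals all_analysis.
From mathcomp Require Import measurable_realfun ess_sup_inf lra ring zify.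
Set Implicit Arguments.
Unset Strict Implicit.
Unset Printing Implicit Defensive.
Import Order.TTheory GRing.Theory Num.Theory.
Import numFieldNormedType.Exports.
Local Open Scope classical_set_scope.
Local Open Scope ring_scope.

(** The dependence hypotheses enter only through inequalities
    E(V Z) <= c E(V), for all bounded nonnegative F_0-measurable weights V.
    They express E(Z | F_0) <= c, they can be shifted in time [cond_ub_shift],
    and for exponentials of consecutive blocks they multiply [cond_ub_lsum];
    this replaces a martingale approximation.

    Moments. The bounds e_n = ||E(S_n | F_0)|| are subadditive, so that
    (N + 1) e_N <= 2 (e_0 + ... + e_N), and the summability of n^(-3/2) e_n
    gives e_N = o(sqrt N), as in Kronecker's lemma. Since E(S_n^2 | F_0) is at
    most C n, Chebyshev's inequality after the first passage above a level gives
    geometric tails for |S_m| / sqrt m [tail_geo].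

    Laplace transforms. For a block of length m with theta^2 m small,
    E(exp(theta S_m) | F_0) is exp((sigma^2 / 2 + o(1)) theta^2 m): the linear
    term is theta o(sqrt m), the quadratic term is given by the variance
    hypothesis, and the geometric tails bound the cubic remainder
    [laplace_block]. Multiplying over blocks gives the joint Laplace transform
    of the increments xi_j of sqrt(a_n) W_n over a grid of k cells, which
    to leading order is that of a Brownian motion of variance sigma^2
    [laplace_joint].

    Paths. I_sigma(x) <= r means that some nondecreasing E satisfies
    E(1) - E(0) <= 2 sigma^2 r and (x(t) - x(s))^2 <= (t - s) (E(t) - E(s))
    [rate_level]. From the rate function to E this is the fundamental theorem of
    calculus for absolutely continuous functions and the Cauchy-Schwarz
    inequality; the converse is Fatou's lemma for the slopes on a grid. In this
    form the level sets are equicontinuous and closed under pointwise limits,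
    hence compact [compact_energy], and the polygon with increments xi_j belongs
    to the level set r as soon as k (sum_j xi_j^2) <= 2 sigma^2 r
    [polygon_energy].

    Upper bound. The path stays close to its polygon, up to probabilities that
    are negligible at any exponential rate [osc_negligible], and the probability
    that k (sum_j xi_j^2) exceeds 2 sigma^2 L is bounded by Chernoff's inequality
    in finitely many directions [incr_energy_tail]. A closed set that misses the
    compact level set L is at a positive distance from it.

    Lower bound. Under the law of density proportional to
    exp(sum_j lam_j xi_j / a_n), with lam_j = k y_j / sigma^2, the increments
    concentrate at y, and this density is almost constant near y
    [incr_near_lower]; y is taken to be the increments of the target path.

    When sigma = 0, a grid of one cell shows that the path is uniformly close to
    0 outside an event that is negligible at any exponential rate. *)

(** * Expectation of bounded measurable functions *)

Section bmeas.
Context {R : realType} d (T : measurableType d).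
Implicit Types f g : T -> R.

(** Boundedness replaces the integrability conditions: all the variables below,
    exponentials included, are bounded. *)
Definition bmeas f := measurable_fun setT f /\ exists c : R, forall w, `|f w| <= c.

Lemma bmeas_ext f g : f =1 g -> bmeas f -> bmeas g.
Proof. by move=> /funext ->. Qed.

Lemma bmeas_cst c : bmeas (fun=> c).
Proof. by split; [exact: measurable_cst|exists `|c|]. Qed.

Lemma bmeasD f g : bmeas f -> bmeas g -> bmeas (fun w => f w + g w).
Proof.
move=> [mf [c fc]] [mg [c' gc]]; split; first exact: measurable_funD.
by exists (c + c') => w; rewrite (le_trans (ler_normD _ _))// lerD.
Qed.

Lemma bmeasM f g : bmeas f -> bmeas g -> bmeas (fun w => f w * g w).
Proof.
move=> [mf [c fc]] [mg [c' gc]]; split; first exact: measurable_funM.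
by exists (c * c') => w; rewrite normrM ler_pM.
Qed.

Lemma bmeasZ k f : bmeas f -> bmeas (fun w => k * f w).
Proof. by apply: bmeasM; exact: bmeas_cst. Qed.

Lemma bmeasN f : bmeas f -> bmeas (fun w => - f w).
Proof.
by move=> /(bmeasZ (-1)); apply: bmeas_ext => w; rewrite mulN1r.
Qed.

Lemma bmeasB f g : bmeas f -> bmeas g -> bmeas (fun w => f w - g w).
Proof. by move=> bf bg; apply: bmeasD => //; exact: bmeasN. Qed.

Lemma bmeas_sum I (r : seq I) (P : pred I) (F : I -> T -> R) :
  (forall i, P i -> bmeas (F i)) -> bmeas (fun w => \sum_(i <- r | P i) F i w).
Proof.
move=> bF; elim: r => [|i r IH].
  by apply: bmeas_ext (bmeas_cst 0) => w; rewrite big_nil.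
apply: (@bmeas_ext (fun w =>
    if P i then F i w + \sum_(j <- r | P j) F j w else \sum_(j <- r | P j) F j w)).
  by move=> w; rewrite big_cons.
by case: (boolP (P i)) => // Pi; apply: bmeasD => //; exact: bF.
Qed.

Lemma bmeasX f n : bmeas f -> bmeas (fun w => f w ^+ n).
Proof.
move=> bf; elim: n => [|n IH]; first exact: bmeas_cst.
by apply: bmeas_ext (bmeasM bf IH) => w; rewrite exprS.
Qed.

Lemma bmeas_norm f : bmeas f -> bmeas (fun w => `|f w|).
Proof.
move=> [mf [c fc]]; split; first exact: measurableT_comp.
by exists c => w; rewrite normr_id.
Qed.

Lemma bmeas_exp f : bmeas f -> bmeas (fun w => expR (f w)).
Proof.
move=> [mf [c fc]]; split; first exact: measurableT_comp.
exists (expR c) => w; rewrite ger0_norm ?expR_ge0// ler_expR.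
exact: le_trans (ler_norm _) (fc w).
Qed.

Lemma indic_bool (p : T -> bool) w : \1_[set w | p w] w = (p w)%:R :> R.
Proof.
rewrite indicE; case: (boolP (p w)) => pw; first by rewrite mem_set.
by rewrite memNset//; exact/negP.
Qed.

Lemma bmeas_bool (p : T -> bool) : measurable [set w | p w] ->
  bmeas (fun w => (p w)%:R).
Proof.
move=> mp; split; last by exists 1 => w; case: (p w); rewrite ?normr1 ?normr0.
rewrite (_ : (fun w => _) = \1_[set w | p w]); first exact: measurable_indic.
by apply/funext => w; rewrite indic_bool.
Qed.

Lemma bmeas_ge f (c : R) : bmeas f -> bmeas (fun w => (c <= f w)%R%:R).
Proof.
move=> [mf _]; apply: bmeas_bool; rewrite -[X in measurable X]setTI.
by apply: measurable_fun_le => //; exact: measurable_cst.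
Qed.

Lemma bmeas_lt f (c : R) : bmeas f -> bmeas (fun w => (f w < c)%R%:R).
Proof.
move=> bf; apply: bmeas_ext (bmeasB (bmeas_cst 1) (bmeas_ge c bf)) => w.
by rewrite ltNge; case: (_ <= _) => /=; rewrite ?subrr ?subr0.
Qed.

End bmeas.

Section expectation.
Context {R : realType} d (T : measurableType d) (P : probability T R).
Implicit Types f g : T -> R.

Definition Ex f : R := \int[P]_w f w.

Lemma bmeas_integrable f : bmeas f -> P.-integrable setT (EFin \o f).
Proof.
move=> [mf [c fc]]; apply: measurable_bounded_integrable => //.
  by rewrite (le_lt_trans (probability_le1 P measurableT))// ltry.
by exists c; split; [exact: num_real|move=> x cx w _; exact: le_trans (fc w) (ltW cx)].
Qed.

Lemma ExD f g : bmeas f -> bmeas g -> Ex (fun w => f w + g w) = Ex f + Ex g.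
Proof. by move=> bf bg; rewrite /Ex RintegralD//; exact: bmeas_integrable. Qed.

Lemma ExZ k f : bmeas f -> Ex (fun w => k * f w) = k * Ex f.
Proof. by move=> bf; rewrite /Ex RintegralZl//; exact: bmeas_integrable. Qed.

Lemma ExN f : bmeas f -> Ex (fun w => - f w) = - Ex f.
Proof.
move=> bf; rewrite -mulN1r -ExZ//; congr Ex.
by apply/funext => w; rewrite mulN1r.
Qed.

Lemma ExB f g : bmeas f -> bmeas g -> Ex (fun w => f w - g w) = Ex f - Ex g.
Proof. by move=> bf bg; rewrite ExD ?ExN//; exact: bmeasN. Qed.

Lemma Ex_cst k : Ex (fun=> k) = k.
Proof.
rewrite /Ex Rintegral_cst// [X in fine X](_ : _ = 1%E) ?mulr1//.
exact: probability_setT.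
Qed.

Lemma Ex_sum I (r : seq I) (p : pred I) (F : I -> T -> R) :
  (forall i, p i -> bmeas (F i)) ->
  Ex (fun w => \sum_(i <- r | p i) F i w) = \sum_(i <- r | p i) Ex (F i).
Proof.
move=> bF; elim: r => [|i r IH].
  by rewrite big_nil -[RHS](Ex_cst 0); congr Ex; apply/funext => w; rewrite big_nil.
rewrite big_cons; have [pi|pi] := boolP (p i); last first.
  by rewrite -IH; congr Ex; apply/funext => w; rewrite big_cons (negbTE pi).
rewrite -IH -ExD; [|exact: bF|exact: bmeas_sum].
by congr Ex; apply/funext => w; rewrite big_cons pi.
Qed.

Lemma le_Ex f g : bmeas f -> bmeas g -> (forall w, f w <= g w) -> Ex f <= Ex g.
Proof. by move=> bf bg fg; rewrite /Ex le_Rintegral//; exact: bmeas_integrable. Qed.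

Lemma Ex_ge0 f : (forall w, 0 <= f w) -> 0 <= Ex f.
Proof. by move=> f0; rewrite /Ex Rintegral_ge0. Qed.

Lemma Ex_bool (p : T -> bool) : measurable [set w | p w] ->
  (Ex (fun w => (p w)%:R))%:E = P [set w | p w].
Proof.
move=> mp; rewrite /Ex /Rintegral fineK; last first.
  by apply: integrable_fin_num => //; apply: (bmeas_integrable (bmeas_bool mp)).
rewrite -[X in P X]setIT -integral_indic//; apply: eq_integral => w _.
by rewrite indic_bool.
Qed.

Lemma Ex_set f (p : T -> bool) : bmeas f -> measurable [set w | p w] ->
  (\int[P]_(w in [set w | p w]) (f w)%:E)%E = (Ex (fun w => (p w)%:R * f w))%:E.
Proof.
move=> bf mp; rewrite /Ex /Rintegral fineK; last first.
  apply: integrable_fin_num => //.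
  exact: (bmeas_integrable (bmeasM (bmeas_bool mp) bf)).
rewrite [LHS]integral_mkcond; apply: eq_integral => w _.
rewrite /patch; case: ifPn; first by rewrite inE/= => ->; rewrite mul1r.
by move=> /negP; rewrite inE/= => /negP/negbTE ->; rewrite mul0r.
Qed.

Lemma Ex_preserve (tau : T -> T) f : measurable_fun setT tau ->
  (forall A, measurable A -> P (tau @^-1` A) = P A) ->
  bmeas f -> Ex (f \o tau) = Ex f.
Proof.
move=> mt Pt bf; rewrite /Ex /Rintegral; congr fine.
have := @integral_pushforward _ _ _ _ _ tau mt P setT (EFin \o f).
rewrite preimage_setT => <-//; last 2 first.
- by apply/measurable_EFinP; case: bf.
- apply: (@bmeas_integrable (f \o tau)); case: bf => mf [c fc].
  by split; [exact: measurableT_comp|exists c => w /=].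
by apply: eq_measure_integral => A mA _; rewrite /pushforward; first [exact: Pt|exact/esym/Pt].
Qed.

End expectation.

(** * Exponentials and summability *)

Section exponential_estimates.
Context {R : realType}.
Implicit Types u x y z : R.

Lemma exp_taylor2 u : `|expR u - (1 + u + u ^+ 2 / 2)| <= `|u| ^+ 3 * expR `|u|.
Proof.
pose a n : R := series (exp_coeff u) n.
have ca : a n @[n --> \oo] --> expR u by exact: is_cvg_series_exp_coeff.
have ca' : `|a n.+3 - (1 + u + u ^+ 2 / 2)| @[n --> \oo] --> `|expR u - (1 + u + u ^+ 2 / 2)|.
  apply: cvg_norm; apply: cvgB; last exact: cvg_cst.
  by have := ca; rewrite -(cvg_shiftn 3); under eq_fun do rewrite addn3.
apply: (cvgr_to_le ca').
apply: nearW => n.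
rewrite /a /series/= big_mkord 3!big_ord_recl/=.
rewrite /exp_coeff/= !expr0 !expr1 !fact0 (_ : 1`! = 1%N)// !divr1.
rewrite (_ : _ - _ = \sum_(i < n) u ^+ i.+3 / i.+3`!%:R); last first.
  rewrite (_ : bump 0 (bump 0 0) = 2%N)// (_ : 2`!%:R = 2%:R :> R)//.
  rewrite [X in _ + (_ + (_ + X)) - _](eq_bigr (fun i : 'I_n => u ^+ i.+3 / i.+3`!%:R))//.
  by ring.
apply: le_trans (ler_norm_sum _ _ _) _.
have H i : `|u ^+ i.+3 / i.+3`!%:R| <= `|u| ^+ 3 * (`|u| ^+ i / i`!%:R).
  rewrite normrM normrX normfV [`|_%:R|]ger0_norm// mulrA -exprD.
  rewrite ler_wpM2l ?exprn_ge0// lef_pV2 ?posrE ?ltr0n ?fact_gt0//.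
  by rewrite ler_nat leq_fact// -addn3 leq_addr.
apply: (@le_trans _ _ (\sum_(i < n) `|u| ^+ 3 * (`|u| ^+ i / i`!%:R))).
  by apply: ler_sum => i _; exact: H.
rewrite -mulr_sumr ler_wpM2l ?exprn_ge0//.
have nd : nondecreasing_seq (series (exp_coeff `|u|)).
  apply/nondecreasing_seqP => k; rewrite /series/= big_nat_recr//= lerDl.
  by rewrite /exp_coeff/= divr_ge0 ?exprn_ge0.
have := nondecreasing_cvgn_le nd (is_cvg_series_exp_coeff _) n.
by rewrite /series/= big_mkord.
Qed.

Lemma expR_half_le2 : expR (1 / 2) <= 2 :> R.
Proof.
have : 1 / 2 <= expR (- (1 / 2)) :> R by apply: le_trans (expR_ge1Dx _); lra.
rewrite expRN => h; rewrite -[expR _]invrK -[leRHS]invrK lef_pV2 ?posrE ?invr_gt0 ?expR_gt0//.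
lra.
Qed.

(** Exponential moments are bounded by powers of 2 with an integer exponent,
    which are finite sums of indicators. *)
Lemma expR_half_trunc z : 0 <= z -> expR (z / 2) <= 2 * 2 ^+ Num.truncn z.
Proof.
move=> z0; rewrite -exprS.
apply: (@le_trans _ _ (expR (1 / 2) ^+ (Num.truncn z).+1)).
  rewrite -expRM_natl ler_expR mulrA mulr1 ler_pM2r ?invr_gt0//.
  by rewrite ltW// truncnS_gt.
by rewrite lerXn2r ?nnegrE ?expR_ge0 ?expR_half_le2.
Qed.

Lemma expR_quarter_trunc z : 0 <= z -> expR (z / 4) <= 2 * 2 ^+ Num.truncn z.
Proof.
move=> z0; apply: le_trans (expR_half_trunc z0); rewrite ler_expR; lra.
Qed.

(** z^3 / 3! is a term of the series of exp z, and 384 = 3! 4^3. *)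
Lemma cube_expR z : 0 <= z -> z ^+ 3 <= 384 * expR (z / 4).
Proof.
move=> z0; have := @expR_ge1Dxn R (z / 4) 2 ltac:(by rewrite divr_ge0).
rewrite (_ : 3`!%:R = 6)// expr_div_n (_ : (4 : R) ^+ 3 = 64); last by ring.
lra.
Qed.

Lemma expR_le_1D y : - (1 / 2) <= y -> expR (y - 2 * y ^+ 2) <= 1 + y.
Proof.
move=> y2; have y1 : 0 < 1 + y by lra.
have H := @expR_ge1Dx R (- (y / (1 + y))).
have H1 : 1 - y / (1 + y) = (1 + y)^-1 by field; rewrite gt_eqF.
rewrite H1 expRN lef_pV2 ?posrE ?expR_gt0// in H.
apply: le_trans H; rewrite ler_expR ler_pdivlMr//.
nra.
Qed.

End exponential_estimates.

(** The first terms of the average are a constant, which is o(sqrt N); in the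
    others, j sqrt j <= (N + 1) sqrt N turns the tail of the weighted series into
    a bound. *)
Lemma kronecker_sqrt {R : realType} (e : nat -> R) :
  (forall n, 0 <= e n) ->
  (forall k : R, 0 < k -> exists J, forall N, \sum_(J <= j < N) e j / (j%:R * Num.sqrt j%:R) <= k) ->
  forall k : R, 0 < k -> exists n0, forall N, (n0 <= N)%N ->
    2 / N.+1%:R * \sum_(j < N.+1) e j <= k * Num.sqrt N%:R.
Proof.
move=> e0 He k k0.
have [J HJ] := He (k / 4) ltac:(by rewrite divr_gt0).
pose C := \sum_(0 <= j < J.+1) e j.
have C0 : 0 <= C by apply: sumr_ge0.
exists (maxn J.+1 (Num.truncn (4 * C / k)).+1) => N.
rewrite geq_max => /andP[JN CN].
have Np : 0 < N%:R :> R by rewrite ltr0n (leq_trans _ JN).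
have sN1 : 1 <= Num.sqrt N%:R :> R.
  by rewrite -[leLHS]sqrtr1 ler_wsqrtr// ler1n (leq_trans _ JN).
have CN' : C <= k / 4 * N%:R.
  rewrite -ler_pdivrMl ?divr_gt0// invf_div ltW//.
  apply: lt_le_trans (truncnS_gt _) _.
  by move: CN; rewrite -(ler_nat R); apply: le_trans; rewrite (_ : 4 / k * C = 4 * C / k)//; ring.
rewrite mulrAC ler_pdivrMr ?ltr0n// -(big_mkord xpredT) .
rewrite (big_cat_nat (n := J.+1))//=; last by rewrite ltnW.
have H2 : \sum_(J.+1 <= j < N.+1) e j <= k / 4 * (N.+1%:R * Num.sqrt N%:R).
  apply: (@le_trans _ _ (\sum_(J.+1 <= j < N.+1) (N.+1%:R * Num.sqrt N%:R) * (e j / (j%:R * Num.sqrt j%:R)))).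
    apply: ler_sum_nat => j /andP[Jj jN].
    have j0 : 0 < j%:R :> R by rewrite ltr0n (leq_trans _ Jj).
    have s0 : 0 < Num.sqrt j%:R :> R by rewrite sqrtr_gt0.
    rewrite mulrCA ler_peMr// ler_pdivlMr ?mulr_gt0// mul1r.
    apply: ler_pM; rewrite ?(ltW j0) ?(ltW s0) ?ler_nat ?(ltnW jN)//.
    by rewrite ler_wsqrtr// ler_nat -ltnS.
  rewrite -mulr_sumr mulrC ler_wpM2r// ?mulr_ge0// ?ler0n//.
  apply: le_trans (HJ N.+1).
  rewrite [leRHS](big_cat_nat (n := J.+1))//=; last by rewrite ltnW.
  rewrite lerDr big_nat1 divr_ge0// mulr_ge0//.
have : C <= k / 4 * (N.+1%:R * Num.sqrt N%:R).
  apply: le_trans CN' _; rewrite ler_wpM2l ?divr_ge0// ?(ltW k0)//.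
  by rewrite -[leLHS]mulr1 ler_pM// ler_nat.
rewrite -/C; set X := N.+1%:R * _ in H2 *.
have -> : k * Num.sqrt N%:R * N.+1%:R = k * X by rewrite /X; ring.
move=> H1; lra.
Qed.

Section summability.
Context {R : realType}.

Lemma powR_three_halves n : (n%:R : R) `^ (- (3 / 2)) = (n%:R * Num.sqrt n%:R)^-1.
Proof.
rewrite powRN; congr (_^-1); have [->|n0] := eqVneq n 0%N.
  by rewrite mul0r powR0.
have np : n%:R != 0 :> R by rewrite pnatr_eq0.
have -> : 3 / 2 = 1 + 2^-1 :> R by field.
by rewrite powRD ?np ?implybT// powRr1// powR12_sqrt.
Qed.

(** The partial sums are monotone, hence close to their supremum. *)
Lemma bounded_series_tail (u : nat -> R) (M : R) : (forall n, 0 <= u n) ->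
  (forall N, \sum_(1 <= j < N) u j <= M) ->
  forall k, 0 < k -> exists J, forall N, \sum_(J <= j < N) u j <= k.
Proof.
move=> u0 uM k k0; pose s N := \sum_(1 <= j < N) u j.
have hs : has_sup [set s N | N in [set: nat]].
  by split; [exists (s 0%N); exists 0%N|exists M => _ [N _ <-]; exact: uM].
have [_ [J _ <-] HJ] := sup_adherent k0 hs.
exists J.+1 => N; have [NJ|JN] := leqP N J.+1; first by rewrite big_geq// ltW.
have sN : s N <= sup [set s N | N in [set: nat]] by apply: ub_le_sup; [case: hs|exists N].
have J1 : s J <= s J.+1.
  rewrite /s; case: J {HJ JN} => [|J]; first by rewrite !big_geq.
  by rewrite [leRHS]big_nat_recr//= lerDl.
have : s N = s J.+1 + \sum_(J.+1 <= j < N) u j by rewrite /s (big_cat_nat (n := J.+1))// ltnW.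
by move: sN J1 HJ; lra.
Qed.

End summability.

(** * Absolutely continuous functions and their variation *)

Section interval_families.
Context {R : realType}.
Implicit Types (a b x y : R) (f g : R -> R) (L : seq (R * R)).

Definition apart (p q : R * R) := (p.2 <= q.1) || (q.2 <= p.1).

(** Nonoverlapping subintervals of [a, b] form a list, in any order, so that
    families can be cut at a point and concatenated. *)
Definition family a b L :=
  all (fun p => [&& a <= p.1, p.1 <= p.2 & p.2 <= b]) L && pairwise apart L.

Definition osc f L := \sum_(p <- L) `|f p.2 - f p.1|.

Lemma familyP a b L : reflect ((forall p, p \in L -> [/\ a <= p.1, p.1 <= p.2 & p.2 <= b]) /\
  pairwise apart L) (family a b L).
Proof.
apply: (iffP andP) => -[H1 H2]; split => //.
- by move=> p /(allP H1)/and3P.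
- by apply/allP => p /H1 /and3P.
Qed.

Lemma family_cons a b p L : family a b (p :: L) ->
  [/\ [/\ a <= p.1, p.1 <= p.2 & p.2 <= b], family a b L & forall q, q \in L -> apart p q].
Proof.
rewrite /family/= => /andP[/andP[/and3P hp hL] /andP[ha hpL]]; split => //.
- by rewrite hL.
- by move=> q /(allP ha).
Qed.

(** The other intervals lie on either side of the head of the list: recurse on
    both sides. *)
Lemma family_monotone_le (E : R -> R) a b L : {homo E : x y / x <= y} -> a <= b ->
  family a b L -> \sum_(p <- L) (E p.2 - E p.1) <= E b - E a.
Proof.
move=> hE; have [n] := ubnP (size L); elim: n L a b => // n IH [|p L] a b.
  by move=> _ ab _; rewrite big_nil subr_ge0 hE.
rewrite /= ltnS => Ln ab /family_cons[[h1 h2 h3] /familyP[hL pL] hp].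
rewrite big_cons (bigID (fun q : R * R => q.2 <= p.1))/=.
rewrite -big_filter -[X in _ + (_ + X)]big_filter.
have Hl : \sum_(q <- [seq q <- L | q.2 <= p.1]) (E q.2 - E q.1) <= E p.1 - E a.
  apply: IH => //; first by rewrite (leq_ltn_trans _ Ln)// size_filter count_size.
  apply/familyP; split; last exact: subseq_pairwise (filter_subseq _ _) pL.
  by move=> q; rewrite mem_filter => /andP[qp /hL[]].
have Hr : \sum_(q <- [seq q <- L | ~~ (q.2 <= p.1)]) (E q.2 - E q.1) <= E b - E p.2.
  apply: IH => //; first by rewrite (leq_ltn_trans _ Ln)// size_filter count_size.
  apply/familyP; split; last exact: subseq_pairwise (filter_subseq _ _) pL.
  move=> q; rewrite mem_filter => /andP[qp qL]; have [_ ? ?] := hL _ qL; split => //.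
  by move: (hp _ qL); rewrite /apart (negbTE qp) orbF.
lra.
Qed.

Lemma family_cat a b y L L' : a <= b -> b <= y -> family a b L -> family b y L' ->
  family a y (L ++ L').
Proof.
move=> ab ay /familyP[h1 p1] /familyP[h2 p2]; apply/familyP; split.
  move=> p; rewrite mem_cat => /orP[/h1[]|/h2[]] ? ? ?; split => //.
    by apply: le_trans ay.
  exact: le_trans ab _.
rewrite pairwise_cat p1 p2 !andbT; apply/allrelP => p q /h1[_ _ pb] /h2[bq _ _].
by rewrite /apart (le_trans pb bq).
Qed.

Lemma osc_cat f L L' : osc f (L ++ L') = osc f L + osc f L'.
Proof. by rewrite /osc big_cat. Qed.

(** Clamping to [a, b] cuts an interval to its part in [a, b], and composing a
    function with it extends the function by constants outside [a, b]. *)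
Definition clamp a b x := Num.max a (Num.min x b).

Lemma clamp_homo a b : {homo clamp a b : x y / x <= y}.
Proof. by move=> x y xy; rewrite /clamp ge_max le_max lexx/= le_max le_min2 ?orbT. Qed.

Lemma clamp_in a b x : a <= b -> a <= clamp a b x <= b.
Proof. by move=> ab; rewrite /clamp le_max lexx/= ge_max ab ge_min lexx orbT. Qed.

Lemma clamp_id a b x : a <= x <= b -> clamp a b x = x.
Proof. by move=> /andP[ax xb]; rewrite /clamp min_l// max_r. Qed.

Lemma clamp_split f a b y x : a <= b -> b <= y ->
  f (clamp a y x) = f (clamp a b x) + f (clamp b y x) - f b.
Proof.
move=> ab cy; have [xb|bx] := leP x b.
  have -> : clamp b y x = b.
    by rewrite /clamp max_l// ge_min xb.
  have -> : clamp a b x = clamp a y x.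
    by rewrite /clamp (min_l xb) (min_l (le_trans xb cy)).
  by rewrite addrK.
have -> : clamp a b x = b by rewrite /clamp min_r ?(ltW bx)// max_r.
have -> : clamp b y x = clamp a y x.
  rewrite /clamp; have h : b <= Num.min x y by rewrite le_min (ltW bx).
  by rewrite !max_r// (le_trans ab).
ring.
Qed.

Definition cut a b L := [seq (clamp a b p.1, clamp a b p.2) | p <- L].

Lemma family_cut a b a' b' L : a <= b -> family a' b' L -> family a b (cut a b L).
Proof.
move=> ab /familyP[h pL]; apply/familyP; split.
  move=> _ /mapP[p /h[_ p12 _] ->] /=; split; last 2 first.
  - exact: clamp_homo.
  - by have /andP[] := clamp_in p.2 ab.
  - by have /andP[] := clamp_in p.1 ab.
rewrite pairwise_map; apply: sub_pairwise pL => p q /orP[|] pq; rewrite /apart/=.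
  by rewrite clamp_homo.
by rewrite (clamp_homo _ _ pq) orbT.
Qed.

Lemma osc_cut f a b y L : a <= b -> b <= y ->
  osc f (cut a y L) <= osc f (cut a b L) + osc f (cut b y L).
Proof.
move=> ab cy; rewrite /osc !big_map -big_split/=; apply: ler_sum => p _.
rewrite !(clamp_split f _ ab cy); apply: le_trans (ler_normD _ _).
by rewrite le_eqVlt; apply/orP; left; apply/eqP; congr `|_|; ring.
Qed.

Lemma cut_id a b L : family a b L -> cut a b L = L.
Proof.
move=> /familyP[h _]; rewrite -[RHS]map_id; apply/eq_in_map => -[u v] /h[/= h1 h2 h3].
by rewrite !clamp_id ?h1 ?h3 ?(le_trans h1 h2) ?(le_trans h2 h3).
Qed.

Definition ac_family f := forall e : R, 0 < e -> exists2 r : R, 0 < r &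
  forall L, family 0 1 L -> \sum_(p <- L) (p.2 - p.1) < r -> osc f L < e.

Lemma ac_familyP f : absolutely_continuous 0 1 f -> ac_family f.
Proof.
move=> H e e0; have [r r0 Hr] := H e e0; exists r => // L /familyP[hL pL] Lr.
have := Hr (size L) (fun i => (nth (0, 0) L i).1) (fun i => (nth (0, 0) L i).2).
have sumE (F : R * R -> R) : \sum_(i < size L) F (nth (0, 0) L i) = \sum_(p <- L) F p.
  by rewrite (big_nth (0, 0)) big_mkord.
rewrite (sumE (fun p => p.2 - p.1)) (sumE (fun p => `|f p.2 - f p.1|)); apply => //.
  by move=> i; have [] := hL (nth (0, 0) L i) (mem_nth _ (ltn_ord i)).
apply/trivIsetP.
suff H' i j : (i < j)%N -> (j < size L)%N ->
    `](nth (0, 0) L i).1, (nth (0, 0) L i).2[%classic `&` `](nth (0, 0) L j).1, (nth (0, 0) L j).2[%classic = set0.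
  move=> i j _ _; rewrite neq_ltn => /orP[ij|ji]; first exact: H'.
  by rewrite setIC; exact: H'.
move=> ij jL; have iL := ltn_trans ij jL.
rewrite -subset0 => x [/=]; rewrite !in_itv/= => /andP[x1 x2] /andP[x3 x4].
have /(pairwiseP (0, 0))/(_ i j iL jL ij)/orP[h|h] := pL.
  by have := lt_le_trans x2 (le_trans h (ltW x3)); rewrite ltxx.
by have := lt_le_trans x4 (le_trans h (ltW x1)); rewrite ltxx.
Qed.

(** Cut [0, 1] into N cells shorter than the modulus given for the value 1: the
    oscillation is at most 1 in each cell. *)
Lemma ac_family_bounded f : ac_family f ->
  exists M : R, forall L, family 0 1 L -> osc f L <= M.
Proof.
move=> /(_ 1 ltr01)[r r0 Hr].
pose N := (Num.truncn r^-1).+1.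
have Np : 0 < N%:R :> R by rewrite ltr0n.
have Nr : N%:R^-1 < r.
  by rewrite -[ltRHS]invrK ltf_pV2 ?posrE ?invr_gt0// truncnS_gt.
exists N%:R => L fL; rewrite -(cut_id fL).
have h01 i : (0 : R) <= i%:R / N%:R by rewrite divr_ge0.
suff H i : (i <= N)%N -> osc f (cut 0 (i%:R / N%:R) L) <= i%:R.
  by have := H N (leqnn _); rewrite divff ?gt_eqF.
elim: i => [_|i IH iN].
  rewrite mul0r /osc big_map big1// => p _ /=.
  have c0 x : clamp 0 0 x = 0 :> R by have := @clamp_in 0 0 x (lexx _); lra.
  by rewrite !c0 subrr normr0.
have ii : i%:R / N%:R <= i.+1%:R / N%:R :> R by rewrite ler_pM2r ?invr_gt0// ler_nat.
apply: le_trans (osc_cut f L (h01 i) ii) _.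
rewrite -[leRHS]natr1 lerD ?IH ?(ltnW iN)// ltW//.
have fc : family (i%:R / N%:R) (i.+1%:R / N%:R) (cut (i%:R / N%:R) (i.+1%:R / N%:R) L).
  exact: family_cut fL.
apply: Hr.
  have /familyP[h ?] := fc; apply/familyP; split => // p /h[h1 h2 h3]; split => //.
    by rewrite (le_trans _ h1).
  by rewrite (le_trans h3)// ler_pdivrMr// mul1r ler_nat.
have := @family_monotone_le id _ _ _ (fun _ _ => id) ii fc => /= h.
apply: le_lt_trans h _; rewrite -mulrBl -natr1 addrAC subrr add0r mul1r//.
Qed.

End interval_families.

Section total_variation.
Context {R : realType}.
Variable f : R -> R.
Hypothesis acf : ac_family f.
Implicit Types (x y : R) (L : seq (R * R)).

Definition oscillations x := [set osc f L | L in [set L | family 0 x L]].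

Definition variation x : R := sup (oscillations (clamp 0 1 x)).

Let oscillations_sup x : 0 <= x <= 1 -> has_sup (oscillations x).
Proof.
move=> /andP[x0 x1]; split.
  by exists (osc f [::]); exists [::].
have [M HM] := ac_family_bounded acf; exists M => _ [L /familyP[h pL] <-].
by apply: HM; apply/familyP; split => // p /h[? ? h3]; split => //; exact: le_trans x1.
Qed.

Lemma variation_clamp x : variation (clamp 0 1 x) = variation x.
Proof.
rewrite /variation [clamp _ _ (clamp _ _ _)]clamp_id//; exact: clamp_in.
Qed.

Let variationE x : 0 <= x <= 1 -> variation x = sup (oscillations x).
Proof. by move=> x01; rewrite /variation clamp_id. Qed.

Lemma variation_super x y L : 0 <= x -> x <= y -> y <= 1 -> family x y L ->
  osc f L <= variation y - variation x.
Proof.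
move=> x0 xy y1 fL.
have x01 : 0 <= x <= 1 by rewrite x0 (le_trans xy).
have y01 : 0 <= y <= 1 by rewrite y1 andbT (le_trans x0).
suff : variation x <= variation y - osc f L by lra.
rewrite [variation x]variationE// ge_sup//; first by case: (oscillations_sup x01).
move=> _ [L' fL' <-]; rewrite lerBrDr -osc_cat variationE//.
apply: ub_le_sup; first by case: (oscillations_sup y01).
by exists (L' ++ L) => //; exact: family_cat fL' fL.
Qed.

Lemma variation_sub x y (k : R) : 0 <= x -> x <= y -> y <= 1 ->
  (forall L, family x y L -> osc f L <= k) -> variation y - variation x <= k.
Proof.
move=> x0 xy y1 H.
have x01 : 0 <= x <= 1 by rewrite x0 (le_trans xy).
have y01 : 0 <= y <= 1 by rewrite y1 andbT (le_trans x0).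
suff : variation y <= k + variation x by lra.
rewrite [variation y]variationE// ge_sup//; first by case: (oscillations_sup y01).
move=> _ [L fL <-]; rewrite -(cut_id fL) (le_trans (osc_cut f L x0 xy))// addrC.
apply: lerD; first by apply: H; exact: family_cut fL.
rewrite variationE//; apply: ub_le_sup; first by case: (oscillations_sup x01).
by exists (cut 0 x L) => //; exact: family_cut fL.
Qed.

Lemma variation_ge x y : 0 <= x -> x <= y -> y <= 1 -> `|f y - f x| <= variation y - variation x.
Proof.
move=> x0 xy y1; have := @variation_super x y [:: (x, y)] x0 xy y1.
by rewrite /osc big_seq1/=; apply; rewrite /family/= !lexx xy.
Qed.

Lemma variation_homo : {homo variation : x y / x <= y}.
Proof.
move=> x y xy; rewrite -(variation_clamp x) -(variation_clamp y) -subr_ge0.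
have /andP[x0 _] := @clamp_in R 0 1 x ler01.
have /andP[_ y1] := @clamp_in R 0 1 y ler01.
exact: le_trans (normr_ge0 _) (variation_ge x0 (clamp_homo _ _ xy) y1).
Qed.

(** Each increment of the variation is approximated by a family inside the
    interval, and the families of the different intervals are concatenated. *)
Lemma variation_ac : ac_family variation.
Proof.
move=> e e0; have [r r0 Hr] := acf (divr_gt0 e0 (ltr0n _ 2)); exists r => // L fL Lr.
pose s := e / 2 / (size L).+1%:R.
have s0 : 0 < s by rewrite !divr_gt0.
have ch (p : R * R) : exists L', p \in L -> family p.1 p.2 L' /\
    variation p.2 - variation p.1 <= osc f L' + s.
  have [pL|] := boolP (p \in L); last by exists [::].
  have /familyP[/(_ _ pL)[h1 h2 h3] _] := fL.
  apply: contrapT => /forallNP H.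
  have : variation p.2 - variation p.1 <= variation p.2 - variation p.1 - s; last by lra.
  apply: variation_sub => // L' fL'; rewrite leNgt; apply/negP => h.
  by apply: (H L') => _; split => //; lra.
have [c Hc] := choice ch.
have main l : {subset l <= L} -> family 0 1 l -> family 0 1 (flatten (map c l)) /\
    \sum_(p <- flatten (map c l)) (p.2 - p.1) <= \sum_(p <- l) (p.2 - p.1) /\
    osc variation l <= osc f (flatten (map c l)) + (size l)%:R * s.
  elim: l => [|p l IH] lL fl.
    by split=> //; rewrite /osc/= !big_nil mul0r addr0.
  have [[h1 h2 h3] fl' hp] := family_cons fl.
  have lL' : {subset l <= L} by move=> q ql; apply: lL; rewrite inE ql orbT.
  have [IH1 [IH2 IH3]] := IH lL' fl'.
  have pL : p \in L by apply: lL; rewrite mem_head.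
  have [c1 c2] := Hc p pL.
  split; last split.
  - have /familyP[IHa IHb] := IH1; have /familyP[ca cb] := c1.
    apply/familyP; split.
      move=> q; rewrite mem_cat => /orP[/ca[? ? ?]|/IHa//]; split => //.
        exact: le_trans h1 _.
      by apply: le_trans h3.
    rewrite /= pairwise_cat IHb cb !andbT; apply/allrelP => q q' qc /flattenP[l' /mapP[p' p'l ->] q'l'].
    have [_ _ _] := ca _ qc.
    have [c1' _] := Hc p' (lL' _ p'l).
    have /familyP[ca' _] := c1'.
    have [? ? ?] := ca _ qc; have [? ? ?] := ca' _ q'l'.
    have := hp _ p'l; rewrite /apart => /orP[h|h]; apply/orP; [left|right].
      by apply: le_trans (le_trans h _).
    by apply: le_trans (le_trans h _).
  - rewrite /= big_cat big_cons lerD//.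
    exact: (@family_monotone_le R id _ _ _ (fun _ _ => id) h2 c1).
  - have -> : osc variation (p :: l) = variation p.2 - variation p.1 + osc variation l.
      by rewrite /osc big_cons ger0_norm ?subr_ge0 ?variation_homo.
    have -> : (size (p :: l))%:R = (size l)%:R + 1 :> R by rewrite natr1.
    by rewrite /= osc_cat; move: c2 IH3; lra.
have [m1 [m2 m3]] := main L (fun _ => id) fL.
have := Hr _ m1 (le_lt_trans m2 Lr).
have : (size L)%:R * s <= e / 2.
  by rewrite /s mulrCA ler_piMr ?divr_ge0 ?(ltW e0)// ler_pdivrMr// mul1r ler_nat.
lra.
Qed.

End total_variation.

(** * Density of an absolutely continuous monotone function *)

Section open_intervals.
Context {R : realType}.

Lemma open_interval_finite (J : set R) : open J -> is_interval J ->
  (@lebesgue_measure R J < +oo)%E -> exists a b : R, a <= b /\ J = `]a, b[%classic.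
Proof.
move=> oJ /is_intervalP JE Joo.
have [J0|/set0P[x Jx]] := eqVneq J set0.
  by exists 0, 0; rewrite J0 set_itvoo0.
move: oJ Joo Jx; rewrite JE; move: (Rhull J) => i {JE}.
case: i => [[l a|l] [r b|r]] oi ioo ix; last 3 first.
- by move: ioo ix; rewrite lebesgue_measure_itv/= in_itv/=; case: r {oi} => //=; rewrite ?andbF ?ltry// ltxx.
- by move: ioo ix; rewrite lebesgue_measure_itv/= in_itv/=; case: l {oi} => //=; rewrite ?ltNyr.
- by move: ioo ix; rewrite lebesgue_measure_itv/= in_itv/=; case: l r {oi} => -[].
have near_in y : [set` Interval (BSide l a) (BSide r b)] y ->
    exists2 e : R, 0 < e & forall z, `|y - z| < e -> [set` Interval (BSide l a) (BSide r b)] z.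
  move=> iy; have := open_nbhs_nbhs (conj oi iy).
  by move=> /nbhs_ballP[e/= e0 He]; exists e => // z yz; apply: He.
have la : l = false.
  case: l oi ioo ix near_in => // oi ioo; rewrite /= in_itv/= => /andP[ax xb] near_in.
  have [|e e0 He] := near_in a.
    by rewrite /= in_itv/= lexx; case: (r) xb => /= xb; [exact: le_lt_trans xb|exact: le_trans xb].
  have := He (a - e / 2); rewrite /= in_itv/= opprD opprK addNKr gtr0_norm ?divr_gt0//.
  by rewrite ltr_pdivrMr// ltr_pMr// ltr1n => /(_ isT)/andP[]; lra.
have rb : r = true.
  case: r oi ioo ix near_in => // oi ioo; rewrite /= in_itv/= => /andP[ax xb] near_in.
  have [|e e0 He] := near_in b.
    by rewrite /= in_itv/= lexx andbT; case: (l) ax => /= ax; [exact: le_trans xb|exact: lt_le_trans xb].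
  have := He (b + e / 2); rewrite /= in_itv/= opprD addNKr normrN gtr0_norm ?divr_gt0//.
  by rewrite ltr_pdivrMr// ltr_pMr// ltr1n => /(_ isT)/andP[]; lra.
exists a, b; rewrite la rb; split => //.
by move: ix; rewrite la rb/= in_itv/= => /andP[ax xb]; exact/ltW/(lt_trans ax).
Qed.

Lemma open_itv_apart (a b a' b' : R) : a < b -> a' < b' ->
  `]a, b[%classic `&` `]a', b'[%classic = set0 -> apart (a, b) (a', b').
Proof.
move=> ab ab' dis; rewrite /apart/= leNgt [X in _ || X]leNgt -negb_and.
apply/negP => /andP[h1 h2].
pose lo := Num.max a a'; pose hi := Num.min b b'.
have lh : lo < hi by rewrite /lo /hi gt_max !lt_min ab ab' h1 h2.
have : (`]a, b[%classic `&` `]a', b'[%classic) ((lo + hi) / 2).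
  have l1 : a <= lo by rewrite /lo le_max lexx.
  have l2 : a' <= lo by rewrite /lo le_max lexx orbT.
  have l3 : hi <= b by rewrite /hi ge_min lexx.
  have l4 : hi <= b' by rewrite /hi ge_min lexx orbT.
  by split; rewrite /= in_itv/=; apply/andP; split; lra.
by rewrite dis.
Qed.

End open_intervals.

Section density.
Context {R : realType}.
Variable g : R -> R.
Hypothesis g_nd : {homo g : x y / x <= y}.
Hypothesis g_clamp : forall x, g (clamp 0 1 x) = g x.
Hypothesis g_ac : ac_family g.

Let leb : measure (measurableTypeR R) R := @lebesgue_measure R.

Lemma clamp_lip (x y : R) : x <= y -> clamp 0 1 y - clamp 0 1 x <= y - x.
Proof.
move=> xy; rewrite lerBlDr [leLHS]/clamp ge_max.
have h0 : 0 <= clamp 0 1 x by have /andP[] := @clamp_in R 0 1 x ler01.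
have h1 : Num.min x 1 <= clamp 0 1 x by rewrite /clamp le_max lexx orbT.
apply/andP; split; first lra.
have [x1|x1] := leP x 1.
  by rewrite min_l// in h1; rewrite ge_min; apply/orP; left; lra.
by rewrite (min_r (ltW x1)) in h1; rewrite ge_min; apply/orP; right; lra.
Qed.

Let g_rc : right_continuous g.
Proof.
move=> x; apply/cvgrPdist_lt => e e0.
have [r r0 Hr] := g_ac e0.
near=> y.
have xy : x < y by near: y; exact: nbhs_right_gt.
have yr : y < x + r by near: y; apply: nbhs_right_lt; rewrite ltrDl.
have cxy : clamp 0 1 x <= clamp 0 1 y by apply: clamp_homo; exact: ltW.
have := Hr [:: (clamp 0 1 x, clamp 0 1 y)].
rewrite /osc !big_seq1/= !g_clamp distrC; apply.
  rewrite /family/= cxy /=.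
  by have /andP[-> _] := @clamp_in R 0 1 x ler01; have /andP[_ ->] := @clamp_in R 0 1 y ler01.
by apply: (le_lt_trans (clamp_lip (ltW xy))); rewrite ltrBlDl.
Unshelve. all: by end_near. Qed.

HB.instance Definition _ := isCumulative.Build R _ R g g_nd g_rc.

Let mu := lebesgue_stieltjes_measure g.

Let mu_itv a b : a <= b -> mu `]a, b]%classic = (g b - g a)%:E.
Proof.
move=> ab; rewrite /mu /lebesgue_stieltjes_measure /measure_extension.
rewrite measurable_mu_extE/=; last exact: is_ocitv.
by rewrite wlength_itv_bnd.
Qed.

(* The measure of g is carried by [0, 1]; restricted to ]-1, 1] it is finite by
   construction. *)
Let D : set (measurableTypeR R) := `]-1, 1]%classic.
Let mD : measurable D. Proof. exact: measurable_itv. Qed.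

Let nu := mrestr mu mD.

Let nu_fin : fin_num_fun nu.
Proof.
move=> A mA; rewrite ge0_fin_numE; last exact: measure_ge0.
apply: (@le_lt_trans _ _ (mu D)).
  by rewrite /nu /mrestr le_measure ?inE//; exact: measurableI.
by rewrite mu_itv ?ltry//; lra.
Qed.

HB.instance Definition _ := Measure.on nu.
HB.instance Definition _ := Measure_isFinite.Build _ _ _ nu nu_fin.

(** A Lebesgue null set is contained in an open set of small length. The
    components of the open set are nonoverlapping intervals, so absolute
    continuity bounds the sum of the increments of g over them. *)
Let nu_dom : nu `<< leb.
Proof.
apply/null_content_dominatesP => A mA A0.
apply/eqP; rewrite eq_le measure_ge0 andbT.
apply/lee_addgt0Pr => e e0; rewrite add0e.
have [r r0 Hr] := g_ac e0.
pose B := A `&` D.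
have mB : measurable B by exact: measurableI.
have B0 : leb B = 0%E.
  by apply/eqP; rewrite eq_le measure_ge0 andbT -A0 le_measure ?inE//; exact: subIsetl.
have [U [oU BU Ur]] := lebesgue_regularity_outer mB (ltac:(by rewrite B0 ltry) : (leb B < +oo)%E) r0.
have mU : measurable (U : set (measurableTypeR R)) by exact: open_measurable.
have lU : (leb U < r%:E)%E.
  rewrite (_ : U = (U `\` B) `|` B); last by rewrite setUC setDUK.
  rewrite measureU//; last 2 first.
  - exact: measurableD.
  - by rewrite -subset0 => x [[_ nB] Bx].
  by rewrite (_ : (_ + _)%E = (leb (U `\` B) + leb B)%E)// B0 adde0.
pose J := open_disjoint_itv oU.
have JU : U = \bigcup_q J q := open_disjoint_itv_bigcup oU.
have mJ q : measurable (J q : set (measurableTypeR R)).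
  by apply: open_measurable; exact: open_disjoint_itv_open.
have tJ : trivIset setT J := open_disjoint_itv_trivIset (oU := oU).
have JoU q : J q `<=` U by rewrite JU; exact: bigcup_sup.
have ch q : exists ab : R * R, ab.1 <= ab.2 /\ J q = `]ab.1, ab.2[%classic.
  have [|||a [b [ab JE]]] := @open_interval_finite R (J q).
  - exact: open_disjoint_itv_open.
  - exact: open_disjoint_itv_is_interval.
  - apply: le_lt_trans (lt_trans lU (ltry _)).
    by apply: le_measure; rewrite ?inE.
  by exists (a, b).
have [p Hp] := choice ch.
have muJ q : (mu (J q) <= (g (p q).2 - g (p q).1)%:E)%E.
  have [h1 ->] := Hp q; rewrite -mu_itv//; apply: le_measure; rewrite ?inE//.
  by apply: subset_itvl; rewrite bnd_simp.
have lJ q : leb (J q) = ((p q).2 - (p q).1)%:E.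
  have [h1 ->] := Hp q; rewrite [LHS]lebesgue_measure_itv/= lte_fin.
  by case: ltP => // h2; rewrite (_ : (p q).2 = (p q).1) ?subrr//; apply/eqP; rewrite eq_le h2 h1.
apply: (@le_trans _ _ (mu U)).
  by apply: le_measure; rewrite ?inE.
have mbJ : measurable (\bigcup_q J q : set (measurableTypeR R)) by rewrite -JU.
have muE : mu (\bigcup_q J q) = (\sum_(0 <= q <oo) mu (J q))%E by exact: measure_semi_bigcup.
have lebE : leb (\bigcup_q J q) = (\sum_(0 <= q <oo) leb (J q))%E by exact: measure_semi_bigcup.
rewrite JU muE.
apply: lime_le; first exact: is_cvg_nneseries.
apply: nearW => n.
apply: (@le_trans _ _ (\sum_(0 <= q < n) (g (p q).2 - g (p q).1)%:E)%E).
  by apply: lee_sum => q _; exact: muJ.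
rewrite sumEFin lee_fin.
pose L := [seq (clamp 0 1 (p q).1, clamp 0 1 (p q).2) | q <- iota 0 n & (p q).1 < (p q).2].
have fL : family 0 1 L.
  apply/familyP; split.
    move=> _ /mapP[q _ ->] /=; split.
    - by have /andP[] := @clamp_in R 0 1 (p q).1 ler01.
    - by apply: clamp_homo; have [] := Hp q.
    - by have /andP[] := @clamp_in R 0 1 (p q).2 ler01.
  rewrite pairwise_map.
  have : pairwise [rel x y | x != y] [seq q <- iota 0 n | (p q).1 < (p q).2].
    by rewrite -uniq_pairwise filter_uniq// iota_uniq.
  move=> /(pairwiseP 0%N) h; apply/(pairwiseP 0%N) => i j iL jL ij.
  have := h i j iL jL ij; set q := nth _ _ i; set q' := nth _ _ j => /= qq'.
  have : q \in [seq q <- iota 0 n | (p q).1 < (p q).2] by rewrite mem_nth.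
  have : q' \in [seq q <- iota 0 n | (p q).1 < (p q).2] by rewrite mem_nth.
  rewrite !mem_filter => /andP[pq' _] /andP[pq _].
  have dis : `](p q).1, (p q).2[%classic `&` `](p q').1, (p q').2[%classic = set0.
    have [_ <-] := Hp q; have [_ <-] := Hp q'.
    by move/trivIsetP : tJ; apply.
  have := open_itv_apart pq pq' dis; rewrite /apart/= => /orP[h1|h1].
    by rewrite clamp_homo.
  by rewrite (clamp_homo _ _ h1) orbT.
have sumE (F : R * R -> R) : (forall q, (p q).2 <= (p q).1 -> F (clamp 0 1 (p q).1, clamp 0 1 (p q).2) = 0) ->
    \sum_(x <- L) F x = \sum_(0 <= q < n) F (clamp 0 1 (p q).1, clamp 0 1 (p q).2).
  move=> F0; rewrite /L big_map big_filter big_mkcond /index_iota subn0.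
  by apply: eq_bigr => q _; case: ltP => // /F0.
have pE q : (p q).2 <= (p q).1 -> (p q).2 = (p q).1.
  by move=> h; apply/eqP; rewrite eq_le h; have [] := Hp q.
have H1 : osc g L < e.
  apply: Hr => //; rewrite sumE/=; last by move=> q /pE ->; rewrite subrr.
  rewrite -lte_fin; apply: le_lt_trans lU.
  apply: (@le_trans _ _ (\sum_(0 <= q < n) leb (J q))%E).
    rewrite -sumEFin; apply: lee_sum => q _; rewrite lJ lee_fin.
    by apply: clamp_lip; have [] := Hp q.
  by rewrite JU lebE; exact: nneseries_lim_ge.
apply: ltW; apply: le_lt_trans H1; rewrite /osc sumE/=; last by move=> q /pE ->; rewrite subrr normr0.
by apply: ler_sum => q _; rewrite !g_clamp ler_norm.
Qed.

(** The density is the Radon-Nikodym derivative of the Stieltjes measure of g. *)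
Lemma monotone_ac_density : exists f : R -> R,
  leb.-integrable setT (EFin \o f) /\ forall x y, 0 <= x -> x <= y -> y <= 1 ->
  (\int[leb]_(z in `]x, y]) (f z)%:E = (g y - g x)%:E)%E.
Proof.
pose F := Radon_Nikodym_SigmaFinite.f nu leb.
have Ffin : forall x, F x \is a fin_num := Radon_Nikodym_SigmaFinite.f_fin_num nu_dom.
have FE : EFin \o (fine \o F) = F by apply/funext => x /=; rewrite fineK.
exists (fine \o F); split.
  by rewrite FE; exact: Radon_Nikodym_SigmaFinite.f_integrable.
move=> x y x0 xy y1.
rewrite [LHS](_ : _ = \int[leb]_(z in `]x, y]) F z)%E; last first.
  by apply: eq_integral => z _; rewrite -[in RHS]FE.
rewrite -(Radon_Nikodym_SigmaFinite.f_integral nu_dom); last exact: measurable_itv.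
rewrite -mu_itv//; transitivity (mu (`]x, y]%classic `&` D)) => //.
congr (mu _); apply: setIidl.
by apply: subset_itv; rewrite bnd_simp//; lra.
Qed.

End density.

(** * The rate function as an energy bound *)

Section limsup_bounds.
Context {R : realType}.
Local Open Scope ereal_scope.
Implicit Types u : (\bar R)^nat.

Lemma limn_esup_le u (l : \bar R) N : (forall n, (N <= n)%N -> u n <= l) -> limn_esup u <= l.
Proof.
move=> H; rewrite /limn_esup /limf_esup.
apply: (@le_trans _ _ (ereal_sup (u @` [set n | (N <= n)%N]))).
  by apply: ereal_inf_lbound; exists [set n | (N <= n)%N] => //; exact: nbhs_infty_ge.
by apply: ge_ereal_sup => _ [n Nn <-]; exact: H.
Qed.

Lemma limn_einf_ge u (l : \bar R) N : (forall n, (N <= n)%N -> l <= u n) -> l <= limn_einf u.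
Proof.
move=> H; rewrite /limn_einf leeNr; apply: (limn_esup_le (N := N)) => n Nn.
by rewrite leeN2 H.
Qed.

Lemma limn_esup_le_fin u (l : R) :
  (forall e : R, (0 < e)%R -> exists N, forall n, (N <= n)%N -> u n <= (l + e)%:E) ->
  limn_esup u <= l%:E.
Proof.
move=> H; apply/lee_addgt0Pr => e e0; have [N HN] := H e e0.
exact: limn_esup_le HN.
Qed.

Lemma limn_einf_ge_fin u (l : R) :
  (forall e : R, (0 < e)%R -> exists N, forall n, (N <= n)%N -> (l - e)%:E <= u n) ->
  l%:E <= limn_einf u.
Proof.
move=> H; rewrite /limn_einf leeNr -EFinN; apply: limn_esup_le_fin => e e0.
have [N HN] := H e e0; exists N => n Nn.
by rewrite leeNl -EFinN opprD opprK; exact: HN.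
Qed.

End limsup_bounds.

Section rate_function_energy.
Context {R : realType}.
Implicit Types (h f : R -> R).

Let leb : measure (measurableTypeR R) R := @lebesgue_measure R.

(** This serves for the square of derive1 h, whose measurability is not known. *)
Lemma ge0_le_integral_any (A D : set R) (f g : R -> \bar R) : A `<=` D ->
  (forall x, A x -> 0 <= f x)%E -> (forall x, D x -> 0 <= g x)%E ->
  (forall x, A x -> f x <= g x)%E ->
  (\int[leb]_(x in A) f x <= \int[leb]_(x in D) g x)%E.
Proof.
move=> AD f0 g0 fg.
rewrite !ge0_integralE//; apply: ereal_sup_le => _ [s sf <-]; exists s => // x.
apply: le_trans (sf x) _; rewrite /patch; case: ifPn => [/set_mem Ax|_].
  by rewrite mem_set ?fg//; exact: AD.
by case: ifPn => // /set_mem; exact: g0.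
Qed.

Lemma ac_family_clamp h : ac_family h -> ac_family (h \o clamp 0 1).
Proof.
move=> ac e e0; have [r r0 Hr] := ac e e0; exists r => // L fL Lr.
have := Hr L fL Lr; apply: le_lt_trans; rewrite le_eqVlt; apply/orP; left; apply/eqP.
by rewrite -[in RHS](cut_id fL) /osc big_map; apply: eq_bigr.
Qed.

Lemma ac_familyB h f : ac_family h -> ac_family f -> ac_family (fun x => h x - f x).
Proof.
move=> ah af e e0; have e20 : 0 < e / 2 by rewrite divr_gt0.
have [r r0 Hr] := ah _ e20; have [s s0 Hs] := af _ e20.
exists (Num.min r s); first by rewrite lt_min r0.
move=> L fL; rewrite lt_min => /andP[Lr Ls].
apply: (@le_lt_trans _ _ (osc h L + osc f L)).
  rewrite /osc -big_split/=; apply: ler_sum => p _; apply: le_trans (ler_normB _ _).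
  by rewrite le_eqVlt; apply/orP; left; apply/eqP; congr `|_|; ring.
by have := Hr L fL Lr; have := Hs L fL Ls; lra.
Qed.

(** h is the difference of its variation and of variation - h, which are both
    monotone and absolutely continuous. *)
Lemma ac_density h : ac_family h -> exists f : R -> R,
  leb.-integrable setT (EFin \o f) /\ forall x y, 0 <= x -> x <= y -> y <= 1 ->
  (\int[leb]_(z in `]x, y]) (f z)%:E = (h y - h x)%:E)%E.
Proof.
move=> ac; pose g1 := variation h; pose g2 x := variation h x - h (clamp 0 1 x).
have ac1 : ac_family g1 by exact: variation_ac.
have cl01 (x : R) : 0 <= clamp 0 1 x <= 1 by exact: clamp_in.
have cc (x : R) : clamp 0 1 (clamp 0 1 x) = clamp 0 1 x by rewrite clamp_id.
have ac2 : ac_family g2 by apply: ac_familyB => //; exact: ac_family_clamp.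
have nd2 : {homo g2 : x y / x <= y}.
  move=> x y xy; rewrite /g2 -(variation_clamp h x) -(variation_clamp h y).
  have := variation_ge ac (ltac:(by have /andP[] := cl01 x) : 0 <= clamp 0 1 x)
    (clamp_homo 0 1 xy) (ltac:(by have /andP[] := cl01 y)).
  have := ler_norm (h (clamp 0 1 y) - h (clamp 0 1 x)); lra.
have [f1 [if1 H1]] := monotone_ac_density (variation_homo ac) (variation_clamp h) ac1.
have [f2 [if2 H2]] := monotone_ac_density nd2
  (fun x => ltac:(by rewrite /g2 variation_clamp cc) : g2 (clamp 0 1 x) = g2 x) ac2.
exists (fun x => f1 x - f2 x); split.
  exact: (integrableB measurableT if1 if2).
move=> x y x0 xy y1.
have mD : measurable (`]x, y]%classic : set (measurableTypeR R)) by exact: measurable_itv.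
have sub f' : leb.-integrable setT (EFin \o f') -> leb.-integrable `]x, y] (EFin \o f').
  by apply: integrableS.
rewrite (integralB_EFin mD (sub _ if1) (sub _ if2)) H1// H2// -EFinB; congr EFin.
rewrite /g1 /g2 !clamp_id ?x0 ?y1 ?(le_trans x0 xy) ?(le_trans xy y1)//; ring.
Qed.

(** Lebesgue's differentiation theorem for the primitive of f. *)
Lemma ac_derive_ae h f : leb.-integrable setT (EFin \o f) ->
  (forall x y : R, 0 <= x -> x <= y -> y <= 1 ->
    (\int[leb]_(z in `]x, y]) (f z)%:E = (h y - h x)%:E)%E) ->
  {ae leb, forall x, 0 < x < 1 -> derive1 h x = f x}.
Proof.
move=> intf H.
have sub (i : interval R) : leb.-integrable [set` i] (EFin \o f).
  by apply: (integrableS measurableT _ _ intf) => //; exact: measurable_itv.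
have lf : locally_integrable [set: R] f.
  by apply: open_integrable_locally => //; exact: openT.
have := FTC1Ny (fun y => sub `]-oo, y]) lf.
set F := (fun x => _) => /= HF.
move: HF => [N [mN N0 NH]]; exists N; split => // x nP; apply: NH => -[dF DF].
apply: nP => /andP[x0 x1].
have FE y : 0 <= y <= 1 -> h y = F y + (h 0 - F 0).
  move=> /andP[y0 y1].
  have := @Rintegral_itvB R f -oo%O (BRight y) 0 (sub _) isT.
  rewrite bnd_simp => /(_ y0); rewrite -/(F y) -/(F 0) => E1.
  have := H 0 y (lexx _) y0 y1 => E2.
  have : F y - F 0 = h y - h 0.
    by rewrite E1 /Rintegral E2.
  lra.
rewrite derive1E -DF derive1E.
transitivity ('D_1 (fun y => F y + (h 0 - F 0)) x).
  apply: near_eq_derive; near=> y; apply: FE; apply/andP; split.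
    by apply: ltW; near: y; exact: lt_nbhsr.
  by apply: ltW; near: y; exact: lt_nbhsl.
rewrite (@deriveD _ _ _ F (cst (h 0 - F 0)) x 1 dF); last exact: derivable_cst.
by rewrite derive_cst addr0.
Unshelve. all: by end_near. Qed.

(** For h(0) = 0 this means that h is absolutely continuous and that the integral
    of h'^2 is at most M. The function E stands for the primitive of h'^2, and the
    inequality is the one that Cauchy-Schwarz gives for this primitive; no derivative
    occurs, so the condition is stable under pointwise limits. *)
Definition energy_bound h (M : R) := h 0 = 0 /\ exists2 E : R -> R,
  {homo E : x y / x <= y} & E 1 - E 0 <= M /\
  forall s t, 0 <= s -> s <= t -> t <= 1 -> (h t - h s) ^+ 2 <= (t - s) * (E t - E s).

(** E is the primitive of the squared density of h. With c the mean slope of h on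
    [s, t], integrating (h' - c)^2 >= 0 gives the inequality. *)
Lemma energy_of_ac h (M : R) : absolutely_continuous 0 1 h -> h 0 = 0 ->
  (\int[leb]_(u in `[0%R, 1%R]) ((derive1 h u) ^+ 2)%:E <= M%:E)%E -> energy_bound h M.
Proof.
move=> /ac_familyP ac h0 HM; split => //.
have [f [intf H]] := ac_density ac.
have [N [mN N0 NH]] := ac_derive_ae intf H.
have mf : measurable_fun setT f by case/integrableP : intf => /measurable_EFinP.
pose D : set (measurableTypeR R) := `[0, 1]%classic.
have mD : measurable D by exact: measurable_itv.
pose N' := N `|` ([set 0] `|` [set 1]) : set (measurableTypeR R).
have m1 (x : R) : measurable ([set x] : set (measurableTypeR R)) by exact: measurable_set1.
have mN' : measurable N' by apply: measurableU => //; exact: measurableU.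
have N'0 : leb N' = 0%E.
  have h01 : leb ([set 0] `|` [set 1]) = 0%E.
    by apply: null_set_setU; [exact: m1|exact: m1|exact: lebesgue_measure_set1..].
  by apply: null_set_setU => //; apply: measurableU; exact: m1.
have mf2 : measurable_fun setT (fun x => f x ^+ 2) by exact: measurable_funX.
have f2M : (\int[leb]_(x in D) (f x ^+ 2)%:E <= M%:E)%E.
  rewrite (ge0_negligible_integral mN' mD _ _ N'0); last 2 first.
  - by apply/measurable_EFinP; exact: measurable_funTS.
  - by move=> x _; rewrite lee_fin sqr_ge0.
  apply: le_trans HM; apply: ge0_le_integral_any.
  - exact: subDsetl.
  - by move=> x _; rewrite lee_fin sqr_ge0.
  - by move=> x _; rewrite lee_fin sqr_ge0.
  - move=> x [Dx nx]; rewrite lee_fin.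
    have x01 : 0 < x < 1.
      move: Dx; rewrite /D/= in_itv/= => /andP[x0 x1].
      by rewrite !lt_neqAle x0 x1 !andbT; apply/andP; split; apply/eqP => E;
        apply: nx; right; [left|right].
    suff -> : derive1 h x = f x by [].
    by apply: contrapT => h'; apply: nx; left; apply: NH => /(_ x01).
pose e2 := (fun x => f x ^+ 2) \_ D.
have e2E x : D x -> e2 x = f x ^+ 2 by move=> Dx; rewrite /e2 /patch mem_set.
have e20 x : 0 <= e2 x by rewrite /e2 /patch; case: ifP => _ //; exact: sqr_ge0.
have me2 : measurable_fun setT e2.
  by apply/(measurable_restrictT _ mD); exact: measurable_funTS.
have inte2 : leb.-integrable setT (EFin \o e2).
  apply/integrableP; split; first exact/measurable_EFinP.
  apply: le_lt_trans (ltry M); apply: le_trans f2M.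
  rewrite [leRHS]integral_mkcond le_eqVlt; apply/orP; left; apply/eqP.
  apply: eq_integral => x _; rewrite /= ger0_norm ?e20// /e2 /patch.
  by case: ifP.
have sub (i : interval R) (g : R -> R) : leb.-integrable setT (EFin \o g) ->
    leb.-integrable [set` i] (EFin \o g).
  by move=> ig; apply: (integrableS measurableT _ _ ig) => //; exact: measurable_itv.
pose E (t : R) := \int[leb]_(x in `]-oo, t]) e2 x.
have EE s t : s <= t -> E t - E s = \int[leb]_(x in `]s, t]) e2 x.
  move=> st; have := @Rintegral_itvB R e2 -oo%O (BRight t) s (sub _ _ inte2) isT.
  by rewrite bnd_simp => /(_ st).
exists E; first by move=> s t st; rewrite -subr_ge0 EE// Rintegral_ge0.
split.
  rewrite EE// -lee_fin /Rintegral fineK; last first.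
    by apply: integrable_fin_num; [exact: measurable_itv|exact: sub].
  apply: le_trans f2M; apply: ge0_le_integral_any.
  - by move=> x; rewrite /D/= !in_itv/= => /andP[/ltW -> ->].
  - by move=> x _; rewrite lee_fin.
  - by move=> x _; rewrite lee_fin sqr_ge0.
  - by move=> x; rewrite /= in_itv/= => /andP[x0 x1]; rewrite e2E// /D/= in_itv/= (ltW x0).
move=> s t s0 st t1.
have [->|snt] := eqVneq s t; first by rewrite !subrr mul0r expr0n.
have slt : s < t by rewrite lt_neqAle snt.
have ts : 0 < t - s by rewrite subr_gt0.
pose c := (h t - h s) / (t - s).
pose I := `]s, t]%classic : set (measurableTypeR R).
have mI : measurable I by exact: measurable_itv.
have intI : leb.-integrable I (EFin \o f) by exact: (sub `]s, t]).
have inte : leb.-integrable I (EFin \o e2) by exact: (sub `]s, t]).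
have lI : leb I = (t - s)%:E by rewrite [LHS]lebesgue_measure_itv/= lte_fin slt.
have intc (k : R) : leb.-integrable I (EFin \o cst k).
  apply: measurable_bounded_integrable => //; first by rewrite lI ltry.
  by exists `|k|; split; [exact: num_real|move=> x kx y _ /=; exact: ltW].
have intZ (k : R) : leb.-integrable I (EFin \o (fun x => k * f x)) by have := integrableZl mI k intI; exact.
have intB : leb.-integrable I (EFin \o (fun x => 2 * c * f x - c ^+ 2)).
  by have := integrableB mI (intZ (2 * c)) (intc (c ^+ 2)).
have fE : \int[leb]_(x in I) f x = h t - h s by rewrite /Rintegral H.
have : \int[leb]_(x in I) (2 * c * f x - c ^+ 2) <= \int[leb]_(x in I) e2 x.
  apply: le_Rintegral => // x; rewrite /I/= in_itv/= => /andP[sx xt].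
  rewrite e2E; last by rewrite /D/= in_itv/= (le_trans s0 (ltW sx)) (le_trans xt).
  by have := sqr_ge0 (f x - c); rewrite sqrrB; lra.
rewrite (RintegralB mI (intZ (2 * c)) (intc (c ^+ 2))) RintegralZl// fE.
rewrite Rintegral_cst// lI/= -EE// => h1.
have -> : (h t - h s) ^+ 2 = (t - s) * (2 * c * (h t - h s) - c ^+ 2 * (t - s)).
  by rewrite /c; field; rewrite gt_eqF.
by rewrite ler_wpM2l// ltW.
Qed.

End rate_function_energy.

Section energy_to_rate.
Context {R : realType}.
Implicit Types (h f : R -> R).

Let leb : measure (measurableTypeR R) R := @lebesgue_measure R.

Lemma norm_le_sqr (x y : R) : 0 <= y -> x ^+ 2 <= y ^+ 2 -> `|x| <= y.
Proof.
move=> y0 xy; rewrite -ler_sqr ?nnegrE// real_normK ?num_real//.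
Qed.

Let sqr_mul_div (K x : R) : 0 < K -> K ^+ 2 * x / K = K * x.
Proof. by move=> K0; field; rewrite gt_eqF. Qed.

Lemma energy_ge0 h (M : R) : energy_bound h M -> 0 <= M.
Proof. by move=> [_ [E hE [EM _]]]; have := hE _ _ (@ler01 R); lra. Qed.

(** |dh| <= (eta dE + dt / eta) / 2 turns the quadratic inequality into a linear
    one, which can be summed over disjoint intervals. *)
Lemma energy_ac h (M : R) : energy_bound h M -> absolutely_continuous 0 1 h.
Proof.
move=> eb; have M0 := energy_ge0 eb; case: eb => _ [E hE [EM HE]] e e0.
pose n1 := e / (M + 1).
have n10 : 0 < n1 by rewrite divr_gt0// ltr_wpDl.
exists (n1 * e); first by rewrite mulr_gt0.
move=> n u v Hi tr Hs.
pose L := [seq (u i, v i) | i <- enum 'I_n & u i < v i].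
have fL : family 0 1 L.
  apply/familyP; split.
    by move=> _ /mapP[i _ ->] /=; have [? [? ?]] := Hi i.
  rewrite pairwise_map.
  have : pairwise [rel x y | x != y] [seq i <- enum 'I_n | u i < v i].
    by rewrite -uniq_pairwise filter_uniq// enum_uniq.
  case: n u v L Hi tr Hs => [|n] u v L Hi tr Hs.
    by rewrite (_ : enum 'I_0 = [::])//; apply/size0nil; rewrite size_enum_ord.
  move=> /(pairwiseP ord0) H; apply/(pairwiseP ord0) => i j iL jL ij.
  have := H i j iL jL ij; set q := nth _ _ i; set q' := nth _ _ j => /= qq'.
  have : q \in [seq i <- enum 'I_n.+1 | u i < v i] by rewrite mem_nth.
  have : q' \in [seq i <- enum 'I_n.+1 | u i < v i] by rewrite mem_nth.
  rewrite !mem_filter => /andP[pq' _] /andP[pq _].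
  by apply: open_itv_apart => //; move/trivIsetP : tr; apply.
have sumE : \sum_(i < n) (E (v i) - E (u i)) <= M.
  apply: le_trans EM; apply: le_trans (family_monotone_le hE ler01 fL).
  rewrite /L big_map big_filter [leRHS]big_mkcond big_enum/=.
  apply: ler_sum => i _; case: ltP => // vu.
  have [_ [uv _]] := Hi i.
  by rewrite (_ : v i = u i) ?subrr//; apply/eqP; rewrite eq_le vu uv.
apply: (@le_lt_trans _ _ (\sum_(i < n) (n1 / 2 * (E (v i) - E (u i)) + (v i - u i) / (2 * n1)))).
  apply: ler_sum => i _; have [u0 [uv v1]] := Hi i.
  have dE : 0 <= E (v i) - E (u i) by rewrite subr_ge0 hE.
  have dt : 0 <= v i - u i by rewrite subr_ge0.
  apply: norm_le_sqr.
    by apply: addr_ge0; [apply: mulr_ge0 => //; exact: divr_ge0 (ltW n10) _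
      |apply: divr_ge0 => //; exact: mulr_ge0 _ (ltW n10)].
  apply: (le_trans (HE _ _ u0 uv v1)).
  rewrite -subr_ge0; set a := E _ - _ in dE *; set b := v i - u i in dt *.
  have -> : (n1 / 2 * a + b / (2 * n1)) ^+ 2 - b * a = (n1 / 2 * a - b / (2 * n1)) ^+ 2.
    by field; rewrite gt_eqF.
  exact: sqr_ge0.
rewrite big_split/= -mulr_sumr -mulr_suml.
have h1 : n1 / 2 * \sum_(i < n) (E (v i) - E (u i)) <= e / 2.
  apply: (@le_trans _ _ (n1 / 2 * M)); first by rewrite ler_wpM2l// divr_ge0// ltW.
  rewrite mulrAC ler_pM2r ?invr_gt0// /n1 mulrAC ler_pdivrMr ?ltr_wpDl//.
  by rewrite ler_wpM2l ?(ltW e0)// lerDl.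
have h2 : (\sum_(i < n) (v i - u i)) / (2 * n1) < e / 2.
  have -> : e / 2 = n1 * e / (2 * n1) by move: (n1) n10 => n2 n20; field; rewrite gt_eqF.
  by rewrite ltr_pM2r// invr_gt0 mulr_gt0.
by lra.
Qed.

(** Away from the grid points this is the squared slope at x of the polygon that
    interpolates h on a grid of k + 1 cells. *)
Definition slope_sqr h k (x : R) : R :=
  \sum_(j < k.+1) (k.+1%:R * (h (j.+1%:R / k.+1%:R) - h (j%:R / k.+1%:R))) ^+ 2 *
    \1_(`[j%:R / k.+1%:R, j.+1%:R / k.+1%:R]%classic : set R) x.

Lemma slope_sqr_ge0 h k x : 0 <= slope_sqr h k x.
Proof. by apply: sumr_ge0 => j _; rewrite mulr_ge0 ?sqr_ge0// indicE. Qed.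

Lemma slope_sqr_integral h M k : energy_bound h M ->
  (\int[leb]_(x in `[0%R, 1%R]) (slope_sqr h k x)%:E <= M%:E)%E.
Proof.
move=> [_ [E hE [EM HE]]].
pose D : set (measurableTypeR R) := `[0, 1]%classic.
have mD : measurable D by exact: measurable_itv.
have K0 : 0 < k.+1%:R :> R by rewrite ltr0n.
pose I (j : nat) : set (measurableTypeR R) := `[j%:R / k.+1%:R, j.+1%:R / k.+1%:R]%classic.
have mI j : measurable (I j) by exact: measurable_itv.
pose d (j : nat) := h (j.+1%:R / k.+1%:R) - h (j%:R / k.+1%:R).
rewrite [leLHS](_ : _ = \int[leb]_(x in D) \sum_(j < k.+1) ((k.+1%:R * d j) ^+ 2 * \1_(I j) x)%:E)%E; last first.
  by apply: eq_integral => x _; rewrite sumEFin.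
rewrite ge0_integral_sum//; last 2 first.
- move=> j; apply/measurable_EFinP; apply: measurable_funM; first exact: measurable_cst.
  by apply: measurable_funTS; exact: measurable_indic.
- by move=> j x _; rewrite lee_fin mulr_ge0 ?sqr_ge0// indicE.
apply: (@le_trans _ _ (\sum_(j < k.+1) (E (j.+1%:R / k.+1%:R) - E (j%:R / k.+1%:R))%:E)%E).
  apply: lee_sum => j _.
  under eq_integral do rewrite EFinM.
  have mind : measurable_fun D (EFin \o (\1_(I j) : measurableTypeR R -> R)).
    by apply/measurable_EFinP; apply: measurable_funTS; exact: measurable_indic.
  rewrite (ge0_integralZl leb mD mind); last 2 first.
  - by move=> x _; rewrite lee_fin indicE.
  - by rewrite lee_fin sqr_ge0.
  rewrite integral_indic//.
  have l1 : (leb (I j `&` D) <= (k.+1%:R^-1)%:E)%E.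
    apply: (@le_trans _ _ (leb (I j))).
      by apply: le_measure; rewrite ?inE//; exact: measurableI.
    rewrite [X in (X <= _)%E]lebesgue_measure_itv/= lte_fin ltr_pM2r ?invr_gt0// ltr_nat ltnSn.
    by rewrite -EFinB -mulrBl -natr1 addrAC subrr add0r mul1r.
  apply: (@le_trans _ _ (((k.+1%:R * d j) ^+ 2)%:E * (k.+1%:R^-1)%:E)%E).
    by rewrite lee_wpmul2l// lee_fin sqr_ge0.
  rewrite -EFinM lee_fin exprMn.
  have := HE (j%:R / k.+1%:R) (j.+1%:R / k.+1%:R).
  have j1 : j.+1%:R / k.+1%:R <= 1 :> R by rewrite ler_pdivrMr// mul1r ler_nat.
  have jj : j%:R / k.+1%:R <= j.+1%:R / k.+1%:R :> R by rewrite ler_pM2r ?invr_gt0// ler_nat.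
  move=> /(_ (ltac:(by rewrite divr_ge0)) jj j1).
  have cell : j.+1%:R / k.+1%:R - j%:R / k.+1%:R = k.+1%:R^-1 :> R.
    by rewrite -mulrBl -natr1 addrAC subrr add0r mul1r.
  rewrite -/(d j) cell => h1.
  rewrite sqr_mul_div//.
  by rewrite -ler_pdivlMl.
rewrite sumEFin lee_fin; apply: le_trans EM.
rewrite -(big_mkord xpredT (fun j => E (j.+1%:R / k.+1%:R) - E (j%:R / k.+1%:R))).
by rewrite telescope_sumr// divff ?gt_eqF// mul0r.
Qed.

(** Two difference quotients at x, one on each side, are combined, so the position
    of x in the cell does not matter. *)
Lemma derive_cell h x (e : R) : derivable h x 1 -> 0 < e -> exists2 r : R, 0 < r &
  forall a b, a <= x -> x <= b -> b - a < r ->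
  `|h b - h a - derive1 h x * (b - a)| <= e * (b - a).
Proof.
move=> dh e0.
have H : (fun s => s^-1 *: (h (s + x) - h x)) @ 0^' --> derive1 h x.
  have := dh; rewrite /derivable (_ : (fun s => _) = (fun s => s^-1 *: (h (s + x) - h x))) //.
  by apply/funext => s /=; rewrite [s%:A]mulr1.
have /cvgrPdist_lt/(_ e e0) := H.
move=> [r /= r0 Hr]; exists r => // a b ax xb ba.
have key s : `|s| < r -> `|h (s + x) - h x - derive1 h x * s| <= e * `|s|.
  move=> sr; have [->|s0] := eqVneq s 0; first by rewrite add0r subrr mulr0 subr0 normr0 mulr0.
  have := Hr s; rewrite /= sub0r normrN => /(_ sr s0) h1.
  have -> : h (s + x) - h x - derive1 h x * s = (s^-1 * (h (s + x) - h x) - derive1 h x) * s.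
    by field.
  by rewrite normrM ler_wpM2r// distrC ltW.
have kb := key (b - x); have ka := key (a - x).
rewrite !subrK in kb ka.
rewrite ger0_norm ?subr_ge0// in kb.
rewrite ler0_norm ?subr_le0// in ka.
have {}kb := kb ltac:(lra); have {}ka := ka ltac:(lra).
rewrite (_ : _ - _ - _ = (h b - h x - derive1 h x * (b - x)) - (h a - h x - derive1 h x * (a - x))); last by ring.
by apply: le_trans (ler_normB _ _) _; lra.
Qed.

(** Fatou's lemma for the slopes over finer and finer grids, which converge to h'
    wherever h is differentiable. *)
Lemma energy_integral h (M : R) : energy_bound h M ->
  (\int[leb]_(u in `[0%R, 1%R]) ((derive1 h u) ^+ 2)%:E <= M%:E)%E.
Proof.
move=> eb.
pose D : set (measurableTypeR R) := `[0, 1]%classic.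
have mD : measurable D by exact: measurable_itv.
have msl k : measurable_fun D (fun x => (slope_sqr h k x)%:E).
  apply/measurable_EFinP; apply: measurable_sum => j.
  apply: measurable_funM; first exact: measurable_cst.
  apply: measurable_funTS.
  by apply: measurable_indic; exact: measurable_itv.
apply: (@le_trans _ _ (limn_einf (fun k => \int[leb]_(x in D) (slope_sqr h k x)%:E))%E); last first.
  apply: le_trans (limn_einf_sup _) _; apply: (limn_esup_le (N := 0)) => k _.
  exact: slope_sqr_integral.
apply: le_trans (fatou _ mD msl _); last by move=> k x _; rewrite lee_fin slope_sqr_ge0.
apply: ge0_le_integral_any => //.
- by move=> x _; rewrite lee_fin sqr_ge0.
- by move=> x _; apply: (limn_einf_ge (N := 0)) => k _; rewrite lee_fin slope_sqr_ge0.
move=> x; rewrite /= in_itv/= => /andP[x0 x1].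
apply: limn_einf_ge_fin => e e0.
have [dx|ndx] := pselect (derivable h x 1); last first.
  (* A derivative that does not exist is 0 by convention. *)
  have -> : derive1 h x = 0.
    rewrite /derive1 (_ : lim _ = point)//; apply: xgetPN => l Hl; apply: ndx.
    apply/cvg_ex; exists l; apply: cvg_trans Hl.
    by rewrite (_ : (fun s => _) = (fun s => s^-1 *: (h (s + x) - h x)))//; apply/funext => s /=; rewrite [s%:A]mulr1.
  exists 0%N => k _; rewrite lee_fin expr0n/= sub0r.
  by apply: le_trans (slope_sqr_ge0 _ _ _); rewrite lerNl oppr0 ltW.
set l := derive1 h x.
pose e' := e / (2 * `|l| + 1).
have e'0 : 0 < e' by rewrite divr_gt0// ltr_wpDl// mulr_ge0.
have [r r0 Hr] := derive_cell dx e'0.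
exists (Num.truncn r^-1) => k rk; rewrite lee_fin.
have K0 : 0 < k.+1%:R :> R by rewrite ltr0n.
have Kr : k.+1%:R^-1 < r.
  rewrite -[ltRHS]invrK ltf_pV2 ?posrE ?invr_gt0//.
  by rewrite (lt_le_trans (truncnS_gt _))// ler_nat.
have [j [jx xj]] : exists j : 'I_k.+1, j%:R / k.+1%:R <= x /\ x <= j.+1%:R / k.+1%:R.
  have [x1'|x1'] := ltP x 1.
    have jk : (Num.truncn (k.+1%:R * x) < k.+1)%N.
      by rewrite truncn_lt_nat ?mulr_ge0 ?(ltW K0)// gtr_pMr.
    exists (Ordinal jk) => /=; split.
      by rewrite ler_pdivrMr// mulrC truncn_le mulr_ge0// ltW.
    by rewrite ler_pdivlMr// mulrC ltW// truncnS_gt.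
  exists ord_max; split; rewrite /= ?divff ?gt_eqF//.
  by apply: le_trans x1'; rewrite ler_pdivrMr// mul1r ler_nat.
have cell : j.+1%:R / k.+1%:R - j%:R / k.+1%:R = k.+1%:R^-1 :> R.
  by rewrite -mulrBl -natr1 addrAC subrr add0r mul1r.
have := Hr _ _ jx xj; rewrite cell => /(_ Kr); rewrite -/l => h1.
pose s := k.+1%:R * (h (j.+1%:R / k.+1%:R) - h (j%:R / k.+1%:R)).
apply: (@le_trans _ _ (s ^+ 2)); last first.
  rewrite /slope_sqr (bigD1 j)//= indicE mem_set ?mulr1 ?lerDl; last by rewrite /= in_itv/= jx xj.
  by apply: sumr_ge0 => i _; rewrite mulr_ge0 ?sqr_ge0// indicE.
have sl : `|s - l| <= e'.
  rewrite -(@ler_pM2r _ k.+1%:R^-1) ?invr_gt0//.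
  rewrite -[X in _ * X]gtr0_norm ?invr_gt0// -normrM mulrBl.
  by rewrite /s mulrAC divff ?gt_eqF// mul1r.
have : `|l * (s - l)| <= `|l| * e' by rewrite normrM ler_wpM2l.
rewrite ler_norml => /andP[h2 _].
have h3 : 2 * (`|l| * e') <= e.
  rewrite /e' mulrA mulrA ler_pdivrMr; last by rewrite ltr_wpDl// mulr_ge0.
  by rewrite mulrC ler_wpM2l ?(ltW e0)// lerDl.
have := sqr_ge0 (s - l).
have : s ^+ 2 = l ^+ 2 + 2 * (l * (s - l)) + (s - l) ^+ 2 by ring.
by lra.
Qed.

Lemma rate_energy (sigma : R) (x : skorohod R) (a : R) : sigma != 0 ->
  (rate_function sigma x <= a%:E)%E <-> energy_bound x (2 * sigma ^+ 2 * a).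
Proof.
move=> s0; rewrite /rate_function (negbTE s0).
have s2 : 0 < 2 * sigma ^+ 2 by rewrite mulr_gt0// exprn_even_gt0.
case: asboolP => [[x0 ac]|nac]; last first.
  split; first by rewrite leye_eq.
  by move=> eb; exfalso; apply: nac; split; [case: eb|exact: energy_ac eb].
split.
- move=> h; apply: energy_of_ac => //.
  apply: (@le_trans _ _ ((2 * sigma ^+ 2)%:E * a%:E)%E).
    apply: le_trans (lee_wpmul2l _ h); last by rewrite lee_fin ltW.
    by rewrite muleA -EFinM divff ?mul1e// gt_eqF.
  by rewrite -EFinM.
- move=> /energy_integral h.
  apply: (@le_trans _ _ (((2 * sigma ^+ 2)^-1)%:E * (2 * sigma ^+ 2 * a)%:E)%E).
    by apply: lee_wpmul2l => //; rewrite lee_fin invr_ge0 ltW.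
  by rewrite -EFinM mulrA mulVf ?mul1r// gt_eqF.
Qed.

End energy_to_rate.

(** * Compactness of the energy balls, polygons *)

Section skorohod_energy.
Context {R : realType}.
Implicit Types (h : R -> R) (x y : skorohod R) (M : R).

Lemma sup_ball x y (r e : R) : r < e ->
  (forall t, 0 <= t <= 1 -> `|x t - y t| <= r) -> ball x e y.
Proof.
move=> re H; apply/skorohod_ballP; exists r; split => //.
exists id; first exact: time_change_id.
move=> t; rewrite in_itv/= => t01; split; last exact: H.
by rewrite subrr normr0; apply: le_trans (H t t01).
Qed.

Lemma energy_holder h M s t : energy_bound h M -> 0 <= s -> s <= t -> t <= 1 ->
  (h t - h s) ^+ 2 <= M * (t - s).
Proof.
move=> [_ [E hE [EM HE]]] s0 st t1; apply: le_trans (HE _ _ s0 st t1) _.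
rewrite mulrC ler_wpM2r ?subr_ge0// (le_trans _ EM)// lerB ?hE//.
Qed.

Lemma energy_bound_ext h h' M : (forall t, 0 <= t <= 1 -> h t = h' t) ->
  energy_bound h M -> energy_bound h' M.
Proof.
move=> hh' [h0 [E hE [EM HE]]]; split; first by rewrite -hh' ?lexx ?ler01.
exists E => //; split => // s t s0 st t1.
by rewrite -!hh' ?s0 ?t1 ?(le_trans s0 st) ?(le_trans st t1)//; exact: HE.
Qed.

Lemma energy_skorohod h M : energy_bound h M ->
  exists x : skorohod R, forall t, 0 <= t <= 1 -> x t = h t.
Proof.
move=> eb; have M0 := energy_ge0 eb.
pose f t := if t \in `[0, 1] then h t else 0.
have fE t : 0 <= t <= 1 -> f t = h t by move=> t01; rewrite /f in_itv/= t01.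
have close (e : R) s t : 0 < e -> 0 <= s -> s <= t -> t <= 1 -> t - s < e ^+ 2 / (M + 1) ->
    `|f t - f s| < e.
  move=> e0 s0 st t1 ts; rewrite !fE ?s0 ?t1 ?(le_trans s0 st) ?(le_trans st t1)//.
  rewrite -ltr_sqr ?nnegrE ?normr_ge0 ?ltW// real_normK ?num_real//.
  apply: le_lt_trans (energy_holder eb s0 st t1) _.
  rewrite ltr_pdivlMr ?ltr_wpDl// in ts; apply: le_lt_trans ts.
  by rewrite mulrC ler_wpM2l ?subr_ge0// lerDl.
have r0 (e : R) : 0 < e -> 0 < e ^+ 2 / (M + 1).
  by move=> e0; rewrite divr_gt0 ?exprn_gt0// ltr_wpDl.
have cf : cadlag01 f.
  split=> t; rewrite in_itv/= => /andP[t0 t1].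
    apply/cvgrPdist_lt => e e0; near=> s.
    have ts : t < s by near: s; exact: nbhs_right_gt.
    have s1 : s < 1 by near: s; exact: nbhs_right_lt.
    have st : s < t + e ^+ 2 / (M + 1) by near: s; apply: nbhs_right_lt; rewrite ltrDl r0.
    by rewrite distrC; apply: close; rewrite ?(ltW ts) ?(ltW s1)// ltrBlDl.
  apply/cvg_ex; exists (f t); apply/cvgrPdist_lt => e e0; near=> s.
  have ts : s < t by near: s; exact: nbhs_left_lt.
  have s1 : 0 < s by near: s; exact: nbhs_left_gt.
  have st : t - e ^+ 2 / (M + 1) < s by near: s; apply: nbhs_left_gt; rewrite gtrBl r0.
  by apply: close; rewrite ?(ltW ts) ?(ltW s1)//; lra.
have of_ t : t \notin `[0, 1] -> f t = 0 by rewrite /f => /negbTE ->.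
by exists (Skorohod cf of_).
Unshelve. all: by end_near. Qed.

Lemma ultra_real_limit (T : Type) (U : set_system T) (f : T -> R) (b : R) :
  UltraFilter U -> U [set z | `|f z| <= b] -> exists l : R, f z @[z --> U] --> l.
Proof.
move=> UU Ub.
have [|l [_ fl]] := @segment_compact R (- b) b (f @ U) _.
  change (U (f @^-1` `[- b, b]%classic)).
  by apply: (@filterS _ U _ _ _ _ Ub) => z /=; rewrite ler_norml in_itv/=.
exists l => B lB; have [//|UB] := in_ultra_setVsetC (f @^-1` B) UU.
by have [z [? ?]] := fl (~` B) B UB lB.
Qed.

(** Along an ultrafilter both the paths and their functions E converge pointwise,
    and the limits satisfy the same inequalities; equicontinuity makes the
    convergence of the paths uniform. *)
Lemma compact_energy M : compact [set x : skorohod R | energy_bound x M].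
Proof.
rewrite compact_ultra => U UU UK.
have [x0 ex0] : [set x : skorohod R | energy_bound x M] !=set0.
  by apply: filter_ex UK.
have M0 := energy_ge0 ex0.
have ch x : exists E : R -> R, {homo E : s t / s <= t} /\ (energy_bound x M -> E 1 - E 0 <= M /\
    forall s t, 0 <= s -> s <= t -> t <= 1 -> (x t - x s) ^+ 2 <= (t - s) * (E t - E s)).
  have [eb|neb] := pselect (energy_bound x M).
    by have [_ [E hE HE]] := eb; exists E; split.
  by exists (fun=> 0); split.
have [E HE] := choice ch.
pose G x t := E x (clamp 0 1 t) - E x 0.
have hbound x t : energy_bound x M -> 0 <= t <= 1 -> `|x t| <= M + 1.
  move=> eb /andP[t0 t1]; apply: norm_le_sqr; first by rewrite addr_ge0.
  have := energy_holder eb (lexx 0) t0 t1; have [-> _] := eb; rewrite !subr0 => h.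
  apply: (le_trans h); apply: (@le_trans _ _ M); first by rewrite ler_piMr.
  have := sqr_ge0 M; rewrite sqrrD expr1n mulr1 => h2; lra.
have Gbound x t : energy_bound x M -> `|G x t| <= M.
  move=> eb; have [hE /(_ eb) [EM _]] := HE x.
  have /andP[c0 c1] := @clamp_in R 0 1 t ler01.
  rewrite ger0_norm ?subr_ge0 ?hE// (le_trans _ EM)// lerB ?hE//.
have /choice[h Hh] t : exists l : R, x t @[x --> U] --> l.
  apply: (@ultra_real_limit _ U (fun x : skorohod R => x t) (M + 1) UU); apply: (@filterS _ U _ _ _ _ UK) => x eb /=.
  have [t01|] := boolP (t \in `[0, 1]).
    by rewrite in_itv/= in t01; exact: hbound.
  by move=> /skorohod_out ->; rewrite normr0 addr_ge0.
have /choice[H HH] t : exists l : R, G x t @[x --> U] --> l.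
  by apply: (@ultra_real_limit _ U (fun x => G x t) M UU); apply: (@filterS _ U _ _ _ _ UK) => x eb /=; exact: Gbound.
have ebh : energy_bound h M.
  split.
    have c0 : x 0 @[x --> U] --> (0 : R).
      by apply: cvg_near_cst; apply: (@filterS _ U _ _ _ _ UK) => x [x00 _].
    by rewrite -(cvg_lim (@Rhausdorff R) (Hh 0)); exact: (cvg_lim (@Rhausdorff R) c0).
  exists H.
    move=> s t st; apply: (ler_cvg_to (HH s) (HH t)); apply: nearW => x.
    by have [hE _] := HE x; rewrite /G lerD2r; apply: hE; exact: clamp_homo.
  split.
    apply: (cvgr_to_le (cvgB (HH 1) (HH 0))); apply: (@filterS _ U _ _ _ _ UK) => x eb /=.
    have [_ /(_ eb)[EM _]] := HE x.
    change (G x 1 - G x 0 <= M).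
    by rewrite /G !clamp_id ?lexx ?ler01// subrr subr0.
  move=> s t s0 st t1.
  have c1 : (x t - x s) ^+ 2 @[x --> U] --> (h t - h s) ^+ 2.
    by rewrite expr2; under eq_fun do rewrite expr2; apply: cvgM; exact: cvgB.
  have c2 : (t - s) * (G x t - G x s) @[x --> U] --> (t - s) * (H t - H s).
    by apply: cvgMr; exact: cvgB.
  apply: (ler_cvg_to c1 c2); apply: (@filterS _ U _ _ _ _ UK) => x eb /=.
  have [_ /(_ eb)[_ HE']] := HE x.
  rewrite /G !clamp_id ?s0 ?t1 ?(le_trans s0 st) ?(le_trans st t1)//.
  by rewrite opprB addrA subrK; exact: HE'.
have [x Hx] := energy_skorohod ebh.
exists x; split; first by apply: energy_bound_ext ebh => t /Hx.
move=> B /nbhs_ballP[e /= e0 eB].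
pose d := e / 8; have d0 : 0 < d by rewrite divr_gt0.
pose k := Num.truncn (M / d ^+ 2).
have kM : M / k.+1%:R <= d ^+ 2.
  rewrite ler_pdivrMr// mulrC -ler_pdivrMr ?exprn_gt0//.
  by rewrite ltW// truncnS_gt.
have grid : U [set y | forall j : 'I_k.+2, `|h (j%:R / k.+1%:R) - y (j%:R / k.+1%:R)| < d].
  by apply: filter_forall => j; have /cvgrPdist_lt/(_ d d0) := Hh (j%:R / k.+1%:R).
have KU : U [set y : skorohod R | energy_bound y M] by [].
apply: (@filterS _ U _ _ _ _ (filterI KU grid)) => y [eby gy]; apply: eB.
apply: (@sup_ball _ _ (d + d + d)); first by rewrite /d; lra.
move=> t /andP[t0 t1]; rewrite Hx ?t0//.
have K0 : 0 < k.+1%:R :> R by rewrite ltr0n.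
pose j := Num.truncn (k.+1%:R * t).
have kt0 : 0 <= k.+1%:R * t by rewrite mulr_ge0.
have jk : (j < k.+2)%N.
  rewrite ltnS -(ler_nat R); apply: (@le_trans _ _ (k.+1%:R * t)); first by rewrite truncn_le.
  by rewrite ler_piMr.
pose s : R := j%:R / k.+1%:R.
have s0 : 0 <= s by rewrite divr_ge0.
have st : s <= t by rewrite ler_pdivrMr// mulrC truncn_le.
have ts : t - s <= k.+1%:R^-1.
  rewrite lerBlDr -[X in X + _]mul1r -mulrDl ler_pdivlMr// mulrC addrC natr1.
  by rewrite ltW// truncnS_gt.
have mod (g : R -> R) : energy_bound g M -> `|g t - g s| <= d.
  move=> eg; apply: norm_le_sqr; first exact: ltW.
  apply: le_trans (energy_holder eg s0 st t1) _; apply: le_trans kM.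
  by rewrite ler_wpM2l.
have := gy (Ordinal jk); rewrite /= -/s => /ltW gs.
have h1 := mod _ ebh; have h2 := mod _ eby.
rewrite (_ : h t - y t = (h t - h s) + (h s - y s) - (y t - y s)); last by ring.
by apply: le_trans (ler_normB _ _) _; rewrite lerD// (le_trans (ler_normD _ _))// lerD.
Qed.

Lemma compact_closed_separated (K F : set (skorohod R)) : compact K -> closed F ->
  K `&` F = set0 -> exists2 e : R, 0 < e & forall x y, K x -> ball x e y -> ~ F y.
Proof.
move=> cK cF KF.
have := (@compact_near_coveringP _ K).1 cK R (0^'+)
  (fun e x => forall y, ball x e y -> ~ F y) _.
case=> [x Kx|].
- have : nbhs x (~` F).
    apply: open_nbhs_nbhs; split; first exact: closed_openC.
    by move=> Fx; have : (K `&` F) x by []; rewrite KF.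
  move=> /nbhs_ballP[r /= r0 rF].
  exists (ball x (r / 2), [set e : R | e < r / 2]).
    split => /=; first by apply: nbhsx_ballx; rewrite divr_gt0.
    by apply: nbhs_right_lt; rewrite divr_gt0.
  move=> [z e] /= [xz er] y zy; apply: rF.
  rewrite [r]splitr; apply: ball_triangle xz _; apply: le_ball zy; exact: ltW.
- move=> e /= e0 He.
  exists (e / 2); first by rewrite divr_gt0.
  move=> x y Kx xy; apply: (He (e / 2) _ _ x Kx y xy).
    by rewrite /ball_/= sub0r normrN gtr0_norm ?divr_gt0// ltr_pdivrMr// ltr_pMr// ltr1n.
  by rewrite divr_gt0.
Qed.

End skorohod_energy.

Section polygon.
Context {R : realType}.
Implicit Types (k : nat) (xi : nat -> R) (z : R -> R).

(** One more cell of the grid adds the part of y that lies in it. *)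
Lemma clampS (k y : R) : 0 <= k -> clamp 0 (k + 1) y = clamp 0 k y + clamp 0 1 (y - k).
Proof.
move=> k0; have [yk|ky] := leP y k.
  have -> : clamp 0 1 (y - k) = 0 :> R.
    by rewrite /clamp max_l// ge_min subr_le0 yk.
  by rewrite addr0 /clamp !min_l//; lra.
have -> : clamp 0 k y = k by rewrite /clamp min_r ?(ltW ky)// max_r.
have [y1|y1] := leP y (k + 1).
  by rewrite !clamp_id; [ring|apply/andP; split; lra..].
by rewrite /clamp !min_r ?max_r//; lra.
Qed.

Lemma sum_clamp k (y : R) : \sum_(j < k) clamp 0 1 (y - j%:R) = clamp 0 k%:R y.
Proof.
elim: k => [|k IH].
  by rewrite big_ord0; have := @clamp_in R 0 0 y (lexx _); lra.
by rewrite big_ord_recr/= IH -natr1 clampS.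
Qed.

Lemma weighted_cauchy_schwarz k xi (w : nat -> R) : (forall j, 0 <= w j) ->
  (\sum_(j < k) xi j * w j) ^+ 2 <= (\sum_(j < k) w j) * \sum_(j < k) xi j ^+ 2 * w j.
Proof.
move=> w0; set B := \sum_(j < k) xi j * w j; set W := \sum_(j < k) w j.
set A := \sum_(j < k) xi j ^+ 2 * w j.
have W0 : 0 <= W by exact: sumr_ge0.
have [WE|WN] := eqVneq W 0.
  have : B = 0.
    rewrite /B big1// => j _; have /eqP := WE.
    by rewrite psumr_eq0// => /allP/(_ j (mem_index_enum _))/eqP ->; rewrite mulr0.
  by move=> ->; rewrite WE mul0r expr0n.
have Wp : 0 < W by rewrite lt_neqAle eq_sym WN.
have : 0 <= \sum_(j < k) w j * (xi j * W - B) ^+ 2.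
  by apply: sumr_ge0 => j _; rewrite mulr_ge0// sqr_ge0.
rewrite (_ : \sum_(j < k) _ = W ^+ 2 * A - 2 * W * B * B + B ^+ 2 * W); last first.
  rewrite (eq_bigr (fun j : 'I_k => W ^+ 2 * (xi j ^+ 2 * w j) - 2 * W * B * (xi j * w j) + B ^+ 2 * w j)).
    by rewrite big_split sumrB/= -!mulr_sumr.
  by move=> j _; ring.
rewrite (_ : _ + _ = W * (W * A - B ^+ 2)); last by ring.
by rewrite pmulr_rge0// subr_ge0.
Qed.

Definition polygon k xi (t : R) : R := \sum_(j < k) xi j * clamp 0 1 (k%:R * t - j%:R).

(** E(t) = k sum_j xi_j^2 clamp(k t - j) is the primitive of the squared slope, and
    the inequality is Cauchy-Schwarz with the increments of the clamps as weights. *)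
Lemma polygon_energy k xi : energy_bound (polygon k xi) (k%:R * \sum_(j < k) xi j ^+ 2).
Proof.
have K0 : 0 <= k%:R :> R by [].
pose E (t : R) := k%:R * \sum_(j < k) xi j ^+ 2 * clamp 0 1 (k%:R * t - j%:R).
split.
  rewrite /polygon big1// => j _; rewrite mulr0 sub0r.
  by rewrite (_ : clamp 0 1 (- j%:R) = 0) ?mulr0// /clamp max_l// ge_min oppr_le0 ler0n.
exists E.
  move=> s t st; rewrite /E ler_wpM2l//; apply: ler_sum => j _.
  by rewrite ler_wpM2l ?sqr_ge0// clamp_homo// lerD2r ler_wpM2l.
split.
  rewrite /E -mulrBr ler_wpM2l// -sumrB; apply: ler_sum => j _.
  rewrite -mulrBr -[leRHS]mulr1 ler_wpM2l ?sqr_ge0//.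
  have /andP[_ h1] := @clamp_in R 0 1 (k%:R * 1 - j%:R) ler01.
  have /andP[h2 _] := @clamp_in R 0 1 (k%:R * 0 - j%:R) ler01.
  lra.
move=> s t s0 st t1.
pose w (j : nat) := clamp 0 1 (k%:R * t - j%:R) - clamp 0 1 (k%:R * s - j%:R).
have w0 j : 0 <= w j by rewrite subr_ge0 clamp_homo// lerD2r ler_wpM2l.
have -> : polygon k xi t - polygon k xi s = \sum_(j < k) xi j * w j.
  by rewrite /polygon -sumrB; apply: eq_bigr => j _; rewrite -mulrBr.
have -> : E t - E s = k%:R * \sum_(j < k) xi j ^+ 2 * w j.
  by rewrite /E -mulrBr -sumrB; congr (_ * _); apply: eq_bigr => j _; rewrite -mulrBr.
have Wk : \sum_(j < k) w j = k%:R * (t - s).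
  rewrite /w sumrB !sum_clamp !clamp_id ?mulrBr//.
  - by rewrite mulr_ge0//= ler_piMr// (le_trans st).
  - by rewrite mulr_ge0 ?(le_trans s0 st)//= ler_piMr.
have := @weighted_cauchy_schwarz k xi w w0; rewrite Wk => h; apply: (le_trans h).
by rewrite le_eqVlt; apply/orP; left; apply/eqP; ring.
Qed.

Definition grid_incr k z (j : nat) : R := z (j.+1%:R / k%:R) - z (j%:R / k%:R).

Lemma grid_cell k (t : R) : 0 <= t <= 1 -> (0 < k)%N ->
  exists j : 'I_k, j%:R / k%:R <= t <= j.+1%:R / k%:R.
Proof.
move=> /andP[t0 t1]; case: k => // k _.
have K0 : 0 < k.+1%:R :> R by rewrite ltr0n.
have [t1'|t1'] := ltP t 1.
  have jk : (Num.truncn (k.+1%:R * t) < k.+1)%N.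
    by rewrite truncn_lt_nat ?mulr_ge0 ?(ltW K0)// gtr_pMr.
  exists (Ordinal jk) => /=; apply/andP; split.
    by rewrite ler_pdivrMr// mulrC truncn_le mulr_ge0// ltW.
  by rewrite ler_pdivlMr// mulrC ltW// truncnS_gt.
exists ord_max; apply/andP; split; rewrite /= ?divff ?gt_eqF//.
by apply: le_trans t1'; rewrite ler_pdivrMr// mul1r ler_nat.
Qed.

Lemma sum_grid_incr k z (j : nat) : z 0 = 0 -> \sum_(i < j) grid_incr k z i = z (j%:R / k%:R).
Proof.
move=> z0; rewrite -(big_mkord xpredT (grid_incr k z)) /grid_incr.
by rewrite (@telescope_sumr_eq _ _ _ (fun i => z (i%:R / k%:R)))// mul0r z0 subr0.
Qed.

(** In each cell both functions stay within e of their common value at the left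
    end. *)
Lemma polygon_close k z (e : R) : (0 < k)%N -> z 0 = 0 ->
  (forall (j : 'I_k) (t : R), j%:R / k%:R <= t <= j.+1%:R / k%:R -> `|z t - z (j%:R / k%:R)| <= e) ->
  forall t, 0 <= t <= 1 -> `|z t - polygon k (grid_incr k z) t| <= 2 * e.
Proof.
move=> k0 z0 H t t01; have [j jt] := grid_cell t01 k0.
have K0 : 0 < k%:R :> R by rewrite ltr0n.
have /andP[jt1 jt2] := jt.
have kt1 : j%:R <= k%:R * t by rewrite mulrC -ler_pdivrMr.
have kt2 : k%:R * t <= j.+1%:R by rewrite mulrC -ler_pdivlMr.
have pE : polygon k (grid_incr k z) t = z (j%:R / k%:R) + grid_incr k z j * (k%:R * t - j%:R).
  rewrite /polygon -(big_mkord xpredT (fun i => grid_incr k z i * clamp 0 1 (k%:R * t - i%:R))).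
  rewrite (big_cat_nat (n := j.+1))//= big_nat_recr//=.
  rewrite (_ : \sum_(j.+1 <= i < k) _ = 0) ?addr0; last first.
    rewrite big_nat_cond big1// => i /andP[/andP[ji _] _].
    rewrite /clamp max_l ?mulr0// ge_min subr_le0.
    by rewrite (le_trans kt2)// ler_nat.
  rewrite (clamp_id (x := _ - _)); last by rewrite subr_ge0 kt1 lerBlDl; move: kt2; rewrite -natr1.
  congr (_ + _); rewrite -(sum_grid_incr k j z0) -(big_mkord xpredT (grid_incr k z)).
  apply: eq_big_nat => i /andP[_ ij]; rewrite /clamp min_r; first by rewrite max_r// mulr1.
  by rewrite lerBrDr addrC natr1; apply: le_trans kt1; rewrite ler_nat.
rewrite pE opprD addrA.
have h1 := H j t jt.
have h2 : `|grid_incr k z j| <= e.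
  by apply: H; rewrite lexx andbT ler_pM2r ?invr_gt0// ler_nat.
have h3 : `|grid_incr k z j * (k%:R * t - j%:R)| <= e.
  rewrite normrM -[leRHS]mulr1 ler_pM// ger0_norm ?subr_ge0//.
  by rewrite lerBlDl; move: kt2; rewrite -natr1.
by apply: le_trans (ler_normB _ _) _; lra.
Qed.

End polygon.

Section rate_levels.
Context {R : realType}.
Implicit Types (x : skorohod R) (sigma r : R).

Lemma rate_ge0 sigma x : (0 <= rate_function sigma x)%E.
Proof.
rewrite /rate_function; case: ifP => _; first by case: ifP.
case: ifP => // _; apply: mule_ge0; first by rewrite lee_fin invr_ge0 mulr_ge0// sqr_ge0.
by apply: integral_ge0 => u _; rewrite lee_fin sqr_ge0.
Qed.

(** For sigma = 0 both sides say that x vanishes on [0, 1]. *)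
Lemma rate_level sigma x r : 0 <= r ->
  (rate_function sigma x <= r%:E)%E <-> energy_bound x (2 * sigma ^+ 2 * r).
Proof.
move=> r0; have [->|s0] := eqVneq sigma 0; last exact: rate_energy.
rewrite expr2 !(mul0r, mulr0) /rate_function eqxx; case: asboolP => [x0|nx0].
  split => // _; apply: (@energy_bound_ext _ (fun=> 0)).
    by move=> t t01; rewrite x0// in_itv.
  by split => //; exists (fun=> 0) => //; split; [rewrite subrr|move=> s t _ _ _; rewrite !subrr expr0n mulr0].
split; first by rewrite leye_eq.
move=> ex; exfalso; apply: nx0 => t; rewrite in_itv/= => /andP[t0 t1].
have := energy_holder ex (lexx 0) t0 t1; rewrite mul0r ex.1 subr0 => h.
by apply/eqP; rewrite -sqrf_eq0 eq_le sqr_ge0 andbT.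
Qed.

Lemma rate_good sigma (alpha : \bar R) : (alpha < +oo)%E ->
  compact [set x | (rate_function sigma x <= alpha)%E].
Proof.
have neg (b : \bar R) : (b < 0)%E -> compact [set x | (rate_function sigma x <= b)%E].
  move=> b0; rewrite (_ : [set x | _] = set0); first exact: compact0.
  by apply/seteqP; split => x //= h; have := le_lt_trans (le_trans (rate_ge0 sigma x) h) b0; rewrite ltxx.
case: alpha => [r| |] // _; last by apply: neg; rewrite ltNy0.
have [r0|r0] := ltP r 0; first by apply: neg; rewrite lte_fin.
rewrite (_ : [set x | _] = [set x : skorohod R | energy_bound x (2 * sigma ^+ 2 * r)]).
  exact: compact_energy.
by apply/seteqP; split => x /=; rewrite rate_level.
Qed.

End rate_levels.

(** * Logarithms of probabilities *)

Section lne_bounds.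
Context {R : realType}.

Lemma mul_lne_le (a p y : R) : 0 < a -> 0 <= p -> p <= expR (y / a) -> (a%:E * lne p%:E <= y%:E)%E.
Proof.
move=> a0 p0 py; move: p0; rewrite le_eqVlt => /orP[/eqP <-|p0].
  by rewrite le0_lneNy// gt0_muleNy ?lte_fin// leNye.
rewrite lne_EFin// -EFinM lee_fin mulrC -ler_pdivlMr//.
by rewrite -[leRHS]expRK ler_ln ?posrE ?expR_gt0.
Qed.

Lemma mul_lne_ge (a p y : R) : 0 < a -> expR (y / a) <= p -> (y%:E <= a%:E * lne p%:E)%E.
Proof.
move=> a0 py; have p0 : 0 < p by exact: lt_le_trans (expR_gt0 _) py.
rewrite lne_EFin// -EFinM lee_fin mulrC -ler_pdivrMr//.
by rewrite -[leLHS]expRK ler_ln ?posrE ?expR_gt0.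
Qed.

Lemma le_ereal_real (x y : \bar R) : (forall r : R, (r%:E < x)%E -> (r%:E <= y)%E) -> (x <= y)%E.
Proof.
move=> H; rewrite leNgt; apply/negP => yx.
case: x y yx H => [x| |] [y| |] //= yx H.
- rewrite lte_fin in yx.
  have := H ((x + y) / 2); rewrite lte_fin lee_fin => h.
  have : (x + y) / 2 <= y by apply: h; lra.
  lra.
- have : ((x - 1)%:E <= -oo)%E by apply: H; rewrite lte_fin; lra.
  by rewrite leeNy_eq.
- have := H (y + 1) (ltry _); rewrite lee_fin; lra.
- by have := H 0 (ltry _); rewrite leeNy_eq.
Qed.

End lne_bounds.

(** * A finite net of the unit sphere *)

Section sphere_net.
Context {R : realType}.

(** A point of [-1, 1]^k with coordinates in Z / N, extended by 0 to all indices. *)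
Definition net_vector k N (i : {ffun 'I_k -> 'I_(2 * N).+1}) (j : nat) : R :=
  if insub j is Some j' then ((i j')%:R - N%:R) / N%:R else 0.

Lemma net_vectorE k N (i : {ffun 'I_k -> 'I_(2 * N).+1}) (j : 'I_k) :
  net_vector i j = ((i j)%:R - N%:R) / N%:R.
Proof. by rewrite /net_vector; case: insubP => [u _ /val_inj ->//|]; rewrite ltn_ord. Qed.

(** Round x / |x| to the net: each coordinate moves by at most 1 / N. *)
Lemma sphere_net k N (x : 'I_k -> R) (r : R) : (0 < N)%N -> k%:R <= N%:R :> R -> 0 < r ->
  r ^+ 2 < \sum_(j < k) x j ^+ 2 ->
  exists i : {ffun 'I_k -> 'I_(2 * N).+1},
    \sum_(j < k) net_vector i j ^+ 2 <= 1 + 3 * k%:R / N%:R /\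
    r * (1 - k%:R / N%:R) <= \sum_(j < k) net_vector i j * x j.
Proof.
move=> N0 kleN r0 rx; set s2x := \sum_(j < k) _ in rx.
have Np : 0 < N%:R :> R by rewrite ltr0n.
pose s := Num.sqrt s2x.
have s2x0 : 0 <= s2x by apply: sumr_ge0 => j _; exact: sqr_ge0.
have ss : s ^+ 2 = s2x by rewrite sqr_sqrtr.
have rs : r < s by rewrite -ltr_sqr ?nnegrE ?sqrtr_ge0 ?(ltW r0)// ss.
have s0 : 0 < s by exact: lt_trans rs.
have xs j : `|x j| <= s.
  rewrite -[`|_|]ger0_norm// -sqrtr_sqr ler_wsqrtr// real_normK ?num_real// /s2x (bigD1 j)//= lerDl.
  by apply: sumr_ge0 => i _; exact: sqr_ge0.
pose u j := x j / s.
have ub j : -1 <= u j <= 1.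
  by rewrite -ler_norml normrM normfV (gtr0_norm s0) ler_pdivrMr// mul1r.
have y0 j : 0 <= N%:R * (u j + 1).
  by rewrite mulr_ge0 ?(ltW Np)//; have /andP[] := ub j; lra.
have tb j : (Num.truncn (N%:R * (u j + 1)) < (2 * N).+1)%N.
  rewrite ltnS truncn_le_nat.
  have -> : (2 * N).+1%:R = N%:R * 2 + 1 :> R by rewrite -natr1 natrM mulrC.
  have : N%:R * (u j + 1) <= N%:R * 2 :> R.
    by rewrite ler_wpM2l ?(ltW Np)//; have /andP[] := ub j; lra.
  lra.
pose i := [ffun j : 'I_k => Ordinal (tb j)].
exists i.
pose v (j : 'I_k) := net_vector i j.
have dv j : `|v j - u j| <= N%:R^-1.
  rewrite /v net_vectorE ffunE /=.
  have /andP[t1 t2] := truncn_itv (y0 j).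
  rewrite -natr1 in t2.
  have -> : ((Num.truncn (N%:R * (u j + 1)))%:R - N%:R) / N%:R - u j =
    ((Num.truncn (N%:R * (u j + 1)))%:R - N%:R * (u j + 1)) / N%:R by field; rewrite gt_eqF.
  rewrite normrM (@ger0_norm _ N%:R^-1) ?invr_ge0// ler_piMl ?invr_ge0// ler_norml.
  apply/andP; split; lra.
have su : \sum_(j < k) u j ^+ 2 = 1.
  rewrite /u; under eq_bigr do rewrite exprMn; rewrite -mulr_suml exprVn ss divff// gt_eqF//.
  by rewrite -/s2x -ss exprn_gt0.
have kN : \sum_(j < k) N%:R^-1 = k%:R / N%:R :> R by rewrite sumr_const card_ord -[LHS]mulr_natl.
split.
- apply: (@le_trans _ _ (\sum_(j < k) (u j ^+ 2 + 3 * N%:R^-1))).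
    apply: ler_sum => j _; rewrite -/(v j).
    have := dv j; rewrite ler_norml => /andP[d1 d2]; have /andP[u1 u2] := ub j.
    have N1 : N%:R^-1 <= 1 :> R by rewrite invf_le1// ler1n.
    rewrite -subr_ge0; have -> : u j ^+ 2 + 3 * N%:R^-1 - v j ^+ 2 =
      3 * N%:R^-1 - (v j - u j) * (v j - u j) - 2 * u j * (v j - u j) by ring.
    have h1 : (v j - u j) * (v j - u j) <= N%:R^-1.
      rewrite (le_trans (ler_norm _))// normrM -[leRHS]mulr1 ler_pM// (le_trans (dv j))//.
    have h2 : u j * (v j - u j) <= N%:R^-1.
      rewrite (le_trans (ler_norm _))// normrM -[leRHS]mul1r ler_pM// ler_norml u1 u2//.
    lra.
  by rewrite big_split/= su -mulr_sumr kN mulrA.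
- apply: (@le_trans _ _ (\sum_(j < k) (u j * x j - N%:R^-1 * s))); last first.
    apply: ler_sum => j _; rewrite -/(v j).
    have h : `|(v j - u j) * x j| <= N%:R^-1 * s by rewrite normrM ler_pM.
    by move: h; rewrite ler_norml => /andP[+ _]; lra.
  rewrite big_split/= sumrN -mulr_suml kN.
  have -> : \sum_(j < k) u j * x j = s.
    rewrite /u; transitivity (\sum_(j < k) x j ^+ 2 / s).
      by apply: eq_bigr => j _; rewrite mulrAC expr2.
    by rewrite -mulr_suml -/s2x -ss; field; rewrite gt_eqF.
  have -> : s - k%:R / N%:R * s = s * (1 - k%:R / N%:R) by ring.
  by rewrite ler_wpM2r ?(ltW rs)// subr_ge0 ler_pdivrMr// mul1r.
Qed.
End sphere_net.

(** * Conditional bounds as inequalities between weighted integrals *)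

Section conditional_walk.
Context {R : realType} d (Omega : measurableType d) (P : probability Omega R).
Variables (T : Omega -> Omega) (F0 : set (set Omega)).
Hypothesis bT : bijective T.
Hypothesis mT : measurable_fun setT T.
Hypothesis PT : forall A, measurable A -> P (T @^-1` A) = P A.
Hypothesis sF : sub_sigma_field F0.
Hypothesis F0T : F0 `<=` preimage_set_system setT T F0.
Implicit Types f g V Z : Omega -> R.

Local Notation E := (Ex P).

(** Functions on Omega equipped with F_0. *)
Definition adapted0 f := bmeas (f : g_sigma_algebraType F0 -> R).

(** F_i = T^-i(F_0), so F_i-measurable functions are F_0-measurable functions
    composed with T^i. *)
Definition adapted i f := exists2 g, adapted0 g & f = g \o iter i T.

Lemma sigF0 : <<s F0 >> = F0.
Proof. by apply: sigma_algebra_id; case: sF. Qed.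

Lemma adapted0P f : adapted0 f <-> measurable_for F0 f /\ exists c : R, forall w, `|f w| <= c.
Proof.
split=> -[mf bf]; split=> //.
- by move=> _ [B mB <-]; rewrite -sigF0; exact: mf.
- by move=> _ B mB; rewrite /measurable/= sigF0; apply: mf; exists B.
Qed.

Lemma adapted0_bmeas f : adapted0 f -> bmeas f.
Proof.
move=> /adapted0P[mf bf]; split => //.
by move=> _ B mB; case: sF => _; apply; apply: mf; exists B.
Qed.

Lemma measurable_iter i : measurable_fun setT (iter i T).
Proof. by elim: i => [|i IH]; [exact: measurable_id|exact: measurableT_comp]. Qed.

Lemma bmeas_iter i f : bmeas f -> bmeas (f \o iter i T).
Proof.
move=> [mf [c fc]]; split; last by exists c => w /=.
by apply: measurableT_comp => //; exact: measurable_iter.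
Qed.

Lemma Ex_iter i f : bmeas f -> E (f \o iter i T) = E f.
Proof.
move=> bf; elim: i => [//|i IH].
rewrite -[RHS]IH -[RHS](Ex_preserve mT PT (bmeas_iter i bf)).
by congr Ex; apply/funext => w; rewrite /= -iterS iterSr.
Qed.

Lemma adapted_bmeas i f : adapted i f -> bmeas f.
Proof. by move=> [g /adapted0_bmeas bg ->]; exact: bmeas_iter. Qed.

(** F_0 is contained in T^-1(F_0), and T is invertible. *)
Lemma adapted0_succ f : adapted0 f -> exists2 g, adapted0 g & f = g \o T.
Proof.
have [T' TK T'K] := bT.
move=> /adapted0P[mf [c fc]]; exists (f \o T'); last by apply/funext => w /=; rewrite TK.
apply/adapted0P; split; last by exists c => w /=.
move=> _ [B mB <-].
have /F0T[A FA AE] : F0 (setT `&` f @^-1` B) by apply: mf; exists B.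
rewrite (_ : _ `&` _ = A)// predeqE => w; split => [[_ fB]|Aw].
- by have : (setT `&` f @^-1` B) (T' w) by []; rewrite -AE => -[_]/=; rewrite T'K.
- split => //; have : (setT `&` T @^-1` A) (T' w) by split => //=; rewrite T'K.
  by rewrite AE => -[].
Qed.

Lemma adapted_succ i f : adapted i f -> adapted i.+1 f.
Proof.
move=> [g /adapted0_succ[h h0 ->] ->]; exists h => //.
Qed.

Lemma adapted_le i j f : (i <= j)%N -> adapted i f -> adapted j f.
Proof. by move=> /subnK <-; elim: (j - i)%N => // k IH /IH/adapted_succ. Qed.

Lemma adaptedW i f : adapted0 f -> adapted i f.
Proof. by move=> f0; apply: (@adapted_le 0) => //; exists f. Qed.

Lemma adapted_cst i c : adapted i (fun=> c).
Proof. by exists (fun=> c) => //; exact: bmeas_cst. Qed.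

Lemma adaptedD i f g : adapted i f -> adapted i g -> adapted i (fun w => f w + g w).
Proof.
move=> [f' f0 ->] [g' g0 ->]; exists (fun w => f' w + g' w) => //.
exact: bmeasD.
Qed.

Lemma adaptedM i f g : adapted i f -> adapted i g -> adapted i (fun w => f w * g w).
Proof.
move=> [f' f0 ->] [g' g0 ->]; exists (fun w => f' w * g' w) => //.
exact: bmeasM.
Qed.

Lemma adaptedZ i k f : adapted i f -> adapted i (fun w => k * f w).
Proof. by apply: adaptedM; exact: adapted_cst. Qed.

Lemma adaptedB i f g : adapted i f -> adapted i g -> adapted i (fun w => f w - g w).
Proof.
move=> [f' f0 ->] [g' g0 ->]; exists (fun w => f' w - g' w) => //.
exact: bmeasB.
Qed.

Lemma adapted_sum i I (r : seq I) (p : pred I) (F : I -> Omega -> R) :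
  (forall j, p j -> adapted i (F j)) -> adapted i (fun w => \sum_(j <- r | p j) F j w).
Proof.
move=> bF; elim: r => [|j r IH].
  have := adapted_cst i 0; congr adapted; apply/funext => w; by rewrite big_nil.
have -> : (fun w => \sum_(j <- j :: r | p j) F j w) = (fun w =>
    if p j then F j w + \sum_(j <- r | p j) F j w else \sum_(j <- r | p j) F j w).
  by apply/funext => w; rewrite big_cons.
by case: (boolP (p j)) => // pj; apply: adaptedD => //; exact: bF.
Qed.

Lemma adapted_exp i f : adapted i f -> adapted i (fun w => expR (f w)).
Proof.
move=> [f' f0 ->]; exists (fun w => expR (f' w)) => //; exact: bmeas_exp.
Qed.

Lemma adapted_norm i f : adapted i f -> adapted i (fun w => `|f w|).
Proof.
move=> [f' f0 ->]; exists (fun w => `|f' w|) => //; exact: bmeas_norm.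
Qed.

Lemma adapted_ge i f (c : R) : adapted i f -> adapted i (fun w => (c <= f w)%R%:R).
Proof.
move=> [f' f0 ->]; exists (fun w => (c <= f' w)%R%:R) => //; exact: bmeas_ge.
Qed.

(** E(Z | F_0) <= c almost surely: testing against weights V leaves no version of
    the conditional expectation to choose. *)
Definition cond_ub Z (c : R) := forall V, adapted0 V -> (forall w, 0 <= V w) ->
  E (fun w => V w * Z w) <= c * E V.

Lemma sum_le_trunc (y : R) K : 0 <= y -> (Num.truncn y < K)%N ->
  \sum_(j < K) (j%:R <= y)%R%:R = (Num.truncn y).+1%:R :> R.
Proof.
move=> y0 yK; under eq_bigr do rewrite -truncn_ge_nat//.
rewrite (_ : K = (Num.truncn y).+1 + (K - (Num.truncn y).+1))%N; last by rewrite subnKC.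
rewrite big_split_ord/= [X in _ + X]big1 ?addr0; last first.
  by move=> j _; rewrite leqNgt ltnS leq_addr.
rewrite (eq_bigr (fun=> 1)); last by move=> j _; rewrite -ltnS ltn_ord.
by rewrite sumr_const card_ord.
Qed.

(** Indicators of F_0-sets determine the bound: V is within 1 / N of 1 / N times
    the sum over j of the indicators of V >= j / N. Adding a constant to Z makes it
    nonnegative. *)
Lemma cond_ub_sets Z c : bmeas Z ->
  (forall A, F0 A -> (\int[P]_(w in A) (Z w)%:E <= c%:E * P A)%E) -> cond_ub Z c.
Proof.
move=> bZ Zc V aV V0.
have [mV [M0 VM0]] := aV.
pose M := (Num.truncn M0).+1.
have VM w : V w <= M%:R.
  by apply: le_trans (ler_norm _) _; apply: le_trans (VM0 w) _; rewrite ltW// truncnS_gt.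
have [mZ [K0 ZK0]] := bZ.
pose K := K0 + `|c|.
have K00 : 0 <= K0 by apply: le_trans (normr_ge0 _) (ZK0 point).
have cK : 0 <= c + K by rewrite /K; have := ler_norm (- c); rewrite normrN; lra.
have ZK w : 0 <= Z w + K.
  have := ZK0 w; rewrite ler_norml => /andP[+ _]; rewrite /K.
  by have := normr_ge0 c; lra.
have bV := adapted0_bmeas aV.
have bZK : bmeas (fun w => Z w + K) by apply: bmeasD => //; exact: bmeas_cst.
apply/ler_addgt0Pr => e e0.
have [N [N0 Ne]] : exists N, (0 < N)%N /\ (c + K) / N%:R <= e.
  exists (Num.truncn ((c + K) / e)).+1; split => //.
  rewrite ler_pdivrMr ?ltr0n// mulrC -ler_pdivrMr// ltW// truncnS_gt//.
have Np : 0 < N%:R :> R by rewrite ltr0n.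
pose I j w : R := (j%:R / N%:R <= V w)%R%:R.
pose VN w := \sum_(j < (N * M).+1) N%:R^-1 * I j w.
have VNE w : VN w = (Num.truncn (N%:R * V w)).+1%:R / N%:R.
  rewrite /VN -mulr_sumr mulrC; congr (_ * _).
  rewrite -(@sum_le_trunc _ (N * M).+1) ?mulr_ge0//; last first.
    rewrite ltnS -(ler_nat R) natrM (@le_trans _ _ (N%:R * V w)) ?ler_wpM2l//.
    by rewrite truncn_le mulr_ge0.
  by apply: eq_bigr => j _; rewrite /I ler_pdivrMr// [V w * _]mulrC.
have NV0 w : 0 <= N%:R * V w by rewrite mulr_ge0.
have VVN w : V w <= VN w by rewrite VNE ler_pdivlMr// mulrC ltW// truncnS_gt.
have VNV w : VN w <= V w + N%:R^-1.
  rewrite VNE ler_pdivrMr// mulrDl mulVf ?gt_eqF// -natr1 lerD2r mulrC.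
  by rewrite truncn_le mulr_ge0.
have aI j : adapted0 (I j) by exact: bmeas_ge.
have bVN : bmeas VN.
  by apply: bmeas_sum => j _; apply: bmeasZ; exact: adapted0_bmeas.
have IZ j : E (fun w => I j w * (Z w + K)) <= (c + K) * E (I j).
  have FI : F0 [set w | (j%:R / N%:R <= V w)%R].
    have := @bmeas_ge R _ (g_sigma_algebraType F0) V (j%:R / N%:R) aV.
    move=> /adapted0P[+ _]; move=> /(_ [set w | (j%:R / N%:R <= V w)%R]); apply.
    exists [set 1]; first exact: measurable_set1.
    rewrite setTI predeqE => w /=; case: (_ <= _) => //=; split => //.
    by move=> /eqP; rewrite eq_sym oner_eq0.
  have mI : measurable [set w | (j%:R / N%:R <= V w)%R] by case: sF => _; exact.
  have := Zc _ FI; rewrite Ex_set// -Ex_bool// -EFinM lee_fin => H.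
  have bI := adapted0_bmeas (aI j).
  have -> : E (fun w => I j w * (Z w + K)) = E (fun w => I j w * Z w) + K * E (I j).
    rewrite -ExZ// -ExD; [|exact: bmeasM|exact: bmeasZ].
    by congr Ex; apply/funext => w; ring.
  by rewrite [(c + K) * _]mulrDl lerD2r.
have H1 : E (fun w => V w * (Z w + K)) <= (c + K) * (E V + N%:R^-1).
  apply: (@le_trans _ _ (E (fun w => VN w * (Z w + K)))).
    by apply: le_Ex; [exact: bmeasM|exact: bmeasM|move=> w; rewrite ler_wpM2r].
  apply: (@le_trans _ _ ((c + K) * E VN)).
    have -> : (fun w => VN w * (Z w + K)) =
        fun w => \sum_(j < (N * M).+1) N%:R^-1 * (I j w * (Z w + K)).
      by apply/funext => w; rewrite mulr_suml; apply: eq_bigr => j _; ring.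
    rewrite Ex_sum; last first.
      by move=> j _; apply: bmeasZ; apply: bmeasM => //; exact: adapted0_bmeas.
    rewrite Ex_sum; last by move=> j _; apply: bmeasZ; exact: adapted0_bmeas.
    rewrite mulr_sumr; apply: ler_sum => j _.
    rewrite !ExZ; [|exact: adapted0_bmeas|by apply: bmeasM => //; exact: adapted0_bmeas].
    by rewrite mulrCA ler_wpM2l// invr_ge0 ltW.
  rewrite ler_wpM2l// -(Ex_cst P N%:R^-1) -ExD//; last exact: bmeas_cst.
  by apply: le_Ex => //; apply: bmeasD => //; exact: bmeas_cst.
have H2 : E (fun w => V w * (Z w + K)) = E (fun w => V w * Z w) + K * E V.
  rewrite -ExZ// -ExD; [|exact: bmeasM|exact: bmeasZ].
  by congr Ex; apply/funext => w; ring.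
by move: H1; rewrite H2; lra.
Qed.

(** By stationarity a bound given F_0 holds given F_i for the shifted variable. *)
Lemma cond_ub_shift i Z c V : bmeas Z -> cond_ub Z c -> adapted i V -> (forall w, 0 <= V w) ->
  E (fun w => V w * Z (iter i T w)) <= c * E V.
Proof.
move=> bZ Zc [g g0 ->] V0.
have bg := adapted0_bmeas g0.
rewrite (Ex_iter i bg).
rewrite -[X in X <= _]/(E ((fun w => g w * Z w) \o iter i T)) Ex_iter; last exact: bmeasM.
apply: Zc => // w.
have [U _ UK] : bijective (iter i T).
  by elim: i {V0} => [|i IH]; [exists id|exact: bij_comp].
by have := V0 (U w); rewrite /= UK.
Qed.

Definition psum (Y : Omega -> R) n w := \sum_(1 <= j < n.+1) Y (iter j T w).

Lemma psumN Y n w : psum (fun w => - Y w) n w = - psum Y n w.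
Proof. by rewrite /psum sumrN. Qed.

Lemma psum0 Y w : psum Y 0 w = 0.
Proof. by rewrite /psum big_geq. Qed.

Lemma psumS Y n w : psum Y n.+1 w = psum Y n w + Y (iter n.+1 T w).
Proof. by rewrite /psum big_nat_recr. Qed.

Lemma psumD Y m n w : psum Y (m + n) w = psum Y m w + psum Y n (iter m T w).
Proof.
elim: n => [|n IH]; first by rewrite addn0 psum0 addr0.
by rewrite addnS !psumS IH -addrA -addnS addnC iterD.
Qed.

Lemma adapted_psum Y n : adapted0 Y -> adapted n (psum Y n).
Proof.
move=> aY; rewrite /psum.
have -> : (fun w => \sum_(1 <= j < n.+1) Y (iter j T w)) =
    fun w => \sum_(0 <= j < n) Y (iter j.+1 T w).
  by apply/funext => w; rewrite big_add1.
have -> : (fun w => \sum_(0 <= j < n) Y (iter j.+1 T w)) =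
    fun w => \sum_(j < n) Y (iter j.+1 T w).
  by apply/funext => w; rewrite big_mkord.
apply: adapted_sum => j _; apply: (@adapted_le j.+1) => //.
by exists Y.
Qed.

Lemma psum_bound Y c n w : (forall w, `|Y w| <= c) -> `|psum Y n w| <= n%:R * c.
Proof.
move=> Yc; elim: n => [|n IH]; first by rewrite psum0 normr0 mul0r.
by rewrite psumS -natr1 mulrDl mul1r (le_trans (ler_normD _ _))// lerD.
Qed.

Lemma cond_ub_psumD Y m n a b : adapted0 Y -> cond_ub (psum Y m) a -> cond_ub (psum Y n) b ->
  cond_ub (psum Y (m + n)) (a + b).
Proof.
move=> aY Ha mean_small V aV V0.
have bV := adapted0_bmeas aV.
have bS k := adapted_bmeas (adapted_psum k aY).
rewrite (_ : E _ = E (fun w => V w * psum Y m w) + E (fun w => V w * psum Y n (iter m T w))).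
  rewrite mulrDl lerD//; first exact: Ha.
  by apply: cond_ub_shift => //; exact: adaptedW.
rewrite -ExD; last 2 first.
- exact: bmeasM.
- by apply: bmeasM => //; apply: (@bmeas_iter m _ (bS n)).
by congr Ex; apply/funext => w; rewrite psumD mulrDr.
Qed.

(** The subadditive bound e_j + e_(N-j) is averaged over j. *)
Lemma cond_ub_psum_avg Y e N : adapted0 Y -> (forall n, cond_ub (psum Y n) (e n)) ->
  cond_ub (psum Y N) (2 / N.+1%:R * \sum_(j < N.+1) e j).
Proof.
move=> aY He V aV V0.
have EV0 : 0 <= E V by exact: Ex_ge0.
have H (j : 'I_N.+1) : E (fun w => V w * psum Y N w) <= (e j + e (N - j)%N) * E V.
  have jN : (j <= N)%N by rewrite -ltnS.
  by have := cond_ub_psumD aY (He j) (He (N - j)%N); rewrite subnKC//; exact.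
have := @ler_sum _ 'I_N.+1 (index_enum _) xpredT _ _ (fun j _ => H j).
rewrite sumr_const card_ord -mulr_suml big_split/=.
rewrite [X in _ + X](_ : _ = \sum_(j < N.+1) e j); last first.
  rewrite (reindex_inj rev_ord_inj)/=; apply: eq_bigr => j _.
  by rewrite subSS subKn// -ltnS.
rewrite -[X in X <= _]mulr_natl => H'.
rewrite -(@ler_pM2l _ N.+1%:R) ?ltr0n// (le_trans H')//.
set s := \sum_(j < _) e j; rewrite [leRHS](_ : _ = (s + s) * E V)//.
have : N.+1%:R != 0 :> R by rewrite pnatr_eq0.
by move=> N0; field.
Qed.

Variables (Y : Omega -> R) (c C s2 : R).
Local Notation S := (psum Y).
Hypothesis aY : adapted0 Y.
Hypothesis Yc : forall w, `|Y w| <= c.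

Let aS n : adapted n (S n) := adapted_psum n aY.
Let bS n : bmeas (S n) := adapted_bmeas (aS n).

Lemma cond_ub_le Z Z' (a : R) : bmeas Z -> bmeas Z' -> (forall w, Z w <= Z' w) ->
  cond_ub Z' a -> cond_ub Z a.
Proof.
move=> bZ bZ' ZZ' Ha V aV V0; apply: le_trans (Ha V aV V0).
by apply: le_Ex => [||w]; [apply: bmeasM => //; exact: adapted0_bmeas..|rewrite ler_wpM2l].
Qed.

Lemma cond_ubW Z (a a' : R) : a <= a' -> cond_ub Z a -> cond_ub Z a'.
Proof.
by move=> aa' Ha V aV V0; apply: le_trans (Ha V aV V0) _; rewrite ler_wpM2r// Ex_ge0.
Qed.

Lemma cond_ub_scale Z (k a : R) : bmeas Z -> 0 <= k -> cond_ub Z a -> cond_ub (fun w => k * Z w) (k * a).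
Proof.
move=> bZ k0 Ha V aV V0.
rewrite (_ : E _ = k * E (fun w => V w * Z w)); first by rewrite -mulrA ler_wpM2l// Ha.
rewrite -ExZ; last by apply: bmeasM => //; exact: adapted0_bmeas.
by congr Ex; apply/funext => w; ring.
Qed.

Lemma cond_ub_add Z Z' (a a' : R) : bmeas Z -> bmeas Z' -> cond_ub Z a -> cond_ub Z' a' ->
  cond_ub (fun w => Z w + Z' w) (a + a').
Proof.
move=> bZ bZ' Ha Ha' V aV V0.
have bV := adapted0_bmeas aV.
rewrite (_ : E _ = E (fun w => V w * Z w) + E (fun w => V w * Z' w)).
  by rewrite mulrDl lerD// ?Ha ?Ha'.
by rewrite -ExD; [congr Ex; apply/funext => w; ring|exact: bmeasM|exact: bmeasM].
Qed.

Lemma cond_ub_cst (a : R) : cond_ub (fun=> a) a.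
Proof.
move=> V aV V0; rewrite -ExZ//; last exact: adapted0_bmeas.
by rewrite le_eqVlt; apply/orP; left; apply/eqP; congr Ex; apply/funext => w; rewrite mulrC.
Qed.

Lemma cond_ub_cheb (a b : R) n : 0 < b -> cond_ub (fun w => S n w ^+ 2) a ->
  cond_ub (fun w => (b <= `|S n w|)%R%:R) (a / b ^+ 2).
Proof.
move=> b0 Ha; rewrite mulrC.
have b2 : 0 < b ^+ 2 by rewrite exprn_gt0.
apply: (@cond_ub_le _ (fun w => (b ^+ 2)^-1 * S n w ^+ 2)).
- by apply: bmeas_ge; exact: bmeas_norm.
- by apply: bmeasZ; exact: bmeasX.
- move=> w; case: (lerP b `|S n w|) => h /=; last by rewrite mulr_ge0 ?invr_ge0 ?sqr_ge0// ltW.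
  rewrite ler_pdivlMl// mulr1 -[leRHS]real_normK ?num_real//.
  by rewrite lerXn2r// nnegrE ?ltW.
- by apply: cond_ub_scale => //; [exact: bmeasX|rewrite invr_ge0 ltW].
Qed.

(** * First passage times *)

Fixpoint hit (x : R) n w : bool := (x <= `|S n w|) || (if n is m.+1 then hit x m w else false).

Lemma hitP (x : R) n w : reflect (exists2 j, (j <= n)%N & x <= `|S j w|) (hit x n w).
Proof.
apply: (iffP idP).
  elim: n => [|n IH] /=; first by rewrite orbF => h; exists 0%N.
  by case/orP => [h|/IH[j jn h]]; [exists n.+1|exists j => //; rewrite leqW].
elim: n => [|n IH] [j jn h] /=; first by move: jn h; rewrite leqn0 => /eqP -> ->.
move: jn; rewrite leq_eqVlt => /predU1P[<-|jn]; first by rewrite h.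
by rewrite IH ?orbT//; exists j.
Qed.

Lemma adapted_hit (x : R) n : adapted n (fun w => (hit x n w)%:R : R).
Proof.
have aI k : adapted k (fun w => (x <= `|S k w|)%R%:R : R) by apply: adapted_ge; exact: adapted_norm.
elim: n => [|n IH].
  by have := aI 0%N; congr adapted; apply/funext => w /=; rewrite orbF.
have IH' : adapted n.+1 (fun w => (hit x n w)%:R : R) by exact: (adapted_le _ IH).
have := adaptedB (adaptedD (aI n.+1) IH') (adaptedM (aI n.+1) IH').
congr adapted; apply/funext => w /=.
by move: (x <= _) (hit x n w) => [] [] /=; ring.
Qed.

(** The indicator that i + 1 is the first index at which |S| reaches x. *)
Definition first_hit (x : R) i w : R := (hit x i.+1 w)%:R - (hit x i w)%:R.

Lemma first_hitE x i w : first_hit x i w = (~~ hit x i w && (x <= `|S i.+1 w|))%:R.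
Proof.
by rewrite /first_hit [hit x i.+1 w]/=; case: (_ <= _); case: hit; rewrite /= ?subrr ?subr0.
Qed.

Lemma first_hit_ge0 x i w : 0 <= first_hit x i w. Proof. by rewrite first_hitE. Qed.

Lemma adapted_first_hit x i : adapted i.+1 (first_hit x i).
Proof. by apply: adaptedB; [exact: adapted_hit|apply: (adapted_le _ (adapted_hit x i))]. Qed.

Lemma sum_first_hit (x : R) m w : 0 < x -> \sum_(i < m) first_hit x i w = (hit x m w)%:R.
Proof.
move=> x0; rewrite -(big_mkord xpredT (fun i => first_hit x i w)).
rewrite telescope_sumr// [hit x 0 w]/= orbF psum0 normr0.
by rewrite leNgt x0 subr0.
Qed.

(** At the first passage |S| is at most x + c, because the steps are at most c;
    a further increment of size b is then required. *)
Lemma passage_le (x b rho : R) m V : 0 < x -> 0 <= b ->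
  (forall j, (j <= m)%N -> cond_ub (fun w => (b <= `|S j w|)%R%:R) rho) ->
  adapted0 V -> (forall w, 0 <= V w) ->
  E (fun w => V w * (x + c + b <= `|S m w|)%R%:R) <= rho * E (fun w => V w * (hit x m w)%:R).
Proof.
move=> x0 b0 mean_small aV V0.
have bV := adapted0_bmeas aV.
have bI j : bmeas (fun w => (b <= `|S j w|)%R%:R : R) by apply: bmeas_ge; exact: bmeas_norm.
have bF i : bmeas (first_hit x i) := adapted_bmeas (adapted_first_hit x i).
pose G i w := V w * first_hit x i w * (b <= `|S (m - i.+1) (iter i.+1 T w)|)%R%:R.
have bG i : bmeas (G i).
  apply: bmeasM; first exact: bmeasM.
  exact: (@bmeas_iter i.+1 _ (bI (m - i.+1)%N)).
apply: (@le_trans _ _ (E (fun w => \sum_(i < m) G i w))).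
  apply: le_Ex => [||w].
  - by apply: bmeasM => //; apply: bmeas_ge; exact: bmeas_norm.
  - by apply: bmeas_sum => i _; exact: bG.
  have G0 i : 0 <= G i w by rewrite !mulr_ge0// first_hit_ge0.
  case: (lerP (x + c + b) `|S m w|) => h /=; last by rewrite mulr0 sumr_ge0.
  have c0 : 0 <= c by apply: le_trans (Yc w).
  have [i im Hi] : exists2 i, (i < m)%N & ~~ hit x i w && (x <= `|S i.+1 w|).
    have hm : hit x m w by apply/hitP; exists m => //; apply: le_trans h; lra.
    elim: (m) hm => [|n IH] /=; first by rewrite orbF psum0 normr0 leNgt x0.
    have [/IH[i im Hi] _|hn /=] := boolP (hit x n w); first by exists i => //; rewrite ltnW.
    by rewrite orbF => h'; exists n => //; rewrite hn.
  rewrite mulr1 (bigD1 (Ordinal im))//= -[leLHS]addr0 lerD ?sumr_ge0//.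
  rewrite /G first_hitE Hi mulr1; case/andP: Hi => Hi1 Hi2.
  have Si : `|S i w| < x.
    by rewrite ltNge; apply: contra Hi1 => h'; apply/hitP; exists i.
  have SmE : S m w = S i w + Y (iter i.+1 T w) + S (m - i.+1) (iter i.+1 T w).
    by rewrite -psumS -psumD subnKC.
  have : `|S m w| <= `|S i w| + `|Y (iter i.+1 T w)| + `|S (m - i.+1) (iter i.+1 T w)|.
    by rewrite SmE (le_trans (ler_normD _ _))// lerD2r ler_normD.
  have := Yc (iter i.+1 T w) => ? ?.
  by rewrite (_ : b <= _ = true) ?mulr1//; lra.
rewrite Ex_sum; last by move=> i _; exact: bG.
rewrite (_ : E (fun w => V w * (hit x m w)%:R) = \sum_(i < m) E (fun w => V w * first_hit x i w)).
  rewrite mulr_sumr; apply: ler_sum => i _.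
  apply: (@cond_ub_shift i.+1 (fun w => (b <= `|S (m - i.+1) w|)%R%:R) rho (fun w => V w * first_hit x i w)) => //.
  - exact: (mean_small _ (leq_subr _ _)).
  - by apply: adaptedM; [exact: adaptedW|exact: adapted_first_hit].
  - by move=> w; rewrite mulr_ge0// first_hit_ge0.
rewrite -Ex_sum; last by move=> i _; exact: bmeasM.
by congr Ex; apply/funext => w; rewrite -mulr_sumr sum_first_hit.
Qed.

(** After the first passage the walk falls back below x - y with small conditional
    probability. *)
Lemma hit_le (x y rho : R) m V : 0 < x ->
  (forall j, (j <= m)%N -> cond_ub (fun w => (y <= `|S j w|)%R%:R) rho) ->
  adapted0 V -> (forall w, 0 <= V w) ->
  (1 - rho) * E (fun w => V w * (hit x m w)%:R) <= E (fun w => V w * (x - y <= `|S m w|)%R%:R).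
Proof.
move=> x0 Hy aV V0.
have bV := adapted0_bmeas aV.
have bI j : bmeas (fun w => (y <= `|S j w|)%R%:R : R) by apply: bmeas_ge; exact: bmeas_norm.
have bF i : bmeas (first_hit x i) := adapted_bmeas (adapted_first_hit x i).
pose G i w := V w * first_hit x i w * (y <= `|S (m - i.+1) (iter i.+1 T w)|)%R%:R.
have bG i : bmeas (G i).
  apply: bmeasM; first exact: bmeasM.
  exact: (@bmeas_iter i.+1 _ (bI (m - i.+1)%N)).
have bVF i : bmeas (fun w => V w * first_hit x i w) by exact: bmeasM.
apply: (@le_trans _ _ (E (fun w => \sum_(i < m) (V w * first_hit x i w - G i w)))); last first.
  apply: le_Ex => [||w].
  - by apply: bmeas_sum => i _; apply: bmeasB.
  - by apply: bmeasM => //; apply: bmeas_ge; exact: bmeas_norm.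
  apply: (@le_trans _ _ (\sum_(i < m) V w * first_hit x i w * (x - y <= `|S m w|)%R%:R)).
    apply: ler_sum => i _; rewrite /G -[X in X - _]mulr1 -mulrBr.
    rewrite first_hitE; have [Hi|_] := boolP (_ && _); last by rewrite mulr0 !mul0r.
    rewrite mulr1; case/andP: Hi => Hi1 Hi2; rewrite ler_wpM2l//.
    case: (lerP y _) => h; first by rewrite subrr.
    rewrite subr0 (_ : x - y <= _ = true)//.
    have SmE : S m w = S i.+1 w + S (m - i.+1) (iter i.+1 T w) by rewrite -psumD subnKC.
    by have := lerB_normD (S i.+1 w) (S (m - i.+1) (iter i.+1 T w)); rewrite -SmE; lra.
  rewrite -mulr_suml -mulr_sumr sum_first_hit// -mulrA ler_wpM2l//.
  by case: hit; rewrite ?mul1r ?mul0r.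
rewrite Ex_sum; last by move=> i _; exact: bmeasB.
rewrite (_ : E (fun w => V w * (hit x m w)%:R) = \sum_(i < m) E (fun w => V w * first_hit x i w)).
  rewrite mulr_sumr; apply: ler_sum => i _.
  rewrite ExB// mulrBl mul1r lerB//.
  apply: (@cond_ub_shift i.+1 (fun w => (y <= `|S (m - i.+1) w|)%R%:R) rho (fun w => V w * first_hit x i w)) => //.
  - exact: (Hy _ (leq_subr _ _)).
  - by apply: adaptedM; [exact: adaptedW|exact: adapted_first_hit].
  - by move=> w; rewrite mulr_ge0// first_hit_ge0.
rewrite -Ex_sum; last by move=> i _; exact: bmeasM.
by congr Ex; apply/funext => w; rewrite -mulr_sumr sum_first_hit.
Qed.

Hypothesis C0 : 0 < C.
Hypothesis var_bound : forall n, cond_ub (fun w => S n w ^+ 2) (C * n%:R).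

Let c0 : 0 <= c. Proof. by apply: le_trans (Yc point). Qed.

(** In units of sqrt m: two Chebyshev steps of size 2 sqrt C, and one overshoot. *)
Definition scale_const : R := 4 * Num.sqrt C + c.

Let K := scale_const.

Lemma scale_const_gt0 : 0 < K.
Proof. by rewrite /K /scale_const ltr_pwDl// mulr_gt0// sqrtr_gt0. Qed.

(** One more unit multiplies the probability by at most (1/4) / (1 - 1/4) = 1/3:
    [passage_le] gains the numerator and [hit_le] costs the denominator. *)
Lemma tail_geo m k V : (0 < m)%N -> adapted0 V -> (forall w, 0 <= V w) ->
  E (fun w => V w * (k%:R * (K * Num.sqrt m%:R) <= `|S m w|)%R%:R) <= 3 ^- k * E V.
Proof.
move=> m0 aV V0; have bV := adapted0_bmeas aV.
have mp : 0 < m%:R :> R by rewrite ltr0n.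
pose b : R := 2 * Num.sqrt C * Num.sqrt m%:R.
have b0 : 0 < b by rewrite !mulr_gt0// sqrtr_gt0.
have b2 : b ^+ 2 = 4 * (C * m%:R).
  rewrite /b !exprMn !sqr_sqrtr ?ler0n// ?ltW//; ring.
have sm1 : 1 <= Num.sqrt m%:R :> R by rewrite -[leLHS]sqrtr1 ler_wsqrtr// ler1n.
have Bb : 2 * b + c <= K * Num.sqrt m%:R.
  have -> : 2 * b = 4 * Num.sqrt C * Num.sqrt m%:R by rewrite /b; ring.
  by rewrite /K /scale_const [leRHS]mulrDl lerD2l ler_peMr.
have mean_small j : (j <= m)%N -> cond_ub (fun w => (b <= `|S j w|)%R%:R) (1 / 4).
  move=> jm; apply: (@cond_ubW _ (C * j%:R / b ^+ 2)).
    rewrite b2 ler_pdivrMr ?mulr_gt0//.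
    rewrite (_ : 1 / 4 * (4 * (C * m%:R)) = C * m%:R); last by field.
    by rewrite ler_pM2l// ler_nat.
  by have := cond_ub_cheb b0 (var_bound j); exact.
have bJ (t : R) : bmeas (fun w => (t <= `|S m w|)%R%:R : R) by apply: bmeas_ge; exact: bmeas_norm.
elim: k => [|k IH].
  rewrite expr0 invr1 mul1r; apply: le_Ex => [||w] //; first exact: bmeasM.
  by rewrite mul0r normr_ge0 mulr1.
pose B := K * Num.sqrt m%:R.
have B0 : 0 <= B by rewrite mulr_ge0 ?sqrtr_ge0// ltW// scale_const_gt0.
pose x := k%:R * B + b.
have x0 : 0 < x by rewrite ltr_wpDl// mulr_ge0.
have H1 := passage_le x0 (ltW b0) mean_small aV V0.
have H2 := hit_le x0 mean_small aV V0.
rewrite {2}/x addrK in H2.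
have H3 : E (fun w => V w * (k.+1%:R * B <= `|S m w|)%R%:R) <=
    E (fun w => V w * (x + c + b <= `|S m w|)%R%:R).
  apply: le_Ex => [||w]; [exact: bmeasM|exact: bmeasM|].
  rewrite ler_wpM2l// ler_nat; case: (lerP (k.+1%:R * B)) => //= h.
  rewrite (_ : x + c + b <= _ = true)//.
  apply: le_trans h; rewrite /x -natr1 mulrDl mul1r; move: Bb; rewrite -/B; lra.
apply: (le_trans H3); apply: (le_trans H1).
have IH' : E (fun w => V w * (k%:R * B <= `|S m w|)%R%:R) <= 3 ^- k * E V by [].
rewrite exprS invfM -mulrA; lra.
Qed.

(** Summation by parts: 1 + sum_j 2^j 3^-(j+1) is at most 2. *)
Lemma cond_ub_moment m : (0 < m)%N ->
  bmeas (fun w => 2 ^+ Num.truncn (`|S m w| / (K * Num.sqrt m%:R)) : R) /\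
  cond_ub (fun w => 2 ^+ Num.truncn (`|S m w| / (K * Num.sqrt m%:R))) 2.
Proof.
move=> m0; set B := K * _.
have mp : 0 < m%:R :> R by rewrite ltr0n.
have B0 : 0 < B by rewrite mulr_gt0 ?sqrtr_gt0// scale_const_gt0.
pose J := (Num.truncn (m%:R * c / B)).+1.
pose I (j : nat) w : R := (j.+1%:R * B <= `|S m w|)%R%:R.
have bI j : bmeas (I j) by apply: bmeas_ge; exact: bmeas_norm.
have WE w : 2 ^+ Num.truncn (`|S m w| / B) = 1 + \sum_(j < J) 2 ^+ j * I j w.
  have z0 : 0 <= `|S m w| / B by rewrite divr_ge0// ltW.
  set k := Num.truncn _.
  have kJ : (k <= J)%N.
    rewrite leqW// /k; apply: le_truncn.
    by rewrite ler_pM2r ?invr_gt0// psum_bound.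
  have -> : \sum_(j < J) 2 ^+ j * I j w = \sum_(j < k) 2 ^+ j.
    rewrite (big_ord_widen J (fun j => 2 ^+ j : R))// [RHS]big_mkcond/=.
    apply: eq_bigr => j _; rewrite /I -ler_pdivlMr// -truncn_ge_nat// -/k.
    by case: ifP; rewrite ?mulr1 ?mulr0.
  elim: (k) => [|i IH]; first by rewrite big_ord0 addr0.
  by rewrite big_ord_recr/= addrA -IH exprS mulr_natl mulr2n.
have WE' : (fun w => 2 ^+ Num.truncn (`|S m w| / B)) = fun w => 1 + \sum_(j < J) 2 ^+ j * I j w.
  exact/funext.
have bsum : bmeas (fun w => \sum_(j < J) 2 ^+ j * I j w).
  by apply: bmeas_sum => j _; exact: bmeasZ.
split; rewrite WE'; first by apply: bmeasD => //; exact: bmeas_cst.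
move=> V aV V0; have bV := adapted0_bmeas aV.
have EV0 : 0 <= E V by exact: Ex_ge0.
rewrite (_ : E _ = E V + \sum_(j < J) 2 ^+ j * E (fun w => V w * I j w)); last first.
  rewrite [X in _ = _ + X](eq_bigr (fun j : 'I_J => E (fun w => 2 ^+ j * (V w * I j w)))); last first.
    by move=> j _; rewrite ExZ//; exact: bmeasM.
  rewrite -Ex_sum; last by move=> j _; apply: bmeasZ; exact: bmeasM.
  rewrite -ExD//; last by apply: bmeas_sum => j _; apply: bmeasZ; exact: bmeasM.
  congr Ex; apply/funext => w; rewrite mulrDr mulr1 mulr_sumr; congr (_ + _).
  by apply: eq_bigr => j _; ring.
have H : \sum_(j < J) 2 ^+ j * E (fun w => V w * I j w) <= \sum_(j < J) (2 / 3) ^+ j / 3 * E V.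
  apply: ler_sum => j _.
  have := tail_geo j.+1 m0 aV V0; rewrite -/B => H.
  apply: le_trans (ler_wpM2l _ H) _; first by rewrite exprn_ge0.
  rewrite mulrA ler_wpM2r// exprS invfM expr_div_n [3^-1 * _]mulrC mulrA.
  exact: lexx.
apply: le_trans (lerD (lexx _) H) _.
rewrite -mulr_suml (_ : 2 * E V = E V + E V); last by ring.
rewrite lerD2l ler_piMl//.
have -> : \sum_(j < J) (2 / 3) ^+ j / 3 = 1 - (2 / 3) ^+ J :> R.
  elim: (J) => [|i IH]; first by rewrite big_ord0 expr0 subrr.
  by rewrite big_ord_recr/= IH exprS; field.
by rewrite gerBl exprn_ge0// divr_ge0.
Qed.

Hypothesis s20 : 0 <= s2.
(** The dependence hypotheses for the weights: E(S_n | F_0) = o(sqrt n) and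
    E(S_n^2 | F_0) = s2 n + o(n), uniformly. *)
Hypothesis mean_small : forall k : R, 0 < k -> exists n0, forall n, (n0 <= n)%N ->
  cond_ub (S n) (k * Num.sqrt n%:R) /\ cond_ub (fun w => - S n w) (k * Num.sqrt n%:R).
Hypothesis var_limit : forall k : R, 0 < k -> exists n0, forall n, (n0 <= n)%N ->
  cond_ub (fun w => S n w ^+ 2) ((s2 + k) * n%:R) /\
  cond_ub (fun w => - S n w ^+ 2) (- ((s2 - k) * n%:R)).

Let K0 : 0 < K := scale_const_gt0.

(** * Laplace transform of the partial sums *)

Lemma exp_error m (t : R) w : (0 < m)%N -> `|t| * (K * Num.sqrt m%:R) <= 1 / 4 ->
  `|expR (t * S m w) - (1 + t * S m w + (t * S m w) ^+ 2 / 2)| <=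
  768 * (`|t| * (K * Num.sqrt m%:R)) ^+ 3 * 2 ^+ Num.truncn (`|S m w| / (K * Num.sqrt m%:R)).
Proof.
move=> m0; set B := K * _ => sB.
have B0 : 0 < B by rewrite mulr_gt0// sqrtr_gt0 ltr0n.
pose z := `|S m w| / B.
have z0 : 0 <= z by rewrite divr_ge0// ltW.
have uE : `|t * S m w| = `|t| * B * z.
  by rewrite normrM /z; field; rewrite gt_eqF.
apply: le_trans (exp_taylor2 _) _; rewrite uE exprMn -/z.
set s := `|t| * B in sB *; have s0 : 0 <= s by rewrite mulr_ge0// ltW.
have h1 := cube_expR z0.
have h2 := expR_half_trunc z0.
have h3 : expR (s * z) <= expR (z / 4).
  by rewrite ler_expR [leRHS]mulrC ler_wpM2r//; lra.
have h4 : z ^+ 3 * expR (s * z) <= 768 * 2 ^+ Num.truncn z.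
  apply: (@le_trans _ _ (384 * expR (z / 4) * expR (z / 4))).
    by apply: ler_pM => //; rewrite ?exprn_ge0 ?expR_ge0.
  rewrite -mulrA -expRD (_ : z / 4 + z / 4 = z / 2); last by field.
  by lra.
rewrite [leLHS](_ : _ = s ^+ 3 * (z ^+ 3 * expR (s * z))); last by ring.
rewrite [leRHS](_ : _ = s ^+ 3 * (768 * 2 ^+ Num.truncn z)); last by ring.
by rewrite ler_wpM2l// exprn_ge0.
Qed.

Lemma cond_ub_lin m (t b : R) : cond_ub (S m) b -> cond_ub (fun w => - S m w) b ->
  cond_ub (fun w => t * S m w) (`|t| * b).
Proof.
move=> h1 h2; have [t0|t0] := lerP 0 t.
  by rewrite ger0_norm//; have := cond_ub_scale (bS m) t0 h1; exact.
have t0' : 0 <= - t by rewrite oppr_ge0 ltW.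
have := cond_ub_scale (bmeasN (bS m)) t0' h2; rewrite ltr0_norm//.
by rewrite (_ : (fun w => - t * - S m w) = fun w => t * S m w)//; apply/funext => w; rewrite mulrNN.
Qed.

(** The constant of [exp_error] times the bound of [cond_ub_moment]. *)
Definition taylor_const : R := 1536.

Let taylor_const_gt0 : 0 < taylor_const. Proof. by rewrite ltr0n. Qed.

Lemma taylor_block m (t b vp vm : R) : (0 < m)%N -> `|t| * (K * Num.sqrt m%:R) <= 1 / 4 ->
  cond_ub (S m) b -> cond_ub (fun w => - S m w) b ->
  cond_ub (fun w => S m w ^+ 2) vp -> cond_ub (fun w => - S m w ^+ 2) (- vm) ->
  let e := taylor_const * (`|t| * (K * Num.sqrt m%:R)) ^+ 3 in
  cond_ub (fun w => expR (t * S m w)) (1 + `|t| * b + t ^+ 2 / 2 * vp + e) /\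
  cond_ub (fun w => - expR (t * S m w)) (- (1 - `|t| * b + t ^+ 2 / 2 * vm - e)).
Proof.
move=> m0 sB hb hb' hp hm e.
have [bW cW] := cond_ub_moment m0.
set W := (fun w => 2 ^+ _) in bW cW.
set s := `|t| * _ in sB e *.
have s0 : 0 <= s by rewrite mulr_ge0// mulr_ge0// ltW.
have es : 0 <= 768 * s ^+ 3 by apply: mulr_ge0; [exact: ler0n|exact: exprn_ge0].
have t2 : 0 <= t ^+ 2 / 2 by rewrite divr_ge0// sqr_ge0.
have bX : bmeas (fun w => S m w ^+ 2) := bmeasX 2 (bS m).
have c1 := cond_ub_cst 1.
have c2 := cond_ub_lin t hb hb'.
have c2' := cond_ub_lin (- t) hb hb'.
rewrite normrN in c2'.
have c3 := cond_ub_scale bX t2 hp.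
have c3' := cond_ub_scale (bmeasN bX) t2 hm.
have c4 := cond_ub_scale bW es cW.
have b1 : bmeas (fun _ : Omega => 1 : R) by exact: bmeas_cst.
have b2 u : bmeas (fun w => u * S m w) := bmeasZ u (bS m).
have b3 := bmeasZ (t ^+ 2 / 2) bX.
have b3' := bmeasZ (t ^+ 2 / 2) (bmeasN bX).
have b4 := bmeasZ (768 * s ^+ 3) bW.
have bE : bmeas (fun w => expR (t * S m w)) by apply: bmeas_exp; exact: b2.
split.
- have H := cond_ub_add (bmeasD (bmeasD b1 (b2 t)) b3) b4 (cond_ub_add (bmeasD b1 (b2 t)) b3 (cond_ub_add b1 (b2 t) c1 c2) c3) c4.
  rewrite (_ : 1 + `|t| * b + t ^+ 2 / 2 * vp + e = 1 + `|t| * b + t ^+ 2 / 2 * vp + 768 * s ^+ 3 * 2); last by rewrite /e /taylor_const; ring.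
  apply: (@cond_ub_le _ _ _ bE (bmeasD (bmeasD (bmeasD b1 (b2 t)) b3) b4) _ H) => w.
  have := exp_error w m0 sB; rewrite -/s -/(W w) ler_norml => /andP[_].
  by rewrite exprMn; lra.
- have c1' := cond_ub_cst (- 1).
  have bN1 : bmeas (fun _ : Omega => -1 : R) by exact: bmeas_cst.
  have H := cond_ub_add (bmeasD (bmeasD bN1 (b2 (- t))) b3') b4 (cond_ub_add (bmeasD bN1 (b2 (- t))) b3' (cond_ub_add bN1 (b2 (- t)) c1' c2') c3') c4.
  rewrite (_ : - (1 - `|t| * b + t ^+ 2 / 2 * vm - e) = -1 + `|t| * b + t ^+ 2 / 2 * - vm + 768 * s ^+ 3 * 2); last by rewrite /e /taylor_const; ring.
  apply: (@cond_ub_le _ _ _ (bmeasN bE) (bmeasD (bmeasD (bmeasD bN1 (b2 (- t))) b3') b4) _ H) => w.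
  have := exp_error w m0 sB; rewrite -/s -/(W w) ler_norml => /andP[+ _].
  by rewrite exprMn; lra.
Qed.

(** With x = theta^2 m, each of the errors is at most k x / 4: the cubic remainder is
    of order x^(3/2) and replacing 1 + y by exp y costs y^2, so x <= e small suffices;
    the linear term theta o(sqrt m) = o(sqrt x) requires x >= e / 2 and m large. *)
Lemma laplace_block (k : R) : 0 < k -> exists e : R, exists m0 : nat,
  [/\ 0 < e, e <= 1, forall m (t : R), t ^+ 2 * m%:R <= e -> `|t| * (K * Num.sqrt m%:R) <= 1 / 4 &
  forall m (t : R), (m0 <= m)%N -> e / 2 <= t ^+ 2 * m%:R <= e ->
  cond_ub (fun w => expR (t * S m w)) (expR ((s2 / 2 + k) * (t ^+ 2 * m%:R))) /\
  cond_ub (fun w => - expR (t * S m w)) (- expR ((s2 / 2 - k) * (t ^+ 2 * m%:R)))].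
Proof.
move=> k0.
(* a1 bounds the cubic remainder, a2 and a3 the passage from 1 + y to exp y, and a4
   makes the Taylor expansion valid. *)
pose a1 := k / (4 * (taylor_const * K ^+ 3)).
pose a2 := k / (8 * (s2 / 2 + k) ^+ 2).
pose a3 := 1 / (2 * k).
pose a4 := 1 / (4 * K).
have sk : 0 < s2 / 2 + k by rewrite ltr_wpDl// divr_ge0.
have a10 : 0 < a1 by rewrite divr_gt0// mulr_gt0// mulr_gt0 ?taylor_const_gt0// exprn_gt0.
have a20 : 0 < a2 by rewrite divr_gt0// !mulr_gt0// exprn_gt0.
have a30 : 0 < a3 by rewrite divr_gt0// mulr_gt0.
have a40 : 0 < a4 by rewrite divr_gt0// mulr_gt0.
pose q := Num.min 1 (Num.min a1 (Num.min a2 (Num.min a3 a4))).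
have q0 : 0 < q by rewrite /q !lt_min a10 a20 a30 a40 ltr01.
have q1 : q <= 1 by rewrite /q ge_min lexx.
have qa1 : q <= a1 by rewrite /q !ge_min lexx !orbT.
have qa2 : q <= a2 by rewrite /q !ge_min lexx !orbT.
have qa3 : q <= a3 by rewrite /q !ge_min lexx !orbT.
have qa4 : q <= a4 by rewrite /q !ge_min lexx !orbT.
have rE m (t : R) : `|t| * Num.sqrt m%:R = Num.sqrt (t ^+ 2 * m%:R).
  by rewrite sqrtrM ?sqr_ge0// sqrtr_sqr.
have qs m (t : R) : t ^+ 2 * m%:R <= q ^+ 2 -> `|t| * (K * Num.sqrt m%:R) <= 1 / 4.
  move=> h; rewrite mulrCA rE.
  have : Num.sqrt (t ^+ 2 * m%:R) <= q.
    by rewrite -[leRHS]gtr0_norm// -sqrtr_sqr ler_wsqrtr.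
  move=> h'; apply: (@le_trans _ _ (K * a4)); first by rewrite ler_wpM2l ?(ltW K0)// (le_trans h').
  by rewrite /a4 le_eqVlt; apply/orP; left; apply/eqP; field; rewrite gt_eqF.
pose k' := k * Num.sqrt (q ^+ 2 / 2) / 4.
have sq0 : 0 < Num.sqrt (q ^+ 2 / 2) by rewrite sqrtr_gt0 divr_gt0// exprn_gt0.
have k'0 : 0 < k' by rewrite divr_gt0// mulr_gt0.
have sq1 : Num.sqrt (q ^+ 2 / 2) <= 1.
  rewrite -[leRHS]sqrtr1 ler_wsqrtr// ler_pdivrMr// mul1r.
  have : q ^+ 2 <= 1 by rewrite exprn_ile1// ltW.
  by lra.
have k'k : k' <= k / 4.
  by rewrite /k' ler_pM2r ?invr_gt0// ler_piMr// ltW.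
have [n1 H1] := mean_small k'0.
have [n2 H2] := var_limit k'0.
exists (q ^+ 2), (maxn 1 (maxn n1 n2)); split => //.
- by rewrite exprn_gt0.
- by rewrite exprn_ile1// ltW.
move=> m t; rewrite !geq_max => /and3P[m0 mn1 mn2] /andP[xl xu].
have [hb hb'] := H1 _ mn1.
have [hp hm] := H2 _ mn2.
have sB := qs _ _ xu.
have [U L] := taylor_block m0 sB hb hb' hp hm.
pose x := t ^+ 2 * m%:R; pose r := Num.sqrt x.
have x0 : 0 < x by apply: lt_le_trans xl; rewrite divr_gt0// exprn_gt0.
have r0 : 0 < r by rewrite sqrtr_gt0.
have r2 : r ^+ 2 = x by rewrite sqr_sqrtr// ltW.
have rq : r <= q by rewrite -[leRHS]gtr0_norm// -sqrtr_sqr ler_wsqrtr.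
have e1 : `|t| * (k' * Num.sqrt m%:R) <= k / 4 * x.
  rewrite mulrCA rE -/x -/r -r2 expr2 mulrA ler_wpM2r ?(ltW r0)//.
  rewrite /k' [leLHS]mulrAC ler_wpM2l ?divr_ge0 ?(ltW k0)//.
  by rewrite ler_wsqrtr.
have e3 : taylor_const * (`|t| * (K * Num.sqrt m%:R)) ^+ 3 <= k / 4 * x.
  rewrite (mulrCA `|t| K) rE -/x -/r exprMn.
  have -> : taylor_const * (K ^+ 3 * r ^+ 3) = (taylor_const * K ^+ 3 * r) * x by rewrite -r2; ring.
  rewrite ler_wpM2r ?(ltW x0)//.
  apply: (@le_trans _ _ (taylor_const * K ^+ 3 * a1)).
    by rewrite ler_wpM2l ?mulr_ge0 ?exprn_ge0 ?(ltW K0) ?(ltW taylor_const_gt0)// (le_trans rq).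
  rewrite /a1 le_eqVlt; apply/orP; left; apply/eqP; move: (taylor_const) taylor_const_gt0 => b b0; field.
  by rewrite !gt_eqF.
have e2 : k' * x <= k / 4 * x by rewrite ler_wpM2r ?(ltW x0).
have kx00 : 0 < k * x by rewrite mulr_gt0.
have xq : x <= q.
  by apply: le_trans xu _; rewrite expr2 ler_piMr// ltW.
split.
- apply: cond_ubW U; apply: le_trans (expR_ge1Dx _).
  have -> : t ^+ 2 / 2 * ((s2 + k') * m%:R) = s2 / 2 * x + k' * x / 2 by rewrite /x; field.
  by rewrite -/x; lra.
- apply: cond_ubW L; rewrite lerN2.
  have -> : t ^+ 2 / 2 * ((s2 - k') * m%:R) = s2 / 2 * x - k' * x / 2 by rewrite /x; field.
  pose y := (s2 / 2 - 3 / 4 * k) * x.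
  have kx : k * x <= 1 / 2.
    apply: (@le_trans _ _ (k * a3)); first by rewrite ler_wpM2l ?(ltW k0)// (le_trans xq).
    by rewrite /a3 le_eqVlt; apply/orP; left; apply/eqP; field; rewrite gt_eqF.
  have sx : 0 <= s2 / 2 * x by rewrite mulr_ge0 ?divr_ge0// ltW.
  have y2 : - (1 / 2) <= y by rewrite /y; lra.
  have := expR_le_1D y2 => H.
  apply: (@le_trans _ _ (1 + y)); last by rewrite /y; lra.
  apply: le_trans H; rewrite ler_expR -/x.
  have yy : y ^+ 2 <= ((s2 / 2 + k) * x) ^+ 2.
    have kx0 : 0 < k * x by rewrite mulr_gt0.
    rewrite -[leLHS]real_normK ?num_real// lerXn2r ?nnegrE ?(mulr_ge0 (ltW sk) (ltW x0))//.
    by rewrite ler_norml /y; apply/andP; split; lra.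
  have h : 2 * ((s2 / 2 + k) * x) ^+ 2 <= k / 4 * x.
    have -> : 2 * ((s2 / 2 + k) * x) ^+ 2 = (2 * (s2 / 2 + k) ^+ 2 * x) * x by ring.
    rewrite ler_wpM2r ?(ltW x0)//.
    apply: (@le_trans _ _ (2 * (s2 / 2 + k) ^+ 2 * a2)).
      by rewrite ler_wpM2l ?mulr_ge0 ?exprn_ge0 ?(ltW sk)// (le_trans xq).
    rewrite /a2 le_eqVlt; apply/orP; left; apply/eqP; move: (s2 / 2 + k) sk => u u0; field.
    by rewrite gt_eqF.
  have yE : y = s2 / 2 * x - 3 / 4 * (k * x) by rewrite /y; ring.
  by lra.
Qed.

Let aE (t : R) n : adapted n (fun w => expR (t * S n w)).
Proof. by apply: adapted_exp; exact: adaptedZ. Qed.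

(** E(Z | F_0) >= a almost surely. *)
Definition cond_lb Z (a : R) := cond_ub (fun w => - Z w) (- a).

Lemma cond_lbP Z (a : R) V : bmeas Z -> cond_lb Z a -> adapted0 V -> (forall w, 0 <= V w) ->
  a * E V <= E (fun w => V w * Z w).
Proof.
move=> bZ h aV V0; have := h V aV V0.
rewrite (_ : (fun w => V w * - Z w) = fun w => - (V w * Z w)); last first.
  by apply/funext => w; rewrite mulrN.
by rewrite ExN ?mulNr ?lerN2//; apply: bmeasM => //; exact: adapted0_bmeas.
Qed.

Lemma cond_lb_shift i Z (a : R) V : bmeas Z -> cond_lb Z a -> adapted i V -> (forall w, 0 <= V w) ->
  a * E V <= E (fun w => V w * Z (iter i T w)).
Proof.
move=> bZ h aV V0; have := cond_ub_shift (bmeasN bZ) h aV V0.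
rewrite (_ : (fun w => V w * - Z _) = fun w => - (V w * Z (iter i T w))); last first.
  by apply/funext => w; rewrite mulrN.
rewrite ExN ?mulNr ?lerN2//; apply: bmeasM; first exact: adapted_bmeas aV.
exact: (@bmeas_iter i _ bZ).
Qed.

(** A linear combination of increments over consecutive periods, given by pairs of
    a coefficient and a duration. *)
Fixpoint lsum (l : seq (R * nat)) w : R :=
  if l is (t, n) :: l' then t * S n w + lsum l' (iter n T w) else 0.

Lemma bmeas_lsum l : bmeas (lsum l).
Proof.
elim: l => [|[t n] l IH] /=; first exact: bmeas_cst.
apply: bmeasD; first exact: bmeasZ.
exact: (@bmeas_iter n _ IH).
Qed.

Let bElsum l : bmeas (fun w => expR (lsum l w)) := bmeas_exp (bmeas_lsum l).

(** The periods after the first one are bounded given the past at its end, and the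
    bounds multiply. *)
Lemma cond_ub_lsum (f : R * nat -> R) l : (forall p, p \in l -> 0 <= f p) ->
  (forall p, p \in l -> cond_ub (fun w => expR (p.1 * S p.2 w)) (f p)) ->
  cond_ub (fun w => expR (lsum l w)) (\prod_(p <- l) f p).
Proof.
elim: l => [|[t n] l IH] f0 Hf.
  rewrite big_nil (_ : (fun w => _) = fun=> 1); first exact: cond_ub_cst.
  by apply/funext => w /=; rewrite expR0.
rewrite big_cons mulrC => V aV V0.
have H1 : cond_ub (fun w => expR (lsum l w)) (\prod_(p <- l) f p).
  by apply: IH => p pl; [apply: f0|apply: Hf]; rewrite inE pl orbT.
have P0 : 0 <= \prod_(p <- l) f p.
  by rewrite big_seq prodr_ge0// => p pl; apply: f0; rewrite inE pl orbT.
have aV' : adapted n (fun w => V w * expR (t * S n w)) by apply: adaptedM; [exact: adaptedW|exact: aE].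
have := cond_ub_shift (bElsum l) H1 aV' (fun w => mulr_ge0 (V0 w) (expR_ge0 _)).
have -> : (fun w => V w * expR (t * S n w) * expR (lsum l (iter n T w))) =
    fun w => V w * expR (lsum ((t, n) :: l) w).
  by apply/funext => w /=; rewrite expRD mulrA.
move=> h; apply: (le_trans h); rewrite -mulrA ler_wpM2l//.
by have := Hf (t, n) (mem_head _ _) V aV V0.
Qed.

Lemma cond_lb_lsum (f : R * nat -> R) l : (forall p, p \in l -> 0 <= f p) ->
  (forall p, p \in l -> cond_lb (fun w => expR (p.1 * S p.2 w)) (f p)) ->
  cond_lb (fun w => expR (lsum l w)) (\prod_(p <- l) f p).
Proof.
elim: l => [|[t n] l IH] f0 Hf.
  rewrite big_nil /cond_lb (_ : (fun w => _) = fun=> - 1); first exact: cond_ub_cst.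
  by apply/funext => w /=; rewrite expR0.
rewrite big_cons mulrC => V aV V0.
have H1 : cond_lb (fun w => expR (lsum l w)) (\prod_(p <- l) f p).
  by apply: IH => p pl; [apply: f0|apply: Hf]; rewrite inE pl orbT.
have P0 : 0 <= \prod_(p <- l) f p.
  by rewrite big_seq prodr_ge0// => p pl; apply: f0; rewrite inE pl orbT.
have aV' : adapted n (fun w => V w * expR (t * S n w)) by apply: adaptedM; [exact: adaptedW|exact: aE].
have := cond_lb_shift (bElsum l) H1 aV' (fun w => mulr_ge0 (V0 w) (expR_ge0 _)).
have -> : (fun w => V w * expR (t * S n w) * expR (lsum l (iter n T w))) =
    fun w => V w * expR (lsum ((t, n) :: l) w).
  by apply/funext => w /=; rewrite expRD mulrA.
rewrite (_ : (fun w => V w * - _) = fun w => - (V w * expR (lsum ((t, n) :: l) w))); last first.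
  by apply/funext => w; rewrite mulrN.
rewrite ExN ?mulNr ?lerN2; last first.
  by apply: bmeasM; [exact: adapted0_bmeas|exact: bElsum].
move=> h; apply: le_trans h; rewrite -mulrA ler_wpM2l//.
apply: cond_lbP => //; last by have := Hf (t, n) (mem_head _ _); exact.
by apply: bmeas_exp; exact: bmeasZ.
Qed.

Lemma lsum_nseq (t : R) m q r w : lsum (rcons (nseq q (t, m)) (t, r)) w = t * S (q * m + r) w.
Proof.
elim: q w => [|q IH] w /=; first by rewrite addr0.
by rewrite IH -mulrDr -psumD mulSn addnA.
Qed.

(** A crude bound, for the incomplete block that remains after cutting a long period
    into blocks. *)
Lemma laplace_remainder m (t : R) : `|t| * (K * Num.sqrt m%:R) <= 1 / 4 ->
  cond_ub (fun w => expR (t * S m w)) 4 /\ cond_lb (fun w => expR (t * S m w)) (1 / 4).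
Proof.
move=> sB.
have bE u : bmeas (fun w => expR (u * S m w)) by apply: bmeas_exp; exact: bmeasZ.
have [W [bW cW EW]] : exists W : Omega -> R, [/\ bmeas W, cond_ub W 4 & forall w, expR `|t * S m w| <= W w].
  have [m0|m0] := posnP m.
    exists (fun=> 4); split; [exact: bmeas_cst|exact: cond_ub_cst|move=> w].
    by rewrite m0 psum0 mulr0 normr0 expR0 ler1n.
  have [bW cW] := cond_ub_moment m0.
  rewrite -/K in bW cW.
  exists (fun w => 2 * 2 ^+ Num.truncn (`|S m w| / (K * Num.sqrt m%:R))); split.
  - exact: bmeasZ.
  - by rewrite (_ : 4 = 2 * 2 :> R); [exact: cond_ub_scale|ring].
  - move=> w; set B := K * _ in sB *.
    have B0 : 0 < B by rewrite mulr_gt0// sqrtr_gt0 ltr0n.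
    apply: le_trans (expR_quarter_trunc _); last by rewrite divr_ge0// ltW.
    rewrite ler_expR normrM (_ : `|t| * `|S m w| = `|t| * B * (`|S m w| / B)); last first.
      by field; rewrite gt_eqF.
    by rewrite [leRHS]mulrC ler_wpM2r// ?divr_ge0//; [rewrite ltW|lra].
have c4 u : `|u| = `|t| -> cond_ub (fun w => expR (u * S m w)) 4.
  move=> ut; apply: (cond_ub_le (bE u) bW _ cW) => w; apply: le_trans (EW w).
  by rewrite ler_expR (le_trans (ler_norm _))// !normrM ut.
split; first exact: c4.
have bE' := bE (- t).
have h := cond_ub_scale bE' (ltac:(lra) : 0 <= 1 / 16 :> R) (c4 (- t) (normrN _)).
have bc : bmeas (fun _ : Omega => - (1 / 2) : R) by exact: bmeas_cst.
have := cond_ub_add bc (bmeasZ (1 / 16) bE') (cond_ub_cst (- (1 / 2))) h.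
rewrite /cond_lb (_ : - (1 / 4) = - (1 / 2) + 1 / 16 * 4); last by field.
apply: cond_ub_le => //; [exact: bmeasN|by apply: bmeasD => //; exact: bmeasZ|move=> w].
rewrite mulNr expRN; set y := expR _; have y0 : 0 < y by exact: expR_gt0.
(* y >= 1 / 2 - 1 / (16 y), a consequence of (4 y - 1)^2 >= 0, and 1 / y is bounded
   as the exponential of - t S_m. *)
have : y - 1 / 2 + 1 / 16 * y^-1 = (4 * y - 1) ^+ 2 / (16 * y) by field; rewrite gt_eqF.
have : 0 <= (4 * y - 1) ^+ 2 / (16 * y) by rewrite divr_ge0 ?sqr_ge0// mulr_ge0// ltW.
lra.
Qed.

(** Cut the period into blocks of length about e / t^2, for which [laplace_block]
    applies with e / 2 <= t^2 m <= e, and an incomplete block. *)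
Lemma laplace_bounds (k : R) : 0 < k -> exists2 h : R, 0 < h &
  forall (t : R) n, `|t| <= h ->
  cond_ub (fun w => expR (t * S n w)) (4 * expR ((s2 / 2 + k) * (t ^+ 2 * n%:R))) /\
  cond_lb (fun w => expR (t * S n w))
    (1 / 4 * expR (- (s2 / 2)) * expR ((s2 / 2 - k) * (t ^+ 2 * n%:R))).
Proof.
move=> k0.
have [e [m0 [e0 e1 He Hm]]] := laplace_block k0.
pose h2 := e / 2 / m0.+1%:R.
have h20 : 0 < h2 by rewrite !divr_gt0.
exists (Num.sqrt h2); first by rewrite sqrtr_gt0.
move=> t n th.
have t2 : t ^+ 2 <= h2.
  rewrite -real_normK ?num_real// -[leRHS]sqr_sqrtr ?(ltW h20)//.
  by rewrite lerXn2r ?nnegrE ?sqrtr_ge0.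
have s20' : 0 <= s2 / 2 by rewrite divr_ge0.
have [->|tn0] := eqVneq t 0.
  rewrite expr0n/= !mul0r !mulr0 expR0.
  have -> : (fun w => expR (0 * S n w)) = fun=> 1 by apply/funext => w; rewrite mul0r expR0.
  split; first by apply: cond_ubW (cond_ub_cst 1); lra.
  apply: cond_ubW (cond_ub_cst (- 1)); rewrite lerN2.
  have : expR (- (s2 / 2)) <= 1 by rewrite expR_le1 oppr_le0.
  have := expR_ge0 (- (s2 / 2)); lra.
have tp : 0 < t ^+ 2 by rewrite exprn_even_gt0.
pose m := Num.truncn (e / t ^+ 2).
have et0 : 0 <= e / t ^+ 2 by rewrite divr_ge0// ltW.
have me : t ^+ 2 * m%:R <= e.
  by rewrite mulrC -ler_pdivlMr// truncn_le.
have me2 : e / 2 <= t ^+ 2 * m%:R.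
  have : e < t ^+ 2 * m.+1%:R by rewrite mulrC -ltr_pdivrMr// truncnS_gt.
  rewrite -natr1 mulrDr mulr1 => h.
  have : t ^+ 2 <= e / 2.
    apply: (le_trans t2); rewrite /h2 ler_pdivrMr// ler_peMr ?divr_ge0 ?(ltW e0)//.
    by rewrite ler1n.
  lra.
have mm0 : (m0 <= m)%N.
  rewrite truncn_ge_nat// ler_pdivlMr// mulrC.
  apply: (@le_trans _ _ (h2 * m0.+1%:R)).
    by apply: ler_pM => //; [exact: sqr_ge0|rewrite ler_nat].
  by rewrite /h2 divfK ?pnatr_eq0//; lra.
have [U L] := Hm m t mm0 (introT andP (conj me2 me)).
have mp : (0 < m)%N.
  rewrite lt0n; apply: contraTneq me2 => ->; rewrite mulr0 -ltNge; lra.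
pose q := (n %/ m)%N; pose r := (n %% m)%N.
have nE : n = (q * m + r)%N by exact: divn_eq.
have rm : `|t| * (K * Num.sqrt r%:R) <= 1 / 4.
  apply: He; apply: le_trans me; rewrite ler_wpM2l ?(ltW tp)// ler_nat.
  by rewrite ltnW// ltn_mod.
have [Ur Lr] := laplace_remainder rm.
have SE : (fun w => expR (t * S n w)) = fun w => expR (lsum (rcons (nseq q (t, m)) (t, r)) w).
  by apply/funext => w; rewrite lsum_nseq -nE.
have prodE (f : R * nat -> R) : \prod_(p <- rcons (nseq q (t, m)) (t, r)) f p =
    f (t, m) ^+ q * f (t, r).
  by rewrite -cats1 big_cat big_seq1/= big_nseq iter_mulr_1.
have qmn : (q * m)%:R <= n%:R :> R by rewrite ler_nat [leqRHS]nE leq_addr.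
have nqm : n%:R <= (q * m)%:R + m%:R :> R.
  by rewrite -natrD ler_nat [leqLHS]nE leq_add2l ltnW// ltn_mod.
split; rewrite SE.
- pose f (p : R * nat) := if p.2 == m then expR ((s2 / 2 + k) * (t ^+ 2 * m%:R)) else 4.
  have := @cond_ub_lsum f (rcons (nseq q (t, m)) (t, r)).
  rewrite prodE /f/= eqxx.
  have -> : (r == m) = false by apply/negbTE; rewrite neq_ltn ltn_mod mp.
  move=> H; apply: (cond_ubW (a := expR ((s2 / 2 + k) * (t ^+ 2 * m%:R)) ^+ q * 4)).
    rewrite mulrC ler_wpM2l// -expRM_natl ler_expR mulrCA ler_wpM2l ?addr_ge0// ?(ltW k0)//.
    by rewrite mulrCA ler_wpM2l ?(ltW tp)// -natrM.
  apply: H => p; rewrite mem_rcons inE; first by case: ifP => _; rewrite ?expR_ge0.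
  case/orP => [/eqP ->|].
    have -> : ((t, r).2 == m) = false by apply/negbTE; rewrite neq_ltn ltn_mod mp.
    exact: Ur.
  by rewrite mem_nseq => /andP[_ /eqP ->]; rewrite eqxx; exact: U.
- pose f (p : R * nat) := if p.2 == m then expR ((s2 / 2 - k) * (t ^+ 2 * m%:R)) else 1 / 4.
  have := @cond_lb_lsum f (rcons (nseq q (t, m)) (t, r)).
  rewrite prodE /f/= eqxx.
  have -> : (r == m) = false by apply/negbTE; rewrite neq_ltn ltn_mod mp.
  move=> H; apply: (cond_ubW (a := - (expR ((s2 / 2 - k) * (t ^+ 2 * m%:R)) ^+ q * (1 / 4)))).
    rewrite lerN2 [leRHS]mulrC -mulrA ler_wpM2l ?divr_ge0// -expRM_natl -expRD ler_expR.
    have h1 : t ^+ 2 * (q * m)%:R <= t ^+ 2 * n%:R by rewrite ler_wpM2l ?(ltW tp).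
    have h3 : t ^+ 2 * n%:R <= t ^+ 2 * (q * m)%:R + 1.
      apply: le_trans (lerD (lexx _) (le_trans me e1)).
      by rewrite -mulrDr ler_wpM2l ?(ltW tp).
    rewrite (_ : q%:R * _ = (s2 / 2 - k) * (t ^+ 2 * (q * m)%:R)); last first.
      by rewrite natrM; ring.
    set X := t ^+ 2 * n%:R in h1 h3 *; set Z := t ^+ 2 * _ in h1 h3 *.
    have := ler_wpM2l (ltW k0) h1; have := ler_wpM2l s20' h3.
    by rewrite mulrDr mulr1 !mulrBl; lra.
  apply: H => p; rewrite mem_rcons inE; first by case: ifP => _; rewrite ?expR_ge0 ?divr_ge0.
  case/orP => [/eqP ->|].
    have -> : ((t, r).2 == m) = false by apply/negbTE; rewrite neq_ltn ltn_mod mp.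
    exact: Lr.
  by rewrite mem_nseq => /andP[_ /eqP ->]; rewrite eqxx; exact: L.
Qed.

(** By Chebyshev, |S_n| >= x - sqrt (2 C n) has conditional probability at least 1/2
    after the first passage above x; Markov's inequality for exp (t S_n) and
    exp (- t S_n) concludes, and 16 = 2 * (4 + 4). *)
Lemma max_ineq (k : R) : 0 < k -> exists2 h : R, 0 < h &
  forall (t x : R) n, 0 < t <= h -> (0 < n)%N -> 0 < x ->
  E (fun w => (hit x n w)%:R) <=
  16 * expR (- (t * (x - Num.sqrt (2 * C * n%:R))) + (s2 / 2 + k) * (t ^+ 2 * n%:R)).
Proof.
move=> k0; have [h h0 H] := laplace_bounds k0; exists h => // t x n /andP[t0 th] n0 x0.
pose y := Num.sqrt (2 * C * n%:R).
have np : 0 < n%:R :> R by rewrite ltr0n.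
have yp : 0 < y by rewrite sqrtr_gt0 !mulr_gt0.
have Hy j : (j <= n)%N -> cond_ub (fun w => (y <= `|S j w|)%R%:R) (1 / 2).
  move=> jn; apply: (@cond_ubW _ (C * j%:R / y ^+ 2)).
    rewrite sqr_sqrtr; last by rewrite !mulr_ge0// ltW.
    rewrite ler_pdivrMr ?mulr_gt0// (_ : 1 / 2 * (2 * C * n%:R) = C * n%:R); last by field.
    by rewrite ler_pM2l// ler_nat.
  by have := cond_ub_cheb yp (var_bound j); exact.
have a1 : adapted0 (fun _ : Omega => 1 : R) by exact: bmeas_cst.
have mul1 (f : Omega -> R) : (fun w => 1 * f w) = f by apply/funext => w; rewrite mul1r.
have := hit_le x0 Hy a1 (fun=> ler01).
rewrite !mul1 => h1.
have bE u : bmeas (fun w => expR (u * S n w)) by apply: bmeas_exp; exact: bmeasZ.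
have EE u : `|u| = t -> E (fun w => expR (u * S n w)) <= 4 * expR ((s2 / 2 + k) * (t ^+ 2 * n%:R)).
  move=> ut; have [U _] := H u n ltac:(by rewrite ut).
  have := U _ a1 (fun=> ler01).
  by rewrite mul1 Ex_cst mulr1 -[u ^+ 2]real_normK ?num_real// ut.
have h2 : E (fun w => (x - y <= `|S n w|)%R%:R) <=
    E (fun w => expR (- (t * (x - y))) * (expR (t * S n w) + expR (- t * S n w))).
  apply: le_Ex.
  - by apply: bmeas_ge; exact: bmeas_norm.
  - by apply: bmeasZ; exact: bmeasD.
  move=> w; rewrite mulrDr -!expRD.
  have e1 := expR_ge0 (- (t * (x - y)) + t * S n w).
  have e2 := expR_ge0 (- (t * (x - y)) + - t * S n w).
  case: (lerP (x - y) `|S n w|) => h3; last exact: addr_ge0.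
  rewrite [X in X <= _](_ : _ = 1)//.
  have [s0|s0] := lerP 0 (S n w).
  - rewrite ger0_norm// in h3.
    have : 1 <= expR (- (t * (x - y)) + t * S n w); last by lra.
    rewrite -expR0 ler_expR addrC subr_ge0 ler_wpM2l// ltW//.
  - rewrite ltr0_norm// in h3.
    have : 1 <= expR (- (t * (x - y)) + - t * S n w); last by lra.
    rewrite -expR0 ler_expR addrC subr_ge0 mulNr -mulrN ler_wpM2l// ltW//.
rewrite ExZ in h2; last exact: bmeasD.
rewrite ExD in h2; [|exact: bE|exact: bE].
have := EE t (gtr0_norm t0); have := EE (- t); rewrite normrN => /(_ (gtr0_norm t0)) h4 h5.
rewrite expRD; set A := expR (- _) in h2 *; set B := expR (_ * _) in h4 h5 *.
have A0 : 0 <= A by exact: expR_ge0.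
have := ler_wpM2l A0 (lerD h5 h4); lra.
Qed.

(** * Joint Laplace transform of the increments over a grid *)

Variable a : nat -> R.
Hypothesis a0 : forall n, 0 < a n.
Hypothesis acv : a n @[n --> \oo] --> 0.
Hypothesis qcv : n%:R * a n @[n --> \oo] --> +oo.

Lemma speed_small (e : R) : 0 < e -> \forall n \near \oo, a n <= e.
Proof.
move=> e0; have /cvgrPdist_lt/(_ e e0) := acv.
by apply: filterS => n; rewrite sub0r normrN gtr0_norm ?a0// => /ltW.
Qed.

Lemma speed_large (M : R) : \forall n \near \oo, M <= n%:R * a n.
Proof. by have /cvgryPge/(_ M) := qcv. Qed.

Lemma natr_large (M : R) : \forall n \near \oo, M <= n%:R.
Proof.
exists (Num.truncn M).+1 => // n /= Mn.
by rewrite ltW// (lt_le_trans (truncnS_gt _))// ler_nat.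
Qed.

(** The path is scale_n S, and dividing it by a_n gives slope_n S: an exponent
    lam x / a_n for the path is an exponent lam slope_n for the partial sums. *)
Definition scale_n n : R := Num.sqrt (a n) / Num.sqrt n%:R.
Definition slope_n n : R := (Num.sqrt (n%:R * a n))^-1.

Let sc := scale_n.
Let rr := slope_n.

Lemma slope_n_gt0 n : (0 < n)%N -> 0 < rr n.
Proof. by move=> n0; rewrite invr_gt0 sqrtr_gt0 mulr_gt0// ltr0n. Qed.

Lemma scale_nE n : (0 < n)%N -> sc n = a n * rr n.
Proof.
move=> n0; rewrite /sc /rr /scale_n /slope_n sqrtrM// invfM mulrA mulrAC.
rewrite -{2}(@sqr_sqrtr _ (a n)) ?ltW//; field.
by rewrite !gt_eqF ?sqrtr_gt0 ?ltr0n.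
Qed.

Lemma slope_n_sqr n : (0 < n)%N -> rr n ^+ 2 = (n%:R * a n)^-1.
Proof. by move=> n0; rewrite /rr /slope_n exprVn sqr_sqrtr// mulr_ge0// ltW. Qed.

Lemma slope_n_small (e : R) : 0 < e -> \forall n \near \oo, rr n <= e.
Proof.
move=> e0; near=> n.
have n0 : (0 < n)%N by near: n; exact: nbhs_infty_gt.
rewrite -[leRHS]gtr0_norm// -[leLHS]gtr0_norm ?slope_n_gt0// -ler_sqr ?nnegrE// !real_normK ?num_real//.
rewrite slope_n_sqr// -[leRHS]invrK lef_pV2 ?posrE ?invr_gt0 ?exprn_gt0 ?mulr_gt0 ?ltr0n//.
by near: n; exact: speed_large.
Unshelve. all: by end_near. Qed.

Definition grid_index k n j := (n * j %/ k)%N.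

Let g := grid_index.

Lemma grid_index_le k n j : (g k n j <= g k n j.+1)%N.
Proof. by rewrite /g /grid_index leq_div2r// leq_mul2l leqnSn orbT. Qed.

Definition grid_step k n j := (g k n j.+1 - g k n j)%N.

Let D := grid_step.

Lemma grid_step_bounds k n j : (0 < k)%N ->
  n%:R / k%:R - 1 <= (D k n j)%:R :> R /\ (D k n j)%:R <= n%:R / k%:R + 1 :> R.
Proof.
move=> k0; have kp : 0 < k%:R :> R by rewrite ltr0n.
rewrite /D /grid_step natrB ?grid_index_le//.
have h i : (g k n i)%:R * k%:R <= n%:R * i%:R :> R /\ n%:R * i%:R < (g k n i)%:R * k%:R + k%:R :> R.
  rewrite -!natrM -natrD ler_nat ltr_nat /g /grid_index; split; first exact: leq_trunc_div.
  by rewrite -mulSnr ltn_ceil.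
have [h1 h2] := h j; have [h3 h4] := h j.+1.
rewrite -natr1 mulrDr mulr1 in h3 h4.
by split; rewrite -(@ler_pM2r _ k%:R)// ?mulrBl ?mulrDl ?mul1r divfK ?gt_eqF//; lra.
Qed.

Lemma slope_grid_step k n j : (0 < k)%N -> (0 < n)%N ->
  (k%:R^-1 - n%:R^-1) / a n <= rr n ^+ 2 * (D k n j)%:R /\
  rr n ^+ 2 * (D k n j)%:R <= (k%:R^-1 + n%:R^-1) / a n.
Proof.
move=> k0 n0; have [h1 h2] := grid_step_bounds n j k0.
have np : 0 < n%:R :> R by rewrite ltr0n.
have kp : 0 < k%:R :> R by rewrite ltr0n.
have r20 : 0 < (n%:R * a n)^-1 by rewrite invr_gt0 mulr_gt0.
rewrite slope_n_sqr//.
have E1 : (k%:R^-1 - n%:R^-1) / a n = (n%:R * a n)^-1 * (n%:R / k%:R - 1).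
  by field; rewrite !gt_eqF.
have E2 : (k%:R^-1 + n%:R^-1) / a n = (n%:R * a n)^-1 * (n%:R / k%:R + 1).
  by field; rewrite !gt_eqF.
by rewrite E1 E2 !ler_pM2l.
Qed.

(** The exponent sum_j lam_j xi_j / a_n of the tilted law, see [tilt_incr]. *)
Definition tilt k n (lam : nat -> R) w : R :=
  \sum_(j < k) lam j * rr n * (S (g k n j.+1) w - S (g k n j) w).

Definition tilt_list k n (lam : nat -> R) (m p : nat) : seq (R * nat) :=
  [seq (lam j * rr n, D k n j) | j <- iota m p].

Let lsum_tilt k n lam m p w :
  lsum (tilt_list k n lam m p) (iter (g k n m) T w) =
  \sum_(m <= j < m + p) lam j * rr n * (S (g k n j.+1) w - S (g k n j) w).
Proof.
elim: p m => [|p IH] m; first by rewrite addn0 big_geq.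
rewrite [LHS]/= -iterD addnC subnKC ?grid_index_le// IH [in RHS]big_ltn; last by rewrite addnS ltnS leq_addr.
rewrite addSnnS; congr (_ * _ + _).
by rewrite -[in RHS](subnKC (grid_index_le k n m)) psumD addrC addKr.
Qed.

Let tiltE k n lam w : tilt k n lam w = lsum (tilt_list k n lam 0 k) w.
Proof.
have := lsum_tilt k n lam 0 k w; rewrite /g /grid_index muln0 div0n /= => ->.
by rewrite add0n big_mkord.
Qed.

Lemma bmeas_tilt k n lam : bmeas (tilt k n lam).
Proof.
rewrite /tilt; apply: bmeas_sum => j _.
by apply: bmeasZ; exact: bmeasB.
Qed.

Let one_le4 : (4 : R) <= expR 4.
Proof. by apply: le_trans (expR_ge1Dx _); lra. Qed.

(** The bounds of [laplace_bounds] multiply over the k cells. Their constant factors,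
    between exp (- k b) and exp (k b), are absorbed in exp (e / a_n). *)
Lemma laplace_joint k (lam : nat -> R) (e : R) : (0 < k)%N -> 0 < e ->
  \forall n \near \oo,
    expR ((s2 / (2 * k%:R) * (\sum_(j < k) lam j ^+ 2) - e) / a n) <= E (fun w => expR (tilt k n lam w)) /\
    E (fun w => expR (tilt k n lam w)) <= expR ((s2 / (2 * k%:R) * (\sum_(j < k) lam j ^+ 2) + e) / a n).
Proof.
move=> k0 e0; pose L := \sum_(j < k) lam j ^+ 2.
have kp : 0 < k%:R :> R by rewrite ltr0n.
have L0 : 0 <= L by apply: sumr_ge0 => j _; exact: sqr_ge0.
pose e1 := e / (3 * (L + 1)).
have e10 : 0 < e1 by rewrite divr_gt0// mulr_gt0// ltr_wpDl.
have [h h0 H] := laplace_bounds e10.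
pose Lm := \sum_(j < k) `|lam j| + 1.
have Lm0 : 0 < Lm by rewrite ltr_wpDl// sumr_ge0.
have lamL (j : 'I_k) : `|lam j| <= Lm.
  by rewrite /Lm (bigD1 j)//= -addrA lerDl addr_ge0// sumr_ge0.
pose b := 4 + s2 / 2.
have b0 : 0 < b by rewrite ltr_wpDr// divr_ge0.
near=> n.
have n0 : (0 < n)%N by near: n; exact: nbhs_infty_gt.
have np : 0 < n%:R :> R by rewrite ltr0n.
have rrh : rr n <= h / Lm by near: n; apply: slope_n_small; rewrite divr_gt0.
have small1 : a n <= e / (3 * (k%:R * b)).
  by near: n; apply: speed_small; rewrite divr_gt0// !mulr_gt0.
have small2 : 3 * ((s2 / 2 + e1) * L) / e <= n%:R by near: n; exact: natr_large.
have an0 := a0 n.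
have tb (j : 'I_k) : `|lam j * rr n| <= h.
  rewrite normrM (gtr0_norm (slope_n_gt0 n0)) (@le_trans _ _ (Lm * rr n)) ?ler_wpM2r ?(ltW (slope_n_gt0 n0))//.
  by rewrite mulrC -ler_pdivlMr.
have small1' : k%:R * b <= e / 3 / a n.
  rewrite ler_pdivlMr// mulrC -ler_pdivlMr ?mulr_gt0//.
  by apply: le_trans small1 _; rewrite le_eqVlt; apply/orP; left; apply/eqP; field; rewrite !gt_eqF.
have small2' : (s2 / 2 + e1) * L / n%:R <= e / 3.
  rewrite ler_pdivrMr//; rewrite ler_pdivrMr// in small2; lra.
have e1L : e1 * L <= e / 3.
  rewrite /e1 mulrAC ler_pdivrMr ?mulr_gt0 ?ltr_wpDl//.
  rewrite (_ : e / 3 * (3 * (L + 1)) = e * (L + 1)); last by field.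
  by rewrite ler_wpM2l ?(ltW e0)// lerDl.
have e1Lk : e1 * L / k%:R <= e / 3.
  apply: le_trans e1L; rewrite ler_pdivrMr//.
  by apply: ler_peMr; [rewrite mulr_ge0// ltW|rewrite ler1n].
have a1 : adapted0 (fun _ : Omega => 1 : R) by exact: bmeas_cst.
have mul1 (f : Omega -> R) : (fun w => 1 * f w) = f by apply/funext => w; rewrite mul1r.
have tE : (fun w => expR (tilt k n lam w)) = fun w => expR (lsum (tilt_list k n lam 0 k) w).
  by apply/funext => w; rewrite tiltE.
have inl p : p \in tilt_list k n lam 0 k -> exists2 j : 'I_k, true & p = (lam j * rr n, D k n j).
  by move=> /mapP[j]; rewrite mem_iota add0n => jk ->; exists (Ordinal jk).
have prodE (f : R * nat -> R) : \prod_(p <- tilt_list k n lam 0 k) f p =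
    \prod_(j < k) f (lam j * rr n, D k n j).
  by rewrite /tilt_list big_map -{1}(subn0 k) -/(index_iota 0 k) big_mkord.
have sumD (v : R) : \sum_(j < k) v * ((lam j * rr n) ^+ 2 * (D k n j)%:R) =
    v * \sum_(j < k) lam j ^+ 2 * (rr n ^+ 2 * (D k n j)%:R).
  by rewrite mulr_sumr; apply: eq_bigr => j _; rewrite exprMn -!mulrA.
pose Q := \sum_(j < k) lam j ^+ 2 * (rr n ^+ 2 * (D k n j)%:R).
have QU : Q <= L * (k%:R^-1 + n%:R^-1) / a n.
  rewrite /Q /L -mulrA mulr_suml; apply: ler_sum => j _.
  by rewrite ler_wpM2l ?sqr_ge0//; have [] := slope_grid_step j k0 n0.
have QL : L * (k%:R^-1 - n%:R^-1) / a n <= Q.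
  rewrite /Q /L -mulrA mulr_suml; apply: ler_sum => j _.
  by rewrite ler_wpM2l ?sqr_ge0//; have [] := slope_grid_step j k0 n0.
have sk : 0 <= s2 / 2 by rewrite divr_ge0.
split.
- pose f (p : R * nat) := 1 / 4 * expR (- (s2 / 2)) * expR ((s2 / 2 - e1) * (p.1 ^+ 2 * p.2%:R)).
  have f0 p : 0 <= f p by rewrite !mulr_ge0 ?expR_ge0.
  have Hf p : p \in tilt_list k n lam 0 k -> cond_lb (fun w => expR (p.1 * S p.2 w)) (f p).
    by move=> /inl[j _ ->]; have [_] := H (lam j * rr n) (D k n j) (tb j); exact.
  have cl := cond_lb_lsum (fun p _ => f0 p) Hf.
  have := cond_lbP (bmeas_exp (bmeas_lsum _)) cl a1 (fun=> ler01).
  rewrite Ex_cst mulr1 mul1 -tE; apply: le_trans.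
  rewrite prodE.
  have fge p : expR (- b + (s2 / 2 - e1) * (p.1 ^+ 2 * p.2%:R)) <= f p.
    rewrite expRD ler_wpM2r ?expR_ge0// /b opprD expRD ler_wpM2r ?expR_ge0//.
    by rewrite mul1r expRN lef_pV2 ?posrE ?expR_gt0.
  apply: (@le_trans _ _ (\prod_(j < k) expR (- b + (s2 / 2 - e1) * ((lam j * rr n) ^+ 2 * (D k n j)%:R)))); last first.
    apply: ler_prod => j _; apply/andP; split; first exact: expR_ge0.
    exact: (fge (lam j * rr n, D k n j)).
  rewrite -expR_sum ler_expR big_split/= sumr_const card_ord sumD -/Q.
  have h1 : s2 / 2 * (L * (k%:R^-1 - n%:R^-1) / a n) <= s2 / 2 * Q by rewrite ler_wpM2l.
  have h2 : e1 * Q <= e1 * (L * (k%:R^-1 + n%:R^-1) / a n) by rewrite ler_wpM2l ?(ltW e10).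
  have E1 : s2 / 2 * (L * (k%:R^-1 - n%:R^-1) / a n) = s2 / (2 * k%:R) * L / a n - s2 / 2 * L / n%:R / a n.
    by field; rewrite !gt_eqF.
  have E2 : e1 * (L * (k%:R^-1 + n%:R^-1) / a n) = (e1 * L / k%:R + e1 * L / n%:R) / a n.
    by field; rewrite !gt_eqF.
  have E3 : (s2 / 2 + e1) * L / n%:R / a n = s2 / 2 * L / n%:R / a n + e1 * L / n%:R / a n.
    by field; rewrite !gt_eqF.
  have h3 : (s2 / 2 + e1) * L / n%:R / a n <= e / 3 / a n by rewrite ler_pM2r ?invr_gt0.
  have h4 : e1 * L / k%:R / a n <= e / 3 / a n by rewrite ler_pM2r ?invr_gt0.
  rewrite -[(- b) *+ k]mulr_natl mulrN; rewrite E1 in h1; rewrite E2 mulrDl in h2.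
  have -> : (s2 / (2 * k%:R) * L - e) / a n = s2 / (2 * k%:R) * L / a n - 3 * (e / 3 / a n).
    by field; rewrite !gt_eqF.
  lra.
- pose f (p : R * nat) := 4 * expR ((s2 / 2 + e1) * (p.1 ^+ 2 * p.2%:R)).
  have f0 p : 0 <= f p by rewrite mulr_ge0 ?expR_ge0.
  have Hf p : p \in tilt_list k n lam 0 k -> cond_ub (fun w => expR (p.1 * S p.2 w)) (f p).
    by move=> /inl[j _ ->]; have [+ _] := H (lam j * rr n) (D k n j) (tb j); exact.
  have cl := cond_ub_lsum (fun p _ => f0 p) Hf.
  have := cl _ a1 (fun=> ler01).
  rewrite Ex_cst mulr1 mul1 -tE => h1; apply: (le_trans h1).
  rewrite prodE.
  have fle p : f p <= expR (b + (s2 / 2 + e1) * (p.1 ^+ 2 * p.2%:R)).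
    rewrite expRD ler_wpM2r ?expR_ge0// (le_trans one_le4)// ler_expR /b lerDl//.
  apply: (@le_trans _ _ (\prod_(j < k) expR (b + (s2 / 2 + e1) * ((lam j * rr n) ^+ 2 * (D k n j)%:R)))).
    apply: ler_prod => j _; apply/andP; split; first exact: f0.
    exact: (fle (lam j * rr n, D k n j)).
  rewrite -expR_sum ler_expR big_split/= sumr_const card_ord sumD -/Q.
  have h2 : (s2 / 2 + e1) * Q <= (s2 / 2 + e1) * (L * (k%:R^-1 + n%:R^-1) / a n).
    by rewrite ler_wpM2l// addr_ge0// ltW.
  have E1 : (s2 / 2 + e1) * (L * (k%:R^-1 + n%:R^-1) / a n) =
      s2 / (2 * k%:R) * L / a n + e1 * L / k%:R / a n + (s2 / 2 + e1) * L / n%:R / a n.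
    by field; rewrite !gt_eqF.
  have h3 : (s2 / 2 + e1) * L / n%:R / a n <= e / 3 / a n by rewrite ler_pM2r ?invr_gt0.
  have h4 : e1 * L / k%:R / a n <= e / 3 / a n by rewrite ler_pM2r ?invr_gt0.
  rewrite -[b *+ k]mulr_natl; rewrite E1 in h2.
  have -> : (s2 / (2 * k%:R) * L + e) / a n = s2 / (2 * k%:R) * L / a n + 3 * (e / 3 / a n).
    by field; rewrite !gt_eqF.
  lra.
Unshelve. all: by end_near. Qed.

Lemma scale_n_gt0 n : (0 < n)%N -> 0 < sc n.
Proof. by move=> n0; rewrite divr_gt0// sqrtr_gt0// ltr0n. Qed.

(** Constant factors do not matter at the speed a_n. *)
Lemma nat_absorbed (m : nat) (e : R) : 0 < e -> \forall n \near \oo, m%:R <= expR (e / a n).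
Proof.
move=> e0; near=> n; apply: le_trans (expR_ge1Dx _).
apply: (@le_trans _ _ (e / a n)); last by rewrite lerDr.
rewrite ler_pdivlMr// mulrC.
have H : a n <= e / m.+1%:R by near: n; apply: speed_small; rewrite divr_gt0// ltr0n.
rewrite ler_pdivlMr ?ltr0n// in H; apply: le_trans H.
by rewrite ler_wpM2l ?ler_nat// ltW.
Unshelve. all: by end_near. Qed.

(** * Exponential bounds for the increments and the oscillations *)

Definition walk_osc k n (x : R) w : bool :=
  [exists j : 'I_k, hit (x / sc n) (D k n j) (iter (g k n j) T w)].

Lemma measurable_walk_osc k n (x : R) : measurable [set w | walk_osc k n x w].
Proof.
have -> : [set w | walk_osc k n x w] =
    \bigcup_(j in [set: 'I_k]) (iter (g k n j) T @^-1` [set w | hit (x / sc n) (D k n j) w]).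
  apply/seteqP; split => [w /existsP[j h]|w [j _ h]]; first by exists j.
  by apply/existsP; exists j.
apply: fin_bigcup_measurable => // j _.
rewrite -[X in measurable X]setTI; apply: measurable_iter => //.
rewrite (_ : [set w | _] = (fun w => (hit (x / sc n) (D k n j) w)%:R : R) @^-1` [set 1]).
  have [mh _] := adapted_bmeas (adapted_hit (x / sc n) (D k n j)).
  by rewrite -[X in measurable X]setTI; exact: mh.
apply/seteqP; split => w /=; first by move=> ->.
by case: hit => // /eqP; rewrite eq_sym oner_eq0.
Qed.

(** A union over the cells of the maximal inequality, with lam slope_n as the
    exponent. *)
Lemma osc_bound k (lam x e : R) : (0 < k)%N -> 0 < lam -> 0 < x -> 0 < e ->
  \forall n \near \oo, E (fun w => (walk_osc k n x w)%:R) <=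
    expR (- ((lam * x - s2 * lam ^+ 2 / (2 * k%:R) - e) / a n)).
Proof.
move=> k0 l0 x0 e0; have kp : 0 < k%:R :> R by rewrite ltr0n.
have k1 : 1 <= k%:R :> R by rewrite ler1n.
have l20 : 0 < lam ^+ 2 by rewrite exprn_gt0.
pose e1 := e / (8 * lam ^+ 2).
have e10 : 0 < e1 by rewrite divr_gt0// mulr_gt0.
have [h h0 H] := max_ineq e10.
near=> n.
have n0 : (0 < n)%N by near: n; exact: nbhs_infty_gt.
have np : 0 < n%:R :> R by rewrite ltr0n.
have rp : 0 < rr n by apply: slope_n_gt0.
have rrh : rr n <= h / lam by near: n; apply: slope_n_small => //; rewrite divr_gt0.
have nk : (2 * k)%:R <= n%:R :> R by near: n; exact: natr_large.
have cst : (16 * k)%:R <= expR (e / 4 / a n) by near: n; apply: nat_absorbed; rewrite divr_gt0.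
have sm1 : a n <= (e / 4) ^+ 2 / (4 * C * lam ^+ 2).
  by near: n; apply: speed_small; rewrite divr_gt0 ?exprn_gt0 ?mulr_gt0 ?divr_gt0.
have sm2 : 4 * ((s2 / 2 + e1) * lam ^+ 2) / e <= n%:R by near: n; exact: natr_large.
have an0 := a0 n.
have nk2 : k%:R * 2 <= n%:R :> R by rewrite mulrC -natrM.
have sm2' : (s2 / 2 + e1) * lam ^+ 2 / n%:R <= e / 4.
  rewrite ler_pdivrMr//; rewrite ler_pdivrMr// in sm2; lra.
have invn : n%:R^-1 <= k%:R^-1 :> R.
  by rewrite lef_pV2 ?posrE//; lra.
pose V := expR (- ((lam * x - s2 * lam ^+ 2 / (2 * k%:R) - e * 3 / 4) / a n)).
have one (j : 'I_k) : E (fun w => (hit (x / sc n) (D k n j) w)%:R) <= 16 * V.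
  have [h1 h2] := slope_grid_step j k0 n0; rewrite -/rr -/D in h1 h2.
  have D0 : (0 < D k n j)%N.
    have [d1 _] := @grid_step_bounds k n j k0.
    rewrite -(ltr_nat R); apply: lt_le_trans d1.
    rewrite subr_gt0 ltr_pdivlMr//; lra.
  have sp := scale_n_gt0 n0.
  apply: le_trans (H (lam * rr n) (x / sc n) (D k n j) _ D0 _) _.
  - by rewrite mulr_gt0//= mulrC -ler_pdivlMr.
  - by rewrite divr_gt0.
  rewrite ler_pM2l// ler_expR.
  have E1 : lam * rr n * (x / sc n) = lam * x / a n.
    by rewrite scale_nE//; field; rewrite !gt_eqF.
  have E2 : (lam * rr n) * Num.sqrt (2 * C * (D k n j)%:R) <= e / 4 / a n.
    apply: (@le_trans _ _ (Num.sqrt (4 * C * lam ^+ 2 / a n))).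
      rewrite -[X in X * _](@ger0_norm _ (lam * rr n)) ?mulr_ge0 ?(ltW l0) ?(ltW rp)//.
      rewrite -sqrtr_sqr -sqrtrM ?sqr_ge0// ler_wsqrtr//.
      rewrite exprMn.
      rewrite [leLHS](_ : _ = (2 * C * lam ^+ 2) * (rr n ^+ 2 * (D k n j)%:R)); last by ring.
      rewrite [leRHS](_ : _ = (2 * C * lam ^+ 2) * (2 / a n)); last by ring.
      rewrite ler_pM2l ?mulr_gt0//; apply: (le_trans h2).
      rewrite ler_pM2r ?invr_gt0//.
      have : k%:R^-1 <= 1 :> R by rewrite invf_le1.
      by move: invn; lra.
    rewrite -[leRHS](@ger0_norm _ (e / 4 / a n)) ?divr_ge0 ?(ltW e0) ?(ltW an0)//.
    rewrite -sqrtr_sqr ler_wsqrtr//.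
    rewrite ler_pdivlMr ?mulr_gt0// in sm1.
    rewrite ler_pdivrMr//.
    have -> : (e / 4 / a n) ^+ 2 * a n = (e / 4) ^+ 2 / a n by field; rewrite gt_eqF.
    by rewrite ler_pdivlMr// mulrC.
  have E3 : (s2 / 2 + e1) * ((lam * rr n) ^+ 2 * (D k n j)%:R) <=
      (s2 * lam ^+ 2 / (2 * k%:R) + e / 4 + e / 8) / a n.
    rewrite [leLHS](_ : _ = (s2 / 2 + e1) * lam ^+ 2 * (rr n ^+ 2 * (D k n j)%:R)); last by ring.
    have s' : 0 <= (s2 / 2 + e1) * lam ^+ 2 by rewrite mulr_ge0// ?(ltW l20)// addr_ge0 ?(ltW e10)// divr_ge0.
    apply: le_trans (ler_wpM2l s' h2) _.
    rewrite mulrA ler_pM2r ?invr_gt0//.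
    rewrite mulrDr; have : (s2 / 2 + e1) * lam ^+ 2 / k%:R <= s2 * lam ^+ 2 / (2 * k%:R) + e / 8.
      rewrite (_ : (s2 / 2 + e1) * lam ^+ 2 / k%:R = s2 * lam ^+ 2 / (2 * k%:R) + e / 8 / k%:R); last first.
        by rewrite /e1; field; rewrite !gt_eqF.
      by rewrite lerD2l ler_pdivrMr// ler_peMr// divr_ge0// (ltW e0).
    by move: sm2'; lra.
  rewrite mulrBr E1 opprB.
  have -> : - ((lam * x - s2 * lam ^+ 2 / (2 * k%:R) - e * 3 / 4) / a n) =
      (s2 * lam ^+ 2 / (2 * k%:R) + e / 4 + e / 8) / a n + e / 4 / a n - lam * x / a n + e / 8 / a n.
    by field; rewrite !gt_eqF.
  have : 0 <= e / 8 / a n by rewrite !divr_ge0// ltW.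
  by move: E2 E3; lra.
have bh m y i : bmeas (fun w => (hit y m (iter i T w))%:R : R).
  by apply: (@bmeas_iter i (fun w => (hit y m w)%:R)); exact: (adapted_bmeas (adapted_hit y m)).
apply: (@le_trans _ _ (E (fun w => \sum_(j < k) (hit (x / sc n) (D k n j) (iter (g k n j) T w))%:R))).
  apply: le_Ex => [||w].
  - by apply: bmeas_bool; exact: measurable_walk_osc.
  - by apply: bmeas_sum => j _; exact: bh.
  case: (boolP (walk_osc k n x w)) => [/existsP[j hj]|_]; last by apply: sumr_ge0.
  by rewrite (bigD1 j)//= hj lerDl sumr_ge0.
rewrite Ex_sum; last by move=> j _; exact: bh.
apply: (@le_trans _ _ (\sum_(j < k) (16 * V))).
  apply: ler_sum => j _; apply: le_trans (one j).
  have := @Ex_iter (g k n j) (fun w => (hit (x / sc n) (D k n j) w)%:R) (bh _ _ 0%N).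
  by move=> <-.
rewrite sumr_const card_ord (_ : 16 * V *+ k = (16 * k)%:R * V); last first.
  by rewrite -[LHS]mulr_natr natrM; ring.
apply: le_trans (ler_wpM2r (expR_ge0 _) cst) _.
rewrite -expRD ler_expR.
by rewrite le_eqVlt; apply/orP; left; apply/eqP; field; rewrite !gt_eqF.
Unshelve. all: by end_near. Qed.

(** The exponent lam x beats the rate L for lam large, and then lam^2 / k is small on
    a fine grid; when the variance vanishes a single cell is enough. *)
Lemma osc_negligible (x L : R) : 0 < x -> 0 <= L -> exists K : R, forall k, (0 < k)%N ->
  s2 * K <= k%:R ->
  \forall n \near \oo, E (fun w => (walk_osc k n x w)%:R) <= expR (- (L / a n)).
Proof.
move=> x0 L0; pose lam := (L + 2) / x.
have l0 : 0 < lam by rewrite divr_gt0// ltr_wpDl.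
exists (lam ^+ 2) => k k0 Kk; have kp : 0 < k%:R :> R by rewrite ltr0n.
have := osc_bound k0 l0 x0 (ltr01 : 0 < (1 : R)); apply: filterS => n H.
apply: (le_trans H).
rewrite ler_expR lerN2 ler_pM2r ?invr_gt0//.
rewrite /lam divfK ?gt_eqF// -/lam.
have : s2 * lam ^+ 2 / (2 * k%:R) <= 1 / 2.
  rewrite ler_pdivrMr ?mulr_gt0//; move: Kk; lra.
lra.
Qed.

Definition walk_incr k n (j : nat) w : R := sc n * (S (g k n j.+1) w - S (g k n j) w).

Lemma bmeas_walk_incr k n j : bmeas (walk_incr k n j).
Proof. by apply: bmeasZ; exact: bmeasB. Qed.

Lemma tilt_incr k n lam w : (0 < n)%N ->
  tilt k n lam w = (\sum_(j < k) lam j * walk_incr k n j w) / a n.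
Proof.
move=> n0; rewrite /tilt mulr_suml; apply: eq_bigr => j _.
by rewrite /walk_incr scale_nE//; field; rewrite gt_eqF.
Qed.

Lemma bmeas_lincomb k n (lam : nat -> R) : bmeas (fun w => \sum_(j < k) lam j * walk_incr k n j w).
Proof. by apply: bmeas_sum => j _; apply: bmeasZ; exact: bmeas_walk_incr. Qed.

Lemma chernoff_incr k (lam : nat -> R) (x e : R) : (0 < k)%N -> 0 < e ->
  \forall n \near \oo,
    E (fun w => (x <= \sum_(j < k) lam j * walk_incr k n j w)%R%:R) <=
    expR (- ((x - s2 / (2 * k%:R) * (\sum_(j < k) lam j ^+ 2) - e) / a n)).
Proof.
move=> k0 e0; near=> n.
have n0 : (0 < n)%N by near: n; exact: nbhs_infty_gt.
have [_ J] : expR ((s2 / (2 * k%:R) * (\sum_(j < k) lam j ^+ 2) - e) / a n) <=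
      E (fun w => expR (tilt k n lam w)) /\
    E (fun w => expR (tilt k n lam w)) <=
      expR ((s2 / (2 * k%:R) * (\sum_(j < k) lam j ^+ 2) + e) / a n).
  by near: n; exact: laplace_joint.
pose Z w := \sum_(j < k) lam j * walk_incr k n j w.
have bZ : bmeas Z by exact: bmeas_lincomb.
have bE : bmeas (fun w => expR (Z w / a n)).
  apply: bmeas_exp; apply: bmeas_ext (bmeasZ (a n)^-1 bZ) => w; exact: mulrC.
apply: (@le_trans _ _ (E (fun w => expR (- (x / a n)) * expR (Z w / a n)))).
  apply: le_Ex; [exact: bmeas_ge|exact: bmeasZ|move=> w].
  rewrite -expRD; case: (boolP (x <= _)) => xZ; last exact: expR_ge0.
  rewrite -expR0 ler_expR addrC -mulrBl divr_ge0 ?subr_ge0// ltW//.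
rewrite ExZ//.
have -> : (fun w => expR (Z w / a n)) = fun w => expR (tilt k n lam w).
  by apply/funext => w; rewrite tilt_incr.
apply: le_trans (ler_wpM2l (expR_ge0 _) J) _.
rewrite -expRD ler_expR.
by rewrite le_eqVlt; apply/orP; left; apply/eqP; rewrite -mulNr -mulrDl -mulNr; congr (_ / _); ring.
Unshelve. all: by end_near. Qed.

Local Notation xi := walk_incr.

(** If |xi| > r then xi has almost the component r along some vector of the net. The
    slope k r / s2 is the optimal one in Chernoff's bound. *)
Lemma incr_energy_tail k (M e : R) : (0 < k)%N -> 0 < s2 -> 0 < M -> 0 < e ->
  \forall n \near \oo, E (fun w => (M < k%:R * \sum_(j < k) xi k n j w ^+ 2)%R%:R) <=
    expR (- ((M / (2 * s2) - e) / a n)).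
Proof.
move=> k0 s2p M0 e0; have kp : 0 < k%:R :> R by rewrite ltr0n.
(* The net loses 5 / 2 (M / s2) (k / N) in the exponent. *)
pose N := (Num.truncn (15 / 2 * (M / s2) * k%:R / e) + k).+1.
have Np : 0 < N%:R :> R by rewrite ltr0n.
have kN : k%:R <= N%:R :> R by rewrite ler_nat /N leqW// leq_addl.
have Ne : 5 / 2 * (M / s2) * k%:R / N%:R <= e / 3.
  have h : 15 / 2 * (M / s2) * k%:R / e <= N%:R.
    apply: (le_trans (ltW (truncnS_gt _))); rewrite ler_nat /N ltnS leq_addr//.
  rewrite ler_pdivrMr//; rewrite ler_pdivrMr// in h; lra.
pose r := Num.sqrt (M / k%:R).
have r0 : 0 < r by rewrite sqrtr_gt0 divr_gt0.
have r2 : r ^+ 2 = M / k%:R by rewrite sqr_sqrtr// divr_ge0// ltW.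
pose I := {ffun 'I_k -> 'I_(2 * N).+1}.
pose good (i : I) := \sum_(j < k) @net_vector R _ _ i j ^+ 2 <= 1 + 3 * k%:R / N%:R.
pose s := k%:R * r / s2.
have s0 : 0 < s by rewrite divr_gt0// mulr_gt0.
pose x := s * (r * (1 - k%:R / N%:R)).
near=> n.
have an0 := a0 n.
have ch (i : I) : E (fun w => (x <= \sum_(j < k) (s * @net_vector R _ _ i j) * xi k n j w)%R%:R) <=
    expR (- ((x - s2 / (2 * k%:R) * (\sum_(j < k) (s * @net_vector R _ _ i j) ^+ 2) - e / 3) / a n)).
  move: i; near: n.
  apply: (@filter_forall _ _ (fun (i : I) (n : nat) => E (fun w => (x <= \sum_(j < k) (s * @net_vector R _ _ i j) * xi k n j w)%R%:R) <=
    expR (- ((x - s2 / (2 * k%:R) * (\sum_(j < k) (s * @net_vector R _ _ i j) ^+ 2) - e / 3) / a n))) _ _) => i.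
  by apply: (chernoff_incr (fun j => s * @net_vector R _ _ i j)) => //; rewrite divr_gt0.
have cst : #|I|%:R <= expR (e / 3 / a n) by near: n; apply: nat_absorbed; rewrite divr_gt0.
pose V := expR (- ((M / (2 * s2) - 2 * (e / 3)) / a n)).
have bx (i : I) : bmeas (fun w => (x <= \sum_(j < k) (s * @net_vector R _ _ i j) * xi k n j w)%R%:R : R).
  by apply: bmeas_ge; exact: (bmeas_lincomb k n (fun j => s * @net_vector R _ _ i j)).
have bM : bmeas (fun w => (M < k%:R * \sum_(j < k) xi k n j w ^+ 2)%R%:R : R).
  have bN : bmeas (fun w => - (k%:R * \sum_(j < k) xi k n j w ^+ 2)).
    by apply: bmeasN; apply: bmeasZ; apply: bmeas_sum => j _; apply: bmeasX; exact: bmeas_walk_incr.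
  by apply: bmeas_ext (bmeas_lt (- M) bN) => w; rewrite ltrN2.
apply: (@le_trans _ _ (E (fun w => \sum_(i | good i)
    (x <= \sum_(j < k) (s * @net_vector R _ _ i j) * xi k n j w)%R%:R))).
  apply: le_Ex => // [|w]; first by apply: bmeas_sum => i _; exact: bx.
  case: (boolP (M < _)) => [Mx|_]; last by apply: sumr_ge0.
  have [|i [gi ri]] := @sphere_net R k N (fun j => xi k n j w) r isT kN r0.
    by rewrite r2 ltr_pdivrMr// mulrC.
  rewrite (bigD1 i)//= (_ : (x <= _)%R = true) ?lerDl ?sumr_ge0//.
  rewrite /x (_ : \sum_(j < k) _ = s * \sum_(j < k) @net_vector R _ _ i j * xi k n j w).
    by rewrite ler_pM2l.
  by rewrite [RHS]mulr_sumr; apply: eq_bigr => j _; rewrite -mulrA.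
rewrite Ex_sum; last by move=> i _; exact: bx.
apply: (@le_trans _ _ (\sum_(i : I | good i) V)).
  apply: ler_sum => i gi; apply: (le_trans (ch i)).
  rewrite ler_expR lerN2 ler_pM2r ?invr_gt0//.
  have -> : \sum_(j < k) (s * @net_vector R _ _ i j) ^+ 2 = s ^+ 2 * \sum_(j < k) @net_vector R _ _ i j ^+ 2.
    by rewrite mulr_sumr; apply: eq_bigr => j _; rewrite exprMn.
  have sr : s * r = M / s2.
    have -> : s * r = k%:R * r ^+ 2 / s2 by rewrite /s; field; rewrite gt_eqF.
    by rewrite r2; field; rewrite !gt_eqF.
  have ss : s2 / (2 * k%:R) * s ^+ 2 = M / (2 * s2).
    have -> : s2 / (2 * k%:R) * s ^+ 2 = s * r / 2 by rewrite /s; field; rewrite !gt_eqF.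
    by rewrite sr; field; rewrite gt_eqF.
  have xE : x = M / s2 * (1 - k%:R / N%:R) by rewrite /x mulrA sr.
  have ssE (q : R) : s2 / (2 * k%:R) * (s ^+ 2 * q) = M / (2 * s2) * q by rewrite -ss mulrA.
  rewrite ssE xE.
  have : M / (2 * s2) * (\sum_(j < k) @net_vector R _ _ i j ^+ 2) <= M / (2 * s2) * (1 + 3 * k%:R / N%:R).
    by rewrite ler_pM2l// divr_gt0// mulr_gt0.
  have -> : M / (2 * s2) * (1 + 3 * k%:R / N%:R) = M / s2 * (1 - k%:R / N%:R) - M / (2 * s2)
    + 5 / 2 * (M / s2) * k%:R / N%:R by field; rewrite !gt_eqF.
  lra.
apply: (@le_trans _ _ (\sum_(i : I) V)).
  by rewrite [leRHS](bigID good)/= lerDl sumr_ge0// => i _; exact: expR_ge0.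
rewrite sumr_const (_ : V *+ _ = #|I|%:R * V); last by rewrite -[LHS]mulr_natl.
apply: le_trans (ler_wpM2r (expR_ge0 _) cst) _.
rewrite -expRD ler_expR.
by rewrite le_eqVlt; apply/orP; left; apply/eqP; field; rewrite !gt_eqF.
Unshelve. all: by end_near. Qed.

Definition incr_near k n (y : nat -> R) (eta : R) w : bool :=
  [forall j : 'I_k, `|xi k n j w - y j| <= eta].

Lemma measurable_incr_near k n y (eta : R) : measurable [set w | incr_near k n y eta w].
Proof.
have -> : [set w | incr_near k n y eta w] =
    \bigcap_(j in [set: 'I_k]) [set w | (`|xi k n j w - y j| <= eta)%R].
  apply/seteqP; split => [w /forallP h j _|w h]; first exact: h.
  by apply/forallP => j; exact: h.
apply: fin_bigcap_measurable => // j _.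
have [m _] := bmeas_norm (bmeasB (bmeas_walk_incr k n j) (bmeas_cst _ (y j))).
by rewrite -[X in measurable X]setTI; apply: measurable_fun_le => //; exact: measurable_cst.
Qed.

Lemma sum_sqr_perturb k (lam : nat -> R) (s : R) (i : 'I_k) :
  \sum_(j < k) (lam j + s * (j == i :> nat)%:R) ^+ 2 =
  \sum_(j < k) lam j ^+ 2 + 2 * s * lam i + s ^+ 2.
Proof.
rewrite (bigD1 i)//= [in RHS](bigD1 i)//= eqxx mulr1.
rewrite (eq_bigr (fun j : 'I_k => lam j ^+ 2)); first by ring.
by move=> j /negbTE ji; rewrite (_ : (_ == _) = false) ?mulr0 ?addr0.
Qed.

Lemma sum_perturb k (lam x : nat -> R) (s : R) (i : 'I_k) :
  \sum_(j < k) (lam j + s * (j == i :> nat)%:R) * x j =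
  \sum_(j < k) lam j * x j + s * x i.
Proof.
rewrite (bigD1 i)//= [in RHS](bigD1 i)//= eqxx mulr1.
rewrite (eq_bigr (fun j : 'I_k => lam j * x j)); first by ring.
by move=> j /negbTE ji; rewrite (_ : (_ == _) = false) ?mulr0 ?addr0.
Qed.

Let bexp k n (lam : nat -> R) : bmeas (fun w => expR (tilt k n lam w)).
Proof. by apply: bmeas_exp; exact: (bmeas_tilt). Qed.

(** Perturbing lam_i by s or - s and using Markov's inequality costs
    s2 s^2 / (2 k) - s eta in the exponent, which is minimal at s = k eta / s2. *)
Lemma tilted_exit k (y : nat -> R) (eta e : R) : (0 < k)%N -> 0 < s2 -> 0 < eta -> 0 < e ->
  let lam j := k%:R * y j / s2 in
  let H := k%:R / (2 * s2) * \sum_(j < k) y j ^+ 2 in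
  forall i : 'I_k, \forall n \near \oo,
    E (fun w => expR (tilt k n lam w) * (eta <= `|xi k n i w - y i|)%R%:R) <=
    2 * expR ((H - k%:R * eta ^+ 2 / (2 * s2) + e) / a n).
Proof.
move=> k0 s2p eta0 e0 lam H i; have kp : 0 < k%:R :> R by rewrite ltr0n.
pose s := k%:R * eta / s2.
have HE : s2 / (2 * k%:R) * (\sum_(j < k) lam j ^+ 2) = H.
  rewrite /H; have -> : \sum_(j < k) lam j ^+ 2 = (k%:R / s2) ^+ 2 * \sum_(j < k) y j ^+ 2.
    by rewrite mulr_sumr; apply: eq_bigr => j _; rewrite /lam; field; rewrite gt_eqF.
  by rewrite mulrA; congr (_ * _); field; rewrite !gt_eqF.
pose p (v : R) (j : nat) := lam j + v * (j == i :> nat)%:R.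
near=> n.
have n0 : (0 < n)%N by near: n; exact: nbhs_infty_gt.
have an0 := a0 n.
have [_ J1] : expR ((s2 / (2 * k%:R) * (\sum_(j < k) p s j ^+ 2) - e) / a n) <=
      E (fun w => expR (tilt k n (p s) w)) /\
    E (fun w => expR (tilt k n (p s) w)) <=
      expR ((s2 / (2 * k%:R) * (\sum_(j < k) p s j ^+ 2) + e) / a n).
  by near: n; exact: laplace_joint.
have [_ J2] : expR ((s2 / (2 * k%:R) * (\sum_(j < k) p (- s) j ^+ 2) - e) / a n) <=
      E (fun w => expR (tilt k n (p (- s)) w)) /\
    E (fun w => expR (tilt k n (p (- s)) w)) <=
      expR ((s2 / (2 * k%:R) * (\sum_(j < k) p (- s) j ^+ 2) + e) / a n).
  by near: n; exact: laplace_joint.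
have tp v w : tilt k n (p v) w = tilt k n lam w + v * xi k n i w / a n.
  by rewrite !tilt_incr// (sum_perturb lam (fun j => xi k n j w) v i) mulrDl.
apply: (@le_trans _ _ (E (fun w => expR (- ((s * y i + s * eta) / a n)) * expR (tilt k n (p s) w)
    + expR (- ((- s * y i + s * eta) / a n)) * expR (tilt k n (p (- s)) w)))).
  apply: le_Ex => [||w].
  - apply: bmeasM; first exact: bexp.
    by apply: bmeas_ge; apply: bmeas_norm; apply: bmeasB; [exact: bmeas_walk_incr|exact: bmeas_cst].
  - by apply: bmeasD; apply: bmeasZ; exact: bexp.
  have s0 : 0 <= s / a n by rewrite !divr_ge0// ?mulr_ge0// ltW.
  case: (boolP (eta <= _)) => [h|_]; last by rewrite mulr0 addr_ge0// mulr_ge0// expR_ge0.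
  rewrite mulr1 -!expRD !tp.
  move: h; rewrite ler_normr => /orP[h|h].
    apply: (@le_trans _ _ (expR (- ((s * y i + s * eta) / a n) +
      (tilt k n lam w + s * xi k n i w / a n)))); last by rewrite lerDl expR_ge0.
    rewrite ler_expR.
    rewrite [leRHS](_ : _ = tilt k n lam w + s / a n * (xi k n i w - y i - eta)); last by ring.
    by rewrite lerDl mulr_ge0// subr_ge0.
  apply: (@le_trans _ _ (expR (- ((- s * y i + s * eta) / a n) +
      (tilt k n lam w + - s * xi k n i w / a n)))); last by rewrite lerDr expR_ge0.
  rewrite ler_expR.
  rewrite [leRHS](_ : _ = tilt k n lam w + s / a n * (- (xi k n i w - y i) - eta)); last by ring.
  by rewrite lerDl mulr_ge0// subr_ge0.
rewrite ExD; [|by apply: bmeasZ; exact: bexp..].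
rewrite !ExZ; [|exact: bexp..].
rewrite (_ : 2 * expR _ = expR ((H - k%:R * eta ^+ 2 / (2 * s2) + e) / a n) + expR ((H - k%:R * eta ^+ 2 / (2 * s2) + e) / a n)); last by ring.
have key v : v ^+ 2 = s ^+ 2 -> - ((v * y i + s * eta) / a n) + (s2 / (2 * k%:R) * (\sum_(j < k) p v j ^+ 2) + e) / a n =
    (H - k%:R * eta ^+ 2 / (2 * s2) + e) / a n.
  move=> v2; rewrite (sum_sqr_perturb lam v i) -mulNr -mulrDl; congr (_ / _).
  rewrite !mulrDr HE v2 /lam /s; field; rewrite !gt_eqF//.
apply: lerD.
- by apply: (le_trans (ler_wpM2l (expR_ge0 _) J1)); rewrite -expRD key.
- by apply: (le_trans (ler_wpM2l (expR_ge0 _) J2)); rewrite -expRD key// sqrrN.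
Unshelve. all: by end_near. Qed.

(** Under the tilted law the increments concentrate at y, by [tilted_exit]. Near y the
    density is almost its value at y, so the untilted probability is the total mass
    exp (H / a_n) over exp (2 H / a_n). *)
Lemma incr_near_lower k (y : nat -> R) (eta0 e : R) : (0 < k)%N -> 0 < s2 -> 0 < eta0 -> 0 < e ->
  \forall n \near \oo, expR (- ((k%:R / (2 * s2) * (\sum_(j < k) y j ^+ 2) + e) / a n)) <=
    E (fun w => (incr_near k n y eta0 w)%:R).
Proof.
move=> k0 s2p eta00 e0; have kp : 0 < k%:R :> R by rewrite ltr0n.
pose lam j := k%:R * y j / s2.
pose H := k%:R / (2 * s2) * \sum_(j < k) y j ^+ 2.
pose La := \sum_(j < k) `|lam j| + 1.
have La0 : 0 < La by rewrite ltr_wpDl// sumr_ge0.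
(* On the event with eta in place of eta0, the exponent of the density differs from
   its value at y by at most eta La <= e / 2. *)
pose eta := Num.min eta0 (e / (2 * La)).
have eta1 : 0 < eta by rewrite lt_min eta00 divr_gt0// mulr_gt0.
have eta2 : eta <= eta0 by rewrite ge_min lexx.
have eta3 : eta * La <= e / 2.
  rewrite -ler_pdivlMr// (_ : e / 2 / La = e / (2 * La)); last by field; rewrite gt_eqF.
  by rewrite ge_min lexx orbT.
pose q := k%:R * eta ^+ 2 / (2 * s2).
have q0 : 0 < q by rewrite divr_gt0 ?mulr_gt0 ?exprn_gt0.
pose e1 := Num.min (q / 4) (e / 4).
have e10 : 0 < e1 by rewrite lt_min; apply/andP; split; apply: divr_gt0.
have e1q : e1 <= q / 4 by rewrite ge_min lexx.
have e1e : e1 <= e / 4 by rewrite ge_min lexx orbT.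
have HE : s2 / (2 * k%:R) * (\sum_(j < k) lam j ^+ 2) = H.
  rewrite /H; have -> : \sum_(j < k) lam j ^+ 2 = (k%:R / s2) ^+ 2 * \sum_(j < k) y j ^+ 2.
    by rewrite mulr_sumr; apply: eq_bigr => j _; rewrite /lam; field; rewrite gt_eqF.
  by rewrite mulrA; congr (_ * _); field; rewrite !gt_eqF.
near=> n.
have n0 : (0 < n)%N by near: n; exact: nbhs_infty_gt.
have an0 := a0 n.
have [J _] : expR ((s2 / (2 * k%:R) * (\sum_(j < k) lam j ^+ 2) - e1) / a n) <=
      E (fun w => expR (tilt k n lam w)) /\
    E (fun w => expR (tilt k n lam w)) <=
      expR ((s2 / (2 * k%:R) * (\sum_(j < k) lam j ^+ 2) + e1) / a n).
  by near: n; exact: laplace_joint.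
rewrite HE in J.
have ex (i : 'I_k) : E (fun w => expR (tilt k n lam w) * (eta <= `|xi k n i w - y i|)%R%:R) <=
    2 * expR ((H - q + e1) / a n).
  move: i; near: n.
  apply: (@filter_forall _ _ (fun (i : 'I_k) n => E (fun w => expR (tilt k n lam w) * (eta <= `|xi k n i w - y i|)%R%:R) <=
    2 * expR ((H - q + e1) / a n)) _ _) => i.
  exact: tilted_exit.
have cst : (4 * k)%:R <= expR (2 * e1 / a n) by near: n; apply: nat_absorbed; rewrite mulr_gt0.
have cst2 : 2%:R <= expR (e1 / a n) by near: n; exact: nat_absorbed.
pose W w := expR (tilt k n lam w).
have bW : bmeas W by exact: bexp.
have bb (i : 'I_k) : bmeas (fun w => (eta <= `|xi k n i w - y i|)%R%:R : R).
  by apply: bmeas_ge; apply: bmeas_norm; apply: bmeasB; [exact: bmeas_walk_incr|exact: bmeas_cst].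
have bnear : bmeas (fun w => (incr_near k n y eta0 w)%:R : R).
  by apply: bmeas_bool; exact: measurable_incr_near.
pose B := expR ((2 * H + e / 2) / a n).
have pt w : W w <= B * (incr_near k n y eta0 w)%:R + \sum_(i < k) W w * (eta <= `|xi k n i w - y i|)%R%:R.
  have s0 : 0 <= \sum_(i < k) W w * (eta <= `|xi k n i w - y i|)%R%:R.
    by apply: sumr_ge0 => i _; rewrite mulr_ge0// expR_ge0.
  case: (boolP (incr_near k n y eta w)) => [/forallP h|].
    have -> : incr_near k n y eta0 w by apply/forallP => j; exact: le_trans (h j) eta2.
    rewrite mulr1 (@le_trans _ _ B) ?lerDl//.
    rewrite ler_expR tilt_incr// ler_pM2r ?invr_gt0//.
    have -> : 2 * H = \sum_(j < k) lam j * y j.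
      rewrite /H mulrA mulr_sumr; apply: eq_bigr => j _; rewrite /lam; field; rewrite gt_eqF//.
    rewrite -lerBlDl -sumrB (le_trans _ eta3)//.
    apply: (@le_trans _ _ (\sum_(j < k) eta * `|lam j|)).
      apply: ler_sum => j _; rewrite -mulrBr (le_trans (ler_norm _))// normrM mulrC ler_wpM2r//.
    by rewrite -mulr_sumr ler_pM2l// lerDl.
  rewrite negb_forall => /existsP[i]; rewrite -ltNge => /ltW h.
  apply: (@le_trans _ _ (\sum_(i < k) W w * (eta <= `|xi k n i w - y i|)%R%:R)); last first.
    by rewrite lerDr mulr_ge0// expR_ge0.
  by rewrite (bigD1 i)//= h mulr1 lerDl; apply: sumr_ge0 => j _; rewrite mulr_ge0// expR_ge0.
have : E W <= E (fun w => B * (incr_near k n y eta0 w)%:R + \sum_(i < k) W w * (eta <= `|xi k n i w - y i|)%R%:R).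
  apply: le_Ex => //; apply: bmeasD; first exact: bmeasZ.
  by apply: bmeas_sum => i _; exact: bmeasM.
rewrite ExD; [|exact: bmeasZ|by apply: bmeas_sum => i _; exact: bmeasM].
rewrite ExZ// Ex_sum; last by move=> i _; exact: bmeasM.
set p := E (fun w => (incr_near k n y eta0 w)%:R).
move=> h1.
have h2 : \sum_(i < k) E (fun w => W w * (eta <= `|xi k n i w - y i|)%R%:R) <= expR ((H - e1) / a n) / 2.
  apply: (@le_trans _ _ (\sum_(i < k) 2 * expR ((H - q + e1) / a n))).
    by apply: ler_sum => i _; exact: ex.
  rewrite sumr_const card_ord (_ : _ *+ k = (4 * k)%:R * expR ((H - q + e1) / a n) / 2); last first.
    by rewrite -[LHS]mulr_natl natrM; field.
  rewrite ler_pM2r ?invr_gt0//.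
  apply: (le_trans (ler_wpM2r (expR_ge0 _) cst)).
  rewrite -expRD ler_expR -mulrDl ler_pM2r ?invr_gt0//; lra.
have h3 : expR ((H - e1) / a n) / 2 <= B * p by move: h1 h2 J; rewrite -/W; lra.
have h4 : expR ((H - e1) / a n) <= B * p * expR (e1 / a n).
  have : expR ((H - e1) / a n) <= 2 * (B * p) by move: h3; lra.
  move=> h; apply: (le_trans h); rewrite mulrC ler_wpM2l//.
  by rewrite mulr_ge0 ?expR_ge0// Ex_ge0// => w; rewrite ler0n.
rewrite -(ler_pM2l (expR_gt0 ((2 * H + e / 2) / a n + e1 / a n))) expRD -/B.
apply: (@le_trans _ _ (expR ((H - e1) / a n))); last by rewrite mulrAC.
rewrite -!expRD ler_expR -mulNr -!mulrDl ler_pM2r ?invr_gt0// -/H; lra.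
Unshelve. all: by end_near. Qed.

(** * The path in the Skorohod space *)

Definition walk_path n w : skorohod R :=
  skorohod_scale (Num.sqrt (a n)) (partial_sum_process n (fun i => Y (iter i T w))).

Lemma walk_pathE n w t : 0 <= t <= 1 ->
  walk_path n w t = sc n * S (Num.truncn (n%:R * t)) w.
Proof.
move=> t01; rewrite /walk_path /= /partial_sum_path in_itv/= t01.
by rewrite mulrA.
Qed.

Lemma walk_path0 n w : walk_path n w 0 = 0.
Proof. by rewrite walk_pathE ?lexx ?ler01// mulr0 truncn0 psum0 mulr0. Qed.

Lemma truncn_grid k n j : (0 < k)%N -> Num.truncn (n%:R * (j%:R / k%:R) : R) = g k n j.
Proof.
move=> k0; have kp : 0 < k%:R :> R by rewrite ltr0n.
apply: truncn_def; rewrite mulrA ler_pdivlMr// ltr_pdivrMr// -!natrM ler_nat ltr_nat.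
by rewrite /grid_index leq_trunc_div ltn_ceil.
Qed.

Lemma walk_path_grid k n w j : (0 < k)%N -> (j <= k)%N ->
  walk_path n w (j%:R / k%:R) = sc n * S (g k n j) w.
Proof.
move=> k0 jk; rewrite walk_pathE ?truncn_grid//.
by rewrite divr_ge0//= ler_pdivrMr ?ltr0n// mul1r ler_nat.
Qed.

Lemma grid_incr_walk k n w (j : 'I_k) : grid_incr k (walk_path n w) j = xi k n j w.
Proof.
have k0 : (0 < k)%N by case: k j => [[]|].
by rewrite /grid_incr !walk_path_grid// ?(ltnW (ltn_ord j))// /walk_incr mulrBr.
Qed.

Lemma walk_path_cell k n (x : R) w : (0 < n)%N -> ~~ walk_osc k n x w ->
  forall (j : 'I_k) (t : R), j%:R / k%:R <= t <= j.+1%:R / k%:R ->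
  `|walk_path n w t - walk_path n w (j%:R / k%:R)| <= x.
Proof.
move=> n0 Hosc j t /andP[t1 t2].
have k0 : (0 < k)%N by case: k j Hosc t1 t2 => [[]|].
have kp : 0 < k%:R :> R by rewrite ltr0n.
have t0 : 0 <= t by rewrite (le_trans _ t1)// divr_ge0.
have t1' : t <= 1.
  by rewrite (le_trans t2)// ler_pdivrMr// mul1r ler_nat.
rewrite walk_path_grid ?(ltnW (ltn_ord j))// walk_pathE ?t0//.
set i := Num.truncn _.
have i1 : (g k n j <= i)%N by rewrite -truncn_grid// le_truncn// ler_wpM2l.
have i2 : (i <= g k n j.+1)%N by rewrite -truncn_grid// le_truncn// ler_wpM2l.
rewrite -{1}(subnKC i1) psumD -mulrBr addrC addKr.
have sp : 0 < sc n by exact: scale_n_gt0.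
rewrite normrM gtr0_norm// mulrC -ler_pdivlMr//.
rewrite leNgt; apply: contra Hosc => h.
apply/existsP; exists j; apply/hitP; exists (i - g k n j)%N; last exact: ltW.
by rewrite leq_sub2r.
Qed.

Local Notation Z := walk_path.

(** The path in the level set is the polygon of the increments of the walk. When
    s2 = 0 the level set is reduced to 0. *)
Lemma walk_exponential_upper (L delta e : R) : 0 < L -> 0 < delta -> 0 < e ->
  \forall n \near \oo, exists bad : Omega -> bool,
    [/\ measurable [set w | bad w], E (fun w => (bad w)%:R) <= expR (- ((L - e) / a n)) &
    forall w, ~~ bad w -> exists2 x : skorohod R, energy_bound x (2 * s2 * L) & ball x delta (Z n w)].
Proof.
move=> L0 d0 e0; pose del := delta / 4.
have del0 : 0 < del by rewrite divr_gt0.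
have [K1 HK1] := osc_negligible del0 (ltW L0).
have dd : 2 * del < delta by rewrite /del; lra.
move: s20; rewrite le_eqVlt => /orP[/eqP s2E|s2p].
  have := HK1 1%N isT _; rewrite -s2E mul0r => /(_ ler01) H.
  near=> n.
  have n0 : (0 < n)%N by near: n; exact: nbhs_infty_gt.
  exists (walk_osc 1 n del); split; first exact: measurable_walk_osc.
    apply: (@le_trans _ _ (expR (- (L / a n)))); first by near: n.
    by rewrite ler_expR lerN2 ler_pM2r ?invr_gt0// gerBl ltW.
  move=> w osc.
  have [x xE] := @energy_skorohod R _ _ (@polygon_energy R 0 (fun=> 0)).
  exists x.
    apply: (@energy_bound_ext _ (@polygon R 0 (fun=> 0))); first by move=> t t01; rewrite xE.
    by have := @polygon_energy R 0 (fun=> 0); rewrite big_ord0 !mulr0 mul0r.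
  apply: (sup_ball (r := del)); first by move: dd del0; lra.
  move=> t t01; rewrite xE// /polygon big_ord0.
  have := walk_path_cell n0 osc (j := ord0) (t := t).
  by rewrite !divr1 t01 walk_path0 subr0 sub0r normrN; apply.
pose k := (Num.truncn (s2 * K1)).+1.
have Kk : s2 * K1 <= k%:R by exact/ltW/truncnS_gt.
have HO := HK1 k isT Kk.
have e4 : 0 < e / 2 by rewrite divr_gt0.
have M0 : 0 < 2 * s2 * L by rewrite !mulr_gt0.
have HT := @incr_energy_tail k (2 * s2 * L) (e / 2) isT s2p M0 e4.
near=> n.
have n0 : (0 < n)%N by near: n; exact: nbhs_infty_gt.
have HTn : E (fun w => (2 * s2 * L < k%:R * \sum_(j < k) walk_incr k n j w ^+ 2)%R%:R) <=
    expR (- ((2 * s2 * L / (2 * s2) - e / 2) / a n)) by near: n; exact: HT.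
pose en w := (2 * s2 * L < k%:R * \sum_(j < k) walk_incr k n j w ^+ 2).
have men : measurable [set w | en w].
  have [m _] : bmeas (fun w => - (k%:R * \sum_(j < k) walk_incr k n j w ^+ 2)).
    apply: bmeasN; apply: bmeasZ; apply: bmeas_sum => j _; apply: bmeasX.
    exact: (bmeas_walk_incr).
  have -> : [set w | en w] = ~` [set w | (- (2 * s2 * L) <= - (k%:R * \sum_(j < k) walk_incr k n j w ^+ 2))%R].
    by apply/seteqP; split => w /=; rewrite /en lerN2 ltNge => /negP.
  apply: measurableC; rewrite -[X in measurable X]setTI.
  by apply: measurable_fun_le => //; exact: measurable_cst.
have an0 := a0 n.
have mU : measurable [set w | walk_osc k n del w || en w].
  have -> : [set w | walk_osc k n del w || en w] = [set w | walk_osc k n del w] `|` [set w | en w].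
    by apply/seteqP; split => w /=; [move=> /orP|move=> h; apply/orP].
  by apply: measurableU => //; exact: measurable_walk_osc.
exists (fun w => walk_osc k n del w || en w); split.
- exact: mU.
- apply: (@le_trans _ _ (E (fun w => (walk_osc k n del w)%:R + (en w)%:R))).
    apply: le_Ex; first exact: bmeas_bool.
      by apply: bmeasD; apply: bmeas_bool => //; exact: measurable_walk_osc.
    by move=> w; case: (walk_osc _ _ _ _); case: (en w) => /=; lra.
  rewrite ExD; [|apply: bmeas_bool; exact: measurable_walk_osc|exact: bmeas_bool].
  have h1 : E (fun w => (walk_osc k n del w)%:R) <= expR (- ((L - e / 2) / a n)).
    apply: (@le_trans _ _ (expR (- (L / a n)))); first by near: n.
    by rewrite ler_expR lerN2 ler_pM2r ?invr_gt0// gerBl ltW.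
  have h2 : E (fun w => (en w)%:R) <= expR (- ((L - e / 2) / a n)).
    have -> : L - e / 2 = 2 * s2 * L / (2 * s2) - e / 2 by congr (_ - _); field; rewrite gt_eqF.
    exact: HTn.
  apply: (le_trans (lerD h1 h2)).
  have cst : 2%:R <= expR (e / 2 / a n) by near: n; exact: nat_absorbed.
  rewrite (_ : _ + _ = 2%:R * expR (- ((L - e / 2) / a n))); last by ring.
  apply: (le_trans (ler_wpM2r (expR_ge0 _) cst)); rewrite -expRD ler_expR.
  by rewrite le_eqVlt; apply/orP; left; apply/eqP; field; rewrite gt_eqF.
move=> w; rewrite negb_or => /andP[osc nen].
pose p := polygon k (grid_incr k (walk_path n w)).
have pe : energy_bound p (2 * s2 * L).
  have [p0 [F hF [FM HF]]] := polygon_energy k (grid_incr k (walk_path n w)).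
  split => //; exists F => //; split => //; apply: (le_trans FM).
  move: nen; rewrite /en -leNgt; apply: le_trans.
  by rewrite le_eqVlt; apply/orP; left; apply/eqP; congr (_ * _); apply: eq_bigr => j _; rewrite grid_incr_walk.
have [x xE] := energy_skorohod pe.
exists x; first by apply: energy_bound_ext pe => t t01; rewrite xE.
apply: (sup_ball dd) => t t01; rewrite xE// distrC.
apply: polygon_close => //; first exact: walk_path0.
exact: walk_path_cell.
Unshelve. all: by end_near. Qed.

Lemma sum_walk_incr k n w j : (0 < k)%N -> (j <= k)%N ->
  \sum_(i < j) walk_incr k n i w = Z n w (j%:R / k%:R).
Proof.
move=> k0 jk; rewrite -(sum_grid_incr k j (walk_path0 n w)).
apply: eq_bigr => i _.
exact: esym (grid_incr_walk n w (Ordinal (leq_trans (ltn_ord i) jk))).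
Qed.

(** Sum the defining inequality of the energy over the cells. *)
Lemma grid_incr_energy k (h : R -> R) (M : R) : (0 < k)%N -> energy_bound h M ->
  k%:R * \sum_(j < k) grid_incr k h j ^+ 2 <= M.
Proof.
move=> k0 [_ [F hF [FM HF]]]; have kp : 0 < k%:R :> R by rewrite ltr0n.
have H (j : 'I_k) : k%:R * grid_incr k h j ^+ 2 <= F (j.+1%:R / k%:R) - F (j%:R / k%:R).
  have s0 : 0 <= j%:R / k%:R :> R by rewrite divr_ge0.
  have st : j%:R / k%:R <= j.+1%:R / k%:R :> R by rewrite ler_pM2r ?invr_gt0// ler_nat.
  have t1 : j.+1%:R / k%:R <= 1 :> R by rewrite ler_pdivrMr// mul1r ler_nat.
  have := HF _ _ s0 st t1.
  have -> : j.+1%:R / k%:R - j%:R / k%:R = k%:R^-1 :> R.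
    by rewrite -mulrBl -natr1 addrAC subrr add0r mul1r.
  by rewrite ler_pdivlMl.
apply: le_trans FM; rewrite mulr_sumr.
apply: (@le_trans _ _ (\sum_(j < k) (F (j.+1%:R / k%:R) - F (j%:R / k%:R)))).
  by apply: ler_sum => j _; exact: H.
rewrite -(big_mkord xpredT (fun j => F (j.+1%:R / k%:R) - F (j%:R / k%:R))).
rewrite (@telescope_sumr_eq _ _ _ (fun j => F (j%:R / k%:R)))//.
by rewrite mul0r divff// gt_eqF.
Qed.

(** It is enough that the increments be close to those of x and that the oscillation
    of the walk be small, since x itself oscillates little on a fine grid. *)
Lemma walk_exponential_lower (x : skorohod R) (r delta e : R) : 0 <= r ->
  energy_bound x (2 * s2 * r) -> 0 < delta -> 0 < e ->
  \forall n \near \oo, exists good : Omega -> bool,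
    [/\ measurable [set w | good w], expR (- ((r + e) / a n)) <= E (fun w => (good w)%:R) &
    forall w, good w -> ball x delta (Z n w)].
Proof.
move=> r0 ex d0 e0; pose del := delta / 4.
have del0 : 0 < del by rewrite divr_gt0.
have L0 : 0 <= r + e / 2 + 1 by rewrite !addr_ge0// divr_ge0// ltW.
have [K1 HK1] := osc_negligible del0 L0.
move: s20; rewrite le_eqVlt => /orP[/eqP s2E|s2p].
  have := HK1 1%N isT _; rewrite -s2E mul0r => /(_ ler01) H.
  near=> n.
  have n0 : (0 < n)%N by near: n; exact: nbhs_infty_gt.
  have an0 := a0 n.
  have H' : E (fun w => (walk_osc 1 n del w)%:R) <= expR (- ((r + e / 2 + 1) / a n)) by near: n.
  have c1 : 2%:R <= expR (1 / a n) by near: n; exact: nat_absorbed.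
  have c2 : 2%:R <= expR (e / a n) by near: n; exact: nat_absorbed.
  have half (y z : R) : 2%:R <= expR (z / a n) -> z <= y -> expR (- (y / a n)) <= 1 / 2.
    move=> hz zy; rewrite expRN div1r lef_pV2 ?posrE ?expR_gt0// (le_trans hz)// ler_expR.
    by rewrite ler_pM2r ?invr_gt0.
  exists (fun w => ~~ walk_osc 1 n del w).
  have mN : measurable [set w | ~~ walk_osc 1 n del w].
    have -> : [set w | ~~ walk_osc 1 n del w] = ~` [set w | walk_osc 1 n del w].
      by apply/seteqP; split => w /= /negP.
    by apply: measurableC; exact: measurable_walk_osc.
  split => //.
    have -> : E (fun w => (~~ walk_osc 1 n del w)%:R) = 1 - E (fun w => (walk_osc 1 n del w)%:R).
      rewrite -[X in X - _](Ex_cst P 1) -ExB; [|exact: bmeas_cst|apply: bmeas_bool; exact: measurable_walk_osc].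
      by congr Ex; apply/funext => w; case: walk_osc; rewrite /= ?subrr ?subr0.
    have v1 : expR (- ((r + e / 2 + 1) / a n)) <= 1 / 2.
      by apply: (half _ 1) => //; have := e0; have := r0; lra.
    have v2 : expR (- ((r + e) / a n)) <= 1 / 2.
      by apply: (half _ e) => //; have := e0; have := r0; lra.
    by move: H' v1 v2; lra.
  move=> w osc; apply: (sup_ball (r := del)); first by rewrite /del; lra.
  move=> t t01; have x0 : x t = 0.
    case/andP: t01 => t0 t1; have := energy_holder ex (lexx 0) t0 t1.
    rewrite -s2E !(mulr0, mul0r) ex.1 subr0 => h.
    by apply/eqP; rewrite -sqrf_eq0 eq_le sqr_ge0 andbT.
  rewrite x0 sub0r normrN.
  have := walk_path_cell n0 osc (j := ord0) (t := t).
  by rewrite !divr1 t01 walk_path0 subr0; apply.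
pose M := 2 * s2 * r.
pose k := (Num.truncn (s2 * K1) + Num.truncn (M / del ^+ 2)).+1.
have kp : 0 < k%:R :> R by rewrite ltr0n.
have Kk : s2 * K1 <= k%:R.
  by apply: (le_trans (ltW (truncnS_gt _))); rewrite ler_nat /k ltnS leq_addr.
have Mk : M <= del ^+ 2 * k%:R.
  rewrite mulrC -ler_pdivrMr ?exprn_gt0//.
  by apply: (le_trans (ltW (truncnS_gt _))); rewrite ler_nat /k ltnS leq_addl.
have HO := HK1 k isT Kk.
pose eta := del / k%:R.
have eta0 : 0 < eta by rewrite divr_gt0.
have e2 : 0 < e / 4 by rewrite divr_gt0.
pose y := grid_incr k x.
have HL := @incr_near_lower k y eta (e / 4) isT s2p eta0 e2.
have yE : k%:R / (2 * s2) * (\sum_(j < k) y j ^+ 2) <= r.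
  have := @grid_incr_energy k x M isT ex; rewrite -/y /M => h.
  rewrite mulrAC ler_pdivrMr ?mulr_gt0//; move: h; lra.
near=> n.
have n0 : (0 < n)%N by near: n; exact: nbhs_infty_gt.
have an0 := a0 n.
have h1 : expR (- ((k%:R / (2 * s2) * (\sum_(j < k) y j ^+ 2) + e / 4) / a n)) <=
    E (fun w => (incr_near k n y eta w)%:R) by near: n; exact: HL.
have h2 : E (fun w => (walk_osc k n del w)%:R) <= expR (- ((r + e / 2 + 1) / a n)) by near: n; exact: HO.
have c1 : 2%:R <= expR (1 / a n) by near: n; exact: nat_absorbed.
have c2 : 2%:R <= expR (e / 2 / a n).
  by near: n; apply: nat_absorbed; rewrite divr_gt0.
have mnear : measurable [set w | incr_near k n y eta w].
  exact: (measurable_incr_near).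
have bo : bmeas (fun w => (walk_osc k n del w)%:R : R) by apply: bmeas_bool; exact: measurable_walk_osc.
have bn : bmeas (fun w => (incr_near k n y eta w)%:R : R) by exact: bmeas_bool.
pose good w := incr_near k n y eta w && ~~ walk_osc k n del w.
have mg : measurable [set w | good w].
  have -> : [set w | good w] = [set w | incr_near k n y eta w] `\` [set w | walk_osc k n del w].
    by apply/seteqP; split => w /=; [move=> /andP[? /negP]|move=> [? /negP ?]; apply/andP].
  by apply: measurableD => //; exact: measurable_walk_osc.
exists good; split => //.
- have h3 : E (fun w => (incr_near k n y eta w)%:R - (walk_osc k n del w)%:R) <= E (fun w => (good w)%:R).
    apply: le_Ex; [exact: bmeasB|exact: bmeas_bool|move=> w].
    by rewrite /good; case: incr_near; case: walk_osc => /=; lra.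
  rewrite ExB// in h3.
  pose A := expR (- ((r + e / 2) / a n)).
  have h4 : A <= E (fun w => (incr_near k n y eta w)%:R).
    apply: le_trans h1; rewrite ler_expR lerN2 ler_pM2r ?invr_gt0//.
    by have := yE; have := e0; lra.
  have h5 : expR (- ((r + e / 2 + 1) / a n)) <= A / 2.
    rewrite mulrDl opprD expRD ler_wpM2l ?expR_ge0// expRN lef_pV2 ?posrE ?expR_gt0//.
  have h6 : expR (- ((r + e) / a n)) <= A / 2.
    have -> : r + e = r + e / 2 + e / 2 by lra.
    by rewrite mulrDl opprD expRD ler_wpM2l ?expR_ge0// expRN lef_pV2 ?posrE ?expR_gt0.
  by move: h2 h3 h4 h5 h6; lra.
move=> w /andP[/forallP nr osc].
apply: (sup_ball (r := 3 * del)); first by rewrite /del; lra.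
move=> t t01; have [j jt] := @grid_cell R k t t01 isT.
have hz := walk_path_cell n0 osc jt.
have jk : (j <= k)%N by exact: ltnW.
have s0 : 0 <= j%:R / k%:R :> R by rewrite divr_ge0.
have hx : `|x t - x (j%:R / k%:R)| <= del.
  case/andP: t01 jt => t0 t1 /andP[j1 j2].
  apply: norm_le_sqr; first exact: ltW.
  apply: le_trans (energy_holder ex s0 j1 t1) _.
  apply: (@le_trans _ _ (M * k%:R^-1)); last by rewrite ler_pdivrMr.
  apply: ler_wpM2l; first by rewrite !mulr_ge0.
  rewrite lerBlDl (le_trans j2)// -natr1 mulrDl mul1r//.
have hg : `|x (j%:R / k%:R) - Z n w (j%:R / k%:R)| <= del.
  rewrite -sum_walk_incr//; have x0 : x 0 = 0 by case: ex.
  rewrite -(sum_grid_incr k j x0) -sumrB.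
  apply: le_trans (ler_norm_sum _ _ _) _.
  apply: (@le_trans _ _ (\sum_(i < j) eta)).
    apply: ler_sum => i _; rewrite distrC.
    exact: (nr (Ordinal (leq_trans (ltn_ord i) jk))).
  rewrite sumr_const card_ord -[leLHS]mulr_natl.
  rewrite /eta mulrA ler_pdivrMr// mulrC ler_pM2l// ler_nat//.
have -> : x t - Z n w t = (x t - x (j%:R / k%:R)) + (x (j%:R / k%:R) - Z n w (j%:R / k%:R))
  - (Z n w t - Z n w (j%:R / k%:R)) by ring.
apply: (le_trans (ler_normB _ _)); apply: (le_trans (lerD (ler_normD _ _) (lexx _))).
move: hz hx hg; lra.
Unshelve. all: by end_near. Qed.

Lemma walk_path_dist n w w' (r t : R) : 0 <= scale_n n -> 0 <= t <= 1 ->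
  (forall i, (i <= n)%N -> `|S i w - S i w'| <= r) ->
  `|walk_path n w t - walk_path n w' t| <= scale_n n * r.
Proof.
move=> s0 t01 H; rewrite !walk_pathE// -mulrBr normrM ger0_norm// ler_wpM2l// H//.
have /andP[t0 t1] := t01.
apply: (@leq_trans (Num.truncn (n%:R : R))); last by rewrite natrK.
by apply: le_truncn; rewrite ler_piMr.
Qed.

Let box n (v : {ffun 'I_n.+1 -> rat} * rat) : set Omega :=
  \bigcap_(i in [set: 'I_n.+1]) [set w | (`|S i w - ratr (v.1 i)| <= ratr v.2)%R].

Let mbox n v : (forall i, measurable_fun setT (S i)) -> measurable (@box n v).
Proof.
move=> mS.
apply: fin_bigcap_measurable => // i _; rewrite -[X in measurable X]setTI.
apply: measurable_fun_le => //; apply: measurableT_comp => //.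
by apply: measurable_funB.
Qed.

(** An open event is a countable union of rational boxes for (S_0, ..., S_n), because
    the path depends on these variables continuously in the uniform distance. *)
Lemma measurable_walk_open n (U : set (skorohod R)) :
  (forall i, measurable_fun setT (S i)) -> 0 <= scale_n n -> open U ->
  measurable [set w | U (walk_path n w)].
Proof.
move=> mS s0 oU; pose F v := if `[< @box n v `<=` [set w | U (walk_path n w)] >] then @box n v else set0.
have -> : [set w | U (walk_path n w)] = \bigcup_(v in [set: {ffun 'I_n.+1 -> rat} * rat]) F v.
  apply/seteqP; split => [w Uw|w [v _]]; last by rewrite /F; case: asboolP => // vU /vU.
  have /nbhs_ballP[e /= e0 eU] : nbhs (walk_path n w) U by exact: open_nbhs_nbhs.
  pose r := e / (3 * (scale_n n + 1)).
  have r0 : 0 < r by rewrite divr_gt0// mulr_gt0// ltr_wpDl.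
  have [q /andP[q0 qr]] : exists q : rat, 0 < (ratr q : R) < r.
    by have [q] := rat_in_itvoo r0; rewrite in_itv/=; exists q.
  have near_rat (y : R) : exists p : rat, `|y - ratr p| <= ratr q.
    have [|p] := @rat_in_itvoo R (y - ratr q) (y + ratr q); first by move: q0; lra.
    rewrite in_itv/= => /andP[p1 p2]; exists p; rewrite ler_norml; apply/andP; split; lra.
  pose v : {ffun 'I_n.+1 -> rat} := [ffun i : 'I_n.+1 => xchoose (near_rat (S i w))].
  have vP (i : 'I_n.+1) : `|S i w - ratr (v i)| <= ratr q.
    by rewrite /v ffunE; have := xchooseP (near_rat (S i w)).
  exists (v, q) => //; rewrite /F; case: asboolP => [_ i _|]; first exact: vP.
  move=> nb; exfalso; apply: nb => w' Bw'; apply: (eU (walk_path n w')); apply: (sup_ball (r := scale_n n * (2 * r))).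
    have -> : e = (scale_n n + 1) * (3 * r).
      by rewrite /r; field; rewrite gt_eqF// ltr_wpDl.
    by have : 0 <= scale_n n * r; [rewrite mulr_ge0// ltW|move: r0; lra].
  move=> t t01; apply: walk_path_dist => // i ni.
  have i' : (i < n.+1)%N by rewrite ltnS.
  have := Bw' (Ordinal i') I; have := vP (Ordinal i'); rewrite /= !ler_norml.
  move=> /andP[h1 h2] /andP[h3 h4]; apply/andP; split; lra.
apply: countable_bigcupT_measurable; first exact: countableP.
by move=> v; rewrite /F; case: asboolP => _ //; exact: mbox.
Qed.

Lemma measurable_walk_event n G : (forall i, measurable_fun setT (S i)) -> 0 <= scale_n n ->
  <<s [set U : set (skorohod R) | open U] >> G ->
  measurable [set w | G (walk_path n w)].
Proof.
move=> mS s0 sG.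
have sa : sigma_algebra setT (@measurable d Omega).
  by split => [|A mA|F mF]; [exact: measurable0|exact: measurableD|exact: bigcupT_measurable].
have := smallest_sub (sigma_algebra_image (walk_path n) sa) _ sG.
rewrite /image_set_system /= setTI; apply => U oU /=.
by rewrite setTI; exact: measurable_walk_open.
Qed.

Let measurable_event n G : <<s [set U : set (skorohod R) | open U] >> G -> measurable [set w | G (Z n w)] :=
  measurable_walk_event (fun i => (bS i).1) (divr_ge0 (sqrtr_ge0 _) (sqrtr_ge0 _)).

Let prob_le (A : set Omega) (b : Omega -> bool) (y : R) : measurable A -> measurable [set w | b w] ->
  (forall w, A w -> b w) -> E (fun w => (b w)%:R) <= y -> fine (P A) <= y.
Proof.
move=> mA mb Ab; apply: le_trans; rewrite -lee_fin [(Ex _ _)%:E]Ex_bool// fineK ?fin_num_measure//.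
by apply: le_measure; rewrite ?inE.
Qed.

Let prob_ge (A : set Omega) (b : Omega -> bool) (y : R) : measurable A -> measurable [set w | b w] ->
  (forall w, b w -> A w) -> y <= E (fun w => (b w)%:R) -> y <= fine (P A).
Proof.
move=> mA mb Ab h; apply: (le_trans h); rewrite -lee_fin [(Ex _ _)%:E]Ex_bool// fineK ?fin_num_measure//.
by apply: le_measure; rewrite ?inE.
Qed.

(** For the upper bound the level set L is compact and disjoint from the closure of G,
    hence far from it; for the lower bound a ball around a path of G is contained in
    G. *)
Lemma bounded_walk_mdp (sigma : R) : s2 = sigma ^+ 2 ->
  MDP P (fun n w => partial_sum_process n (fun i => Y (iter i T w))) a (rate_function sigma).
Proof.
move=> s2E; split; first exact: rate_good.
move=> G sG u.
pose p n := fine (P [set w | G (Z n w)]).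
have uE n : u n = ((a n)%:E * lne (p n)%:E)%E.
  by rewrite /p fineK ?fin_num_measure//; exact: measurable_event.
have p0 n : 0 <= p n by rewrite fine_ge0.
split; last split.
- apply/le_ereal_real => r; rewrite lteNr => /ereal_inf_lt[_ [x Gx <-]].
  move=> Ix; have [q qr Iq] : exists2 q : R, (rate_function sigma x = q%:E) & q < - r.
    move: Ix (rate_ge0 sigma x); case: rate_function => [q| |]//; rewrite lte_fin; by exists q.
  have q0 : 0 <= q by rewrite -lee_fin -qr rate_ge0.
  have ex : energy_bound x (2 * s2 * q) by rewrite s2E; apply/rate_level => //; rewrite qr.
  have [delta /= d0 xG] : exists2 delta : R, 0 < delta & ball x delta `<=` G.
    by have /nbhs_ballP[e e0 He] := Gx; exists e.
  have e0 : 0 < - r - q by rewrite subr_gt0.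
  have [N _ HN] := walk_exponential_lower q0 ex d0 e0.
  apply: (limn_einf_ge (N := N)) => n Nn; rewrite uE.
  have [good [mg pg Hg]] := HN n Nn.
  apply: mul_lne_ge => //; apply: (@prob_ge _ good _ (@measurable_event n G sG) mg).
    by move=> w /Hg; exact: xG.
  by apply: le_trans pg; rewrite -mulNr ler_expR ler_pM2r ?invr_gt0//; lra.
- exact: limn_einf_sup.
- rewrite leeNr; apply/le_ereal_real => L LJ.
  rewrite leeNr -EFinN.
  have [L0|L0] := leP L 0.
    apply: (@le_trans _ _ 0%E); last by rewrite lee_fin oppr_ge0.
    apply: (limn_esup_le (N := 0%N)) => n _; rewrite uE; apply: mul_lne_le => //.
    rewrite mul0r expR0 -lee_fin fineK ?fin_num_measure//; last exact: measurable_event.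
    by apply: probability_le1; exact: measurable_event.
  have [|delta d0 Hd] := @compact_closed_separated R [set x | energy_bound x (2 * s2 * L)] (closure G)
    (@compact_energy R _) (@closed_closure _ _) _.
    apply/seteqP; split => x //= [ex Gx].
    have : (rate_function sigma x <= L%:E)%E by apply/rate_level; [exact: ltW|rewrite -s2E].
    apply/negP; rewrite -ltNge; apply: (lt_le_trans LJ).
    by apply: ereal_inf_lbound; exists x.
  apply: limn_esup_le_fin => e e0.
  have [N _ HN] := walk_exponential_upper L0 d0 e0.
  exists N => n Nn; rewrite uE.
  have [bad [mb pb Hb']] := HN n Nn.
  apply: mul_lne_le => //; apply: (@prob_le _ bad _ (@measurable_event n G sG) mb).
    move=> w Gw; apply: contraT => /Hb'[x ex bx]; exfalso.
    by apply: (Hd x _ ex bx); exact: subset_closure.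
  by apply: (le_trans pb); rewrite -mulNr opprB addrC.
Qed.

End conditional_walk.

(** * From conditional expectations to weighted integrals *)

Section conditional_bounds.
Context {R : realType} d (Omega : measurableType d) (P : probability Omega R).
Variable F0 : set (set Omega).
Hypothesis sF : sub_sigma_field F0.

Lemma ae_le_Lnorm (f : Omega -> \bar R) :
  \forall w \ae P, (`|f w| <= 'N[P]_+oo [f])%E.
Proof.
have -> : ('N[P]_+oo [f] = ess_sup P (abse \o f))%E.
  by rewrite unlock /= [P setT]probability_setT lte01.
exact: (ess_sup_ge P (abse \o f)).
Qed.

Lemma clamp_measurable (l u : R) d' (T' : measurableType d') (f : T' -> R) :
  measurable_fun setT f -> measurable_fun setT (fun w => clamp l u (f w)).
Proof.
move=> mf; apply: measurable_maxr; first exact: measurable_cst.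
by apply: measurable_minr => //; exact: measurable_cst.
Qed.

Lemma clamp_bmeas (l u : R) d' (T' : measurableType d') (f : T' -> R) : l <= u ->
  measurable_fun setT f -> bmeas (fun w => clamp l u (f w)).
Proof.
move=> lu mf; split; first exact: clamp_measurable.
exists (`|l| + `|u|) => w; have /andP[h1 h2] := clamp_in (f w) lu.
have := ler_norm u; have := ler_norm (- l); rewrite normrN ler_norml => h3 h4.
have := normr_ge0 u; have := normr_ge0 l => h5 h6; apply/andP; split; lra.
Qed.

Lemma F0_measurable A : F0 A -> measurable A.
Proof. by case: sF => _; exact. Qed.

(** Truncated to [l, u], the version V of the conditional expectation changes only on
    a null set and becomes bounded. *)
Lemma cond_exp_ub (W V Z : Omega -> R) (l u : R) : is_cond_exp P F0 W V ->
  measurable_fun setT W -> bmeas Z -> (\forall w \ae P, W w = Z w) -> l <= u ->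
  (\forall w \ae P, l <= V w <= u) ->
  cond_ub P F0 Z u /\ cond_ub P F0 (fun w => - Z w) (- l).
Proof.
move=> [mV _ VE] mW bZ WZ lu Vlu.
have mV' : measurable_fun setT V.
  by move=> _ B mB; apply: F0_measurable; apply: mV; exists B.
pose V' w := clamp l u (V w).
have bV' : bmeas V' by exact: clamp_bmeas.
have VV' : \forall w \ae P, V w = V' w.
  by apply: filterS Vlu => w h; rewrite /V' clamp_id.
have mS (A : set Omega) (f : Omega -> R) : measurable A -> measurable_fun setT f ->
    measurable_fun A (fun w => (f w)%:E).
  move=> mA mf; apply/measurable_EFinP; exact: measurable_funTS.
have IE A : F0 A -> (\int[P]_(w in A) (Z w)%:E = \int[P]_(w in A) (V' w)%:E)%E.
  move=> FA; have mA := F0_measurable FA.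
  transitivity (\int[P]_(w in A) (W w)%:E)%E.
    apply: ae_eq_integral => //; [exact: (mS _ _ mA bZ.1)|exact: (mS _ _ mA mW)|].
    by apply: filterS WZ => w -> _.
  rewrite -VE//; apply: ae_eq_integral => //; [exact: (mS _ _ mA mV')|exact: (mS _ _ mA bV'.1)|].
  by apply: filterS VV' => w h _; rewrite /= h.
have ExE A : F0 A -> Ex P (fun w => `[< A w >]%:R * Z w) = Ex P (fun w => `[< A w >]%:R * V' w).
  move=> FA; have mA := F0_measurable FA.
  have AE : A = [set w | `[< A w >]] by apply/seteqP; split => w /= /asboolP.
  have := IE A FA; rewrite AE !Ex_set// -?AE//; first by case.
have bA A : F0 A -> bmeas (fun w => `[< A w >]%:R : R).
  move=> FA; apply: bmeas_bool; rewrite (_ : [set w | _] = A); first exact: F0_measurable.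
  by apply/seteqP; split => w /= /asboolP.
have PA A : F0 A -> P A = (Ex P (fun w => `[< A w >]%:R))%:E.
  move=> FA; have AE : A = [set w | `[< A w >]] by apply/seteqP; split => w /= /asboolP.
  by rewrite Ex_bool -?AE//; exact: F0_measurable.
have intE A f : F0 A -> bmeas f -> (\int[P]_(w in A) (f w)%:E = (Ex P (fun w => `[< A w >]%:R * f w))%:E)%E.
  move=> FA bf; have AE : A = [set w | `[< A w >]] by apply/seteqP; split => w /= /asboolP.
  by rewrite {1}AE Ex_set// -AE; exact: F0_measurable.
split; apply: cond_ub_sets => //; try exact: bmeasN.
- move=> A FA; rewrite intE// ExE// PA// -EFinM lee_fin -ExZ; last exact: bA.
  apply: le_Ex => [||w]; [exact: bmeasM (bA _ FA) bV'|exact: bmeasZ (bA _ FA)|].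
  by rewrite mulrC ler_wpM2r//; have /andP[] := clamp_in (V w) lu.
- move=> A FA; rewrite intE//; last exact: bmeasN.
  rewrite PA// -EFinM lee_fin.
  rewrite (_ : (fun w => `[< A w >]%:R * - Z w) = fun w => - (`[< A w >]%:R * Z w)); last first.
    by apply/funext => w; rewrite mulrN.
  rewrite ExN; last exact: bmeasM (bA _ FA) bZ.
  rewrite ExE// mulNr lerN2 -ExZ; last exact: bA.
  apply: le_Ex => [||w]; [exact: bmeasZ (bA _ FA)|exact: bmeasM (bA _ FA) bV'|].
  by rewrite [leRHS]mulrC ler_wpM2r//; have /andP[] := clamp_in (V w) lu.
Qed.

End conditional_bounds.

Section preserved_null_sets.
Context {R : realType} d (Omega : measurableType d) (P : probability Omega R).
Variable T : Omega -> Omega.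
Hypothesis mT : measurable_fun setT T.
Hypothesis PT : forall A, measurable A -> P (T @^-1` A) = P A.

Lemma preserve_iter i A : measurable A -> P (iter i T @^-1` A) = P A.
Proof.
move=> mA; elim: i => [|i IH] //.
rewrite -[RHS]IH -(PT (A := iter i T @^-1` A)); last first.
  by rewrite -[X in measurable X]setTI; exact: (measurable_iter mT i).
congr (P _); apply/seteqP; split => w /=; by rewrite -iterSr.
Qed.

Lemma ae_iter (p : Omega -> Prop) : (\forall w \ae P, p w) ->
  \forall w \ae P, forall i, p (iter i T w).
Proof.
move=> [N [mN N0 pN]]; apply: ae_foralln => i.
exists (iter i T @^-1` N); split.
- by rewrite -[X in measurable X]setTI; exact: (measurable_iter mT i).
- exact: etrans (preserve_iter i mN) N0.
- by move=> w /= npw; apply: pN.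
Qed.

Lemma prob_ae_eq (A B : set Omega) : measurable A -> measurable B ->
  (\forall w \ae P, A w <-> B w) -> P A = P B.
Proof.
move=> mA mB [N [mN N0 AB]].
have le (A' B' : set Omega) : measurable A' -> measurable B' ->
    (forall w, ~ N w -> A' w -> B' w) -> (P A' <= P B')%E.
  move=> mA' mB' h; apply: (@le_trans _ _ (P (B' `|` N))).
    apply: le_measure; rewrite ?inE//; first exact: measurableU.
    by move=> w A'w; have [Nw|nNw] := pselect (N w); [right|left; exact: h].
  by rewrite -[leRHS]adde0 -N0; exact: measureU2.
have h w : ~ N w -> (A w <-> B w).
  by move=> nN; apply: contrapT => nAB; apply: nN; exact: AB.
by apply/eqP; rewrite eq_le !le// => w /h[].
Qed.

End preserved_null_sets.

Theorem theorem1 (R : realType) (d : measure_display) (Omega : measurableType d)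
    (P : probability Omega R) (T : Omega -> Omega) (F0 : set (set Omega))
    (X0 : {RV P >-> R}) (sigma : R) (ES ES2 : nat -> Omega -> R) :
  let X i := fun w => X0 (iter i T w) in
  let S n := fun w => \sum_(1 <= j < n.+1) X j w in
  let W n := fun w => partial_sum_process n (fun i => X i w) in
  bijective T ->
  measurable_fun setT T ->
  (forall A, measurable A -> measurable (T @` A)) ->
  (forall A, measurable A -> P (T @^-1` A) = P A) ->
  sub_sigma_field F0 ->
  F0 `<=` preimage_set_system setT T F0 ->
  ('N[P]_+oo [EFin \o X0] < +oo)%E ->
  ('E_P[X0] = 0)%E ->
  measurable_for F0 X0 ->
  (forall n, is_cond_exp P F0 (S n) (ES n)) ->
  (forall n, is_cond_exp P F0 (fun w => S n w ^+ 2) (ES2 n)) ->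
  (\sum_(1 <= n <oo) (n%:R `^ (- (3 / 2)))%:E * 'N[P]_+oo [EFin \o ES n] < +oo)%E ->
  0 <= sigma ->
  (fun n => 'N[P]_+oo [(fun w => (n%:R^-1 * ES2 n w - sigma ^+ 2)%:E)])%E @ \oo
    --> 0%E ->
  forall a : nat -> R,
    (forall n, 0 < a n) ->
    a n @[n --> \oo] --> 0 ->
    n%:R * a n @[n --> \oo] --> +oo ->
    MDP P W a (rate_function sigma).
Proof.
move=> X S W bT mT _ PT sF F0T Xinf _ mX HES HES2 sumES _ limES2 a a0 acv qcv.
have mX0 : measurable_fun setT (X0 : Omega -> R) by [].
have normE (f : Omega -> R) : ('N[P]_+oo [EFin \o f] < +oo)%E ->
    \forall w \ae P, `|f w| <= fine 'N[P]_+oo [EFin \o f].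
  move=> flt; apply: filterS (ae_le_Lnorm P (EFin \o f)) => w /=.
  by rewrite -lee_fin fineK// ge0_fin_numE// Lnorm_ge0.
pose c := fine 'N[P]_+oo [EFin \o X0].
have c0 : 0 <= c by rewrite fine_ge0// Lnorm_ge0.
have cc : - c <= c by lra.
(* A version of X0 that is bounded everywhere. *)
pose Y w := clamp (- c) c (X0 w).
have aY : adapted0 F0 Y.
  apply/(adapted0P sF); split; last first.
    by exists c => w; rewrite ler_norml; exact: clamp_in.
  move=> _ [B mB <-]; apply: mX; exists (clamp (- c) c @^-1` B) => //.
  rewrite -[X in measurable X]setTI.
  exact: (clamp_measurable (- c) c (@measurable_id _ R setT)).
have Yc w : `|Y w| <= c by rewrite ler_norml; exact: clamp_in.
have XY : \forall w \ae P, forall i, X0 (iter i T w) = Y (iter i T w).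
  apply: (@ae_iter R d Omega P T mT PT (fun w => X0 w = Y w)); apply: filterS (normE _ Xinf) => w.
  by rewrite ler_norml => h; rewrite /Y clamp_id.
have SY n : \forall w \ae P, S n w = psum T Y n w.
  by apply: filterS XY => w h; apply: eq_bigr => j _; exact: h.
have bS n : bmeas (psum T Y n) := adapted_bmeas mT sF (adapted_psum bT sF F0T n aY).
have mXi i : measurable_fun setT (X i) by apply: measurableT_comp => //; exact: measurable_iter.
have mS n : measurable_fun setT (S n).
  have -> : S n = fun w => \sum_(j <- index_iota 1 n.+1) X j w by [].
  by apply: measurable_sum => j; have := mXi j.
have Sbound n w : psum T Y n w ^+ 2 <= (n%:R * c) ^+ 2.
  rewrite -real_normK ?num_real// ler_sqr ?nnegrE ?mulr_ge0//.
  by have := psum_bound T n w Yc.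
(* The series starts at n = 1; the value 0 at n = 0 is correct since S_0 = 0. *)
pose e n := if n is 0%N then 0 else fine 'N[P]_+oo [EFin \o ES n].
have e0 n : 0 <= e n by case: n => // n; rewrite fine_ge0// Lnorm_ge0.
have term_ge0 n : (0 <= (n%:R `^ (- (3 / 2)))%:E * 'N[P]_+oo [EFin \o ES n])%E.
  by rewrite mule_ge0 ?Lnorm_ge0// lee_fin powR_ge0.
have pos n : 0 < n.+1%:R `^ (- (3 / 2)) :> R by rewrite powR_gt0// ltr0n.
have part N : (\sum_(1 <= n < N) (n%:R `^ (- (3 / 2)))%:E * 'N[P]_+oo [EFin \o ES n] < +oo)%E.
  by apply: le_lt_trans sumES; apply: nneseries_lim_ge.
have ESlt n : ('N[P]_+oo [EFin \o ES n.+1] < +oo)%E.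
  have : ((n.+1%:R `^ (- (3 / 2)))%:E * 'N[P]_+oo [EFin \o ES n.+1] < +oo)%E.
    apply: le_lt_trans (part n.+2); rewrite big_nat_recr//= leeDr//.
    by apply: sume_ge0 => i _; exact: term_ge0.
  have := Lnorm_ge0 P +oo%E (EFin \o ES n.+1).
  by case: ('N[P]_+oo [EFin \o ES n.+1])%E => [r| |]//; rewrite ?ltry// gt0_muley ?lte_fin.
have ubE n : cond_ub P F0 (psum T Y n) (e n) /\ cond_ub P F0 (fun w => - psum T Y n w) (e n).
  case: n => [|n].
    have h (v : Omega -> R) : (forall w, v w = 0) -> cond_ub P F0 v 0.
      move=> v0 U _ _; rewrite mul0r (_ : (fun w => U w * v w) = fun=> 0) ?Ex_cst//.
      by apply/funext => w; rewrite v0 mulr0.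
    by split; apply: h => w; rewrite psum0 ?oppr0.
  have := @cond_exp_ub R d Omega P F0 sF (S n.+1) (ES n.+1) (psum T Y n.+1) (- e n.+1) (e n.+1)
    (HES _) (mS _) (bS _) (SY _).
  rewrite opprK; apply; first by have := e0 n.+1; lra.
  by apply: filterS (normE _ (ESlt n)) => w; rewrite ler_norml.
have tail k : 0 < k -> exists J, forall N, \sum_(J <= j < N) e j / (j%:R * Num.sqrt j%:R) <= k.
  apply: (@bounded_series_tail R _ (fine (\sum_(1 <= n <oo) (n%:R `^ (- (3 / 2)))%:E * 'N[P]_+oo [EFin \o ES n])%E)).
    by move=> n; rewrite divr_ge0// mulr_ge0// sqrtr_ge0.
  move=> N; rewrite -lee_fin fineK; last first.
    by rewrite ge0_fin_numE// nneseries_ge0.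
  apply: le_trans (nneseries_lim_ge (P := xpredT) N (fun n _ _ => term_ge0 n)).
  rewrite -sumEFin le_eqVlt; apply/orP; left; apply/eqP.
  rewrite big_nat [RHS]big_nat; apply: eq_bigr => -[//|n] _.
  rewrite powR_three_halves EFinM muleC; congr (_ * _)%E.
  by rewrite /e fineK// ge0_fin_numE// Lnorm_ge0.
have aN : adapted0 F0 (fun w => - Y w) by exact: bmeasN aY.
have mean_small (k : R) : 0 < k -> exists n0, forall n, (n0 <= n)%N ->
    cond_ub P F0 (psum T Y n) (k * Num.sqrt n%:R) /\
    cond_ub P F0 (fun w => - psum T Y n w) (k * Num.sqrt n%:R).
  move=> k0; have [n0 H] := kronecker_sqrt e0 tail k0.
  exists n0 => n /H; set b := 2 / _ * _ => bk; split.
  - apply: (cond_ubW bk); apply: cond_ub_psum_avg => // m; exact: (ubE m).1.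
  - apply: (cond_ubW bk).
    have -> : (fun w => - psum T Y n w) = psum T (fun w => - Y w) n.
      by apply/funext => w; rewrite psumN.
    apply: cond_ub_psum_avg => // m; rewrite (_ : psum _ _ _ = fun w => - psum T Y m w).
      exact: (ubE m).2.
    by apply/funext => w; rewrite psumN.
have var_limit (k : R) : 0 < k -> exists n0, forall n, (n0 <= n)%N ->
    cond_ub P F0 (fun w => psum T Y n w ^+ 2) ((sigma ^+ 2 + k) * n%:R) /\
    cond_ub P F0 (fun w => - psum T Y n w ^+ 2) (- ((sigma ^+ 2 - k) * n%:R)).
  move=> k0.
  have [N _ HN] : \forall n \near \oo, ('N[P]_+oo [(fun w => (n%:R^-1 * ES2 n w - sigma ^+ 2)%:E)] < k%:E)%E.
    apply: (limES2 [set y | (y < k%:E)%E]); apply: open_nbhs_nbhs; split.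
      exact: open_ereal_lt_ereal.
    by rewrite /= lte_fin.
  exists (maxn N 1) => n; rewrite geq_max => /andP[/HN /= Nk n0].
  have np : 0 < n%:R :> R by rewrite ltr0n.
  apply: (@cond_exp_ub R d Omega P F0 sF (fun w => S n w ^+ 2) (ES2 n)) => //.
  - exact: measurable_funX.
  - exact: bmeasX.
  - by apply: filterS (SY n) => w ->.
  - by rewrite ler_pM2r//; lra.
  apply: filterS (ae_le_Lnorm P (fun w => (n%:R^-1 * ES2 n w - sigma ^+ 2)%:E)) => w /= h.
  have := le_lt_trans h Nk; rewrite lte_fin ltr_norml => /andP[h1 h2].
  apply/andP; split.
    by rewrite mulrC -ler_pdivlMl//; lra.
  by rewrite [leRHS]mulrC -ler_pdivrMl//; lra.
have [n0 var_limit1] := var_limit 1 ltr01.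
(* Below n0 the second moment is bounded through |S_n| <= n c. *)
pose C := sigma ^+ 2 + 1 + n0%:R * c ^+ 2.
have C0 : 0 < C by rewrite ltr_wpDr ?mulr_ge0 ?sqr_ge0// ltr_wpDl ?sqr_ge0.
have var_bound n : cond_ub P F0 (fun w => psum T Y n w ^+ 2) (C * n%:R).
  have [n0n|nn0] := leqP n0 n.
    apply: cond_ubW (var_limit1 n n0n).1; apply: ler_wpM2r => //.
    by rewrite /C lerDl; apply: mulr_ge0 => //; exact: sqr_ge0.
  have ncC : (n%:R * c) ^+ 2 <= C * n%:R.
    have -> : (n%:R * c) ^+ 2 = n%:R * c ^+ 2 * n%:R by ring.
    rewrite ler_wpM2r// /C (@le_trans _ _ (n0%:R * c ^+ 2))//.
      by rewrite ler_wpM2r ?sqr_ge0// ler_nat (ltnW nn0).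
    by rewrite lerDr addr_ge0 ?sqr_ge0.
  exact (@cond_ub_le R d Omega P F0 sF (fun w => psum T Y n w ^+ 2) (fun=> (n%:R * c) ^+ 2) (C * n%:R)
    (bmeasX 2 (bS n)) (bmeas_cst _ _) (Sbound n)
    (cond_ubW ncC (@cond_ub_cst R d Omega P F0 sF ((n%:R * c) ^+ 2)))).
have M := bounded_walk_mdp bT mT PT sF F0T aY Yc C0 var_bound (sqr_ge0 sigma) mean_small var_limit a0 acv qcv (erefl _).
have [good HG] := M; split => // G sG u.
have uE : u = fun n => ((a n)%:E * lne (P [set w | G (skorohod_scale (Num.sqrt (a n))
    (partial_sum_process n (fun i => Y (iter i T w))))]))%E.
  apply/funext => n; rewrite /u; congr (_ * lne _)%E.
  have sc : 0 <= scale_n a n by rewrite divr_ge0// sqrtr_ge0.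
  apply: prob_ae_eq.
  - exact: (measurable_walk_event (Y := X0) mS sc sG).
  - exact: (measurable_walk_event (fun i => (bS i).1) sc sG).
  - apply: filterS XY => w h.
    have WE : W n w = partial_sum_process n (fun i => Y (iter i T w)).
      by congr partial_sum_process; apply/funext => i; exact: h.
    change (G (skorohod_scale (Num.sqrt (a n)) (W n w)) <->
      G (skorohod_scale (Num.sqrt (a n)) (partial_sum_process n (fun i => Y (iter i T w))))).
    by rewrite WE.
rewrite uE; exact: HG.
Qed.
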